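(* Let $K\subset\mathbb{R}^d$ be a compact convex set that is not a segment and let $b\ge1$. Then there exist $x,y\in K$ and positive constants $a_0$, $\sigma_0$ and $n_0$ depending on $m$, $p$, $\beta$ and $b$ such that for all $0<a\le a_0$, $0<\sigma\le\sigma_0$ and all integers $n\ge n_0$, $$\min_{\hat D\in\mathcal{D}_n}\ \max_{\mu\in\mathcal{M}_{K,a,b,\sigma}}\ \mathbb{E}\left[\left|\hat D-D_\mu(x,y)\right|\right]\ \ge\ C\,\frac{\|x-y\|^{\beta+1}}{n^{\min(\frac1b,\frac12)}},$$ where $\mathcal{D}_n$ is the set of possible estimators of $D_\mu(x,y)$ from $n$ sample points and $C>0$ is a constant depending on $m$, $p$, $\beta$ and $b$.
   Context: $\mathbb{R}^d$ carries the Euclidean norm $\|\cdot\|$; $B(x,r)$ is the open ball. Fixed real parameters: $m\in(0,1]$, $p\ge 1$, $\beta\ge 1$. For a probability measure $\mu$ on $\mathbb{R}^d$, $\delta_{\mu,u}(x)=\inf\{r>0:\mu(B(x,r))>u\}$ and the distance-to-measure is $d_\mu(x)=\left(\frac1m\int_0^m\delta_{\mu,u}(x)^p\,du\right)^{1/p}$. A rectifiable path is a continuous $\gamma:[0,1]\to\mathbb{R}^d$ of finite Euclidean length $|\gamma|=\int_0^1\|\dot\gamma(t)\|\,dt$, parametrized so as to be Lipschitz (always possible, e.g. with constant speed). Its FDTM length is $D_\mu(\gamma)=\int_0^1 d_\mu(\gamma(t))^\beta\|\dot\gamma(t)\|\,dt$. For a closed set $F\subset\mathbb{R}^d$ (the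 domain) and $x,y\in\mathbb{R}^d$, $\Gamma_F(x,y)$ is the set of rectifiable paths $\gamma$ with $\gamma(0)=x$, $\gamma(1)=y$ such that for every open interval $I\subset[0,1]$ with $\gamma(I)\subset\mathbb{R}^d\setminus F$ there is a unit vector $u\in\mathbb{R}^d$ with $\dot\gamma(t)=\|\dot\gamma(t)\|u$ for all $t\in I$ where $\dot\gamma$ is defined. The Fermat distance-to-measure (FDTM) is $D_{\mu,F}(x,y)=\inf_{\gamma\in\Gamma_F(x,y)}D_\mu(\gamma)$, and $D_\mu(x,y)=D_{\mu,\mathrm{supp}(\mu)}(x,y)$. $\mathcal{M}_{K,a,b,\sigma}$ is the set of probability measures $\mu$ on $\mathbb{R}^d$ such that: (i) $\mathrm{supp}(\mu)\subset K$; (ii) $\mu$ is $(a,b)$-standard: $\mu(B(x,r))\ge ar^b$ for all $x\in\mathrm{supp}(\mu)$ and $0<r\le a^{-1/b}$; (iii) $\min_{\mathbb{R}^d}d_\mu\ge\sigma$; (iv) $\mathrm{supp}(\mu)$ is connected. Here $a>0$, $b\ge1$, $\sigma>0$. An estimator from $n$ sample points is a function $\hat D=\hat D(X_1,\dots,X_n)$ of $X_1,\dots,X_n$, which are i.i.d. with law $\mu$; the expectation is over this sample.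
   Formalization: σ_0 may depend on K, x and y: for σ greater than the diameter of K the class of measures is empty, so no σ_0 depending only on m, p, β and b can work for all K; K is assumed nonempty and a single point counts as a segment. *)

(* Defs.v *)
From HB Require Import structures.
From mathcomp Require Import all_boot all_order all_algebra.
From mathcomp Require Import all_classical all_reals all_analysis.

Set Implicit Arguments.
Unset Strict Implicit.
Unset Printing Implicit Defensive.

Import Order.TTheory GRing.Theory Num.Theory.
Import numFieldNormedType.Exports.

Local Open Scope classical_set_scope.
Local Open Scope ring_scope.

(* R^d is 'rV[R]_d, whose library topology is the usual one; its library norm
   is the sup norm, so the Euclidean norm is defined here. *)
Definition enorm (R : realType) (d : nat) (x : 'rV[R]_d) : R :=
  Num.sqrt (\sum_(i < d) x ord0 i ^+ 2).

Definition eball (R : realType) (d : nat) (x : 'rV[R]_d) (r : R) :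
    set 'rV[R]_d :=
  [set y | enorm (y - x) < r].

Definition segment (R : realType) (d : nat) (u v : 'rV[R]_d) : set 'rV[R]_d :=
  [set (1 - t) *: u + t *: v | t in `[0, 1]].

(* R^d with its Borel sigma-algebra. *)
Notation borelRd R d := (g_sigma_algebraType (@open 'rV[R]_d)).

Section iid_sample.
Context d (T : measurableType d) (R : realType).

Definition cons_sample (n : nat) (z : T * n.-tuple T) : n.+1.-tuple T :=
  [tuple of z.1 :: z.2].

Lemma measurable_cons_sample n : measurable_fun setT (@cons_sample n).
Proof. exact: measurable_cons. Qed.

HB.instance Definition _ n :=
  isMeasurableFun.Build _ _ _ _ (@cons_sample n) (@measurable_cons_sample n).

(* The product measure mu^(x)n, i.e. the joint law of n i.i.d. points of
   law mu. *)
Fixpoint iid_law (mu : probability T R) (n : nat) :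
    probability (n.-tuple T) R :=
  match n with
  | 0 => \d_([tuple])
  | k.+1 => distribution (mu \x iid_law mu k)%E (@cons_sample k)
  end.

Lemma iid_lawE (mu : probability T R) n (A : 'I_n -> set T) :
  (forall i, measurable (A i)) ->
  iid_law mu n [set s | forall i, A i (tnth s i)] = (\prod_(i < n) mu (A i))%E.
Proof.
elim: n A => [|n IHn] A mA.
  rewrite big_ord0 /= diracE mem_set//; by case.
rewrite big_ord_recl -IHn//= /distribution /pushforward.
rewrite -product_measure1E//.
  congr (_ _); apply/seteqP; split => -[x s] /=.
    move=> As; split => [|i]; first by have := As ord0.
    by have := As (lift ord0 i); rewrite tnthS.
  move=> [Ax As] i; have [->//|i0] := eqVneq i ord0.
  by case: (unliftP ord0 i) i0 => [j ->|->]; rewrite ?eqxx// tnthS.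
rewrite (_ : [set s | _] = \bigcap_i
    ((fun s : n.-tuple T => tnth s i) @^-1` A (lift ord0 i))).
  apply: fin_bigcap_measurable => // i _.
  by rewrite -[X in measurable X]setTI; apply: measurable_tnth.
by apply/seteqP; split => s /= As i; [move=> _|]; exact: As.
Qed.

End iid_sample.

Section fermat_distance_to_measure.
Context (R : realType) (d : nat).
Implicit Types (mu : probability (borelRd R d) R) (x y : 'rV[R]_d).
Implicit Types (F K : set 'rV[R]_d) (gamma : R -> 'rV[R]_d).

Definition supp mu : set 'rV[R]_d :=
  [set x | forall r : R, 0 < r -> (0 < mu (eball x r))%E].

(* Equal to +oo when no ball has mass > u. *)
Definition delta mu (u : R) x : \bar R :=
  ereal_inf [set r%:E | r in [set r : R | 0 < r /\ (u%:E < mu (eball x r))%E]].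

Definition dtm (m p : R) mu x : \bar R :=
  (((m^-1)%:E * \int[lebesgue_measure]_(u in `[0%R, m]) (delta mu u x `^ p))
    `^ (p^-1))%E.

(* Only the values of gamma on [0, 1] matter. A rectifiable path is taken in a
   Lipschitz parametrization, hence is differentiable almost everywhere. *)
Definition rectifiable_path gamma : Prop :=
  exists k : R, forall s t : R, s \in `[0, 1] -> t \in `[0, 1] ->
    enorm (gamma s - gamma t) <= k * `|s - t|.

(* The integrand is meaningful only where gamma is differentiable, that is, off
   a null set. *)
Definition fdtm_length (m p beta : R) mu gamma : \bar R :=
  (\int[lebesgue_measure]_(t in `[0%R, 1%R])
     (dtm m p mu (gamma t) `^ beta * (enorm (derive1 gamma t))%:E))%E.

Definition admissible_path F x y gamma : Prop :=
  [/\ rectifiable_path gamma, gamma 0 = x, gamma 1 = y &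
      forall s t : R, 0 <= s -> s < t -> t <= 1 ->
        gamma @` `]s, t[ `<=` ~` F ->
        exists2 u : 'rV[R]_d, enorm u = 1 &
          forall v : R, v \in `]s, t[ -> derivable gamma v 1 ->
            derive1 gamma v = enorm (derive1 gamma v) *: u].

Definition fdtm_dom (m p beta : R) mu F x y : \bar R :=
  ereal_inf (fdtm_length m p beta mu @` admissible_path F x y).

Definition fdtm (m p beta : R) mu x y : \bar R :=
  fdtm_dom m p beta mu (supp mu) x y.

Definition standard (a b : R) mu : Prop :=
  forall x (r : R), supp mu x -> 0 < r -> r <= a `^ (- b^-1) ->
    ((a * r `^ b)%:E <= mu (eball x r))%E.

Definition measure_class (m p : R) K (a b sigma : R) :
    set (probability (borelRd R d) R) :=
  [set mu | [/\ supp mu `<=` K, standard a b mu,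
                forall x, (sigma%:E <= dtm m p mu x)%E &
                connected (supp mu)]].

(* The expected error of the estimator Dhat of D_mu(x, y). *)
Definition risk (m p beta : R) (n : nat) x y
    (Dhat : n.-tuple (borelRd R d) -> R) mu : \bar R :=
  (\int[iid_law mu n]_X `|(Dhat X)%:E - fdtm m p beta mu x y|)%E.

(* The minimum over estimators and the maximum over measures are an infimum and
   a supremum in \bar R. *)
Definition minimax_risk (m p beta : R) K (a b sigma : R) (n : nat) x y :
    \bar R :=
  ereal_inf
    [set ereal_sup (risk m p beta x y Dhat @` measure_class m p K a b sigma)
    | Dhat in [set Dhat : n.-tuple (borelRd R d) -> R |
               measurable_fun setT Dhat]].

End fermat_distance_to_measure.

(* Main.v *)
(** Le Cam's two-point method. Since K is not a segment, it contains a rectangle;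
    in its coordinates (a, b) = c + a e1 + b e2, with e1, e2 orthogonal of length
    rho, let O = (0, 0), G = (0, 1), A = (N, 1), x = (0, -s) and y = (0, s).
    The measure mu0 puts mass 1/N uniformly on the arm [O, G] and the rest
    uniformly on [G, A]. The measure mu1 moves a mass eta1 ~ n^(-1/2) from the
    second arm to the first if b <= 2; if b > 2 it moves a mass eta2 ~ 1/n to a
    third arm from O to the tip (eps, 0), eps ~ n^(-1/b), which keeps mu1
    standard. In both cases the chi-square distance between mu0 and
    mu1 is O(1/n), so that n samples do not separate them.

    Close to O the support of mu0 lies on the line (x y), and the direction of an
    admissible path is constant off the support, so a path from x to y that stays
    close to O never leaves this line; the other paths are too long. Under mu1 the
    path from x to the tip to y is admissible. It is longer than the segment by a
    factor 1 + O(eps^2) only, while d_mu is smaller along it by a factor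
    1 - const (eta1 + eps), because nearly all quantiles of the distance are
    attained in the direction of e1. The Fermat distances of mu0 and mu1 thus
    differ by a multiple of eta1 + eps. *)

Require Import Defs.
From HB Require Import structures.
From mathcomp Require Import all_boot all_order all_algebra.
From mathcomp Require Import all_classical all_reals all_analysis.
From mathcomp Require Import measurable_realfun ring lra.

Set Implicit Arguments.
Unset Strict Implicit.
Unset Printing Implicit Defensive.

Import Order.TTheory GRing.Theory Num.Theory.
Import numFieldNormedType.Exports.

Local Open Scope classical_set_scope.
Local Open Scope ring_scope.

(** * Euclidean space *)

Section euclidean.
Context (R : realType) (d : nat).
Implicit Types u v w : 'rV[R]_d.

(** The two perturbations have different sizes because of the first order of the chi-square
    distance: [mu0] already charges the two arms between which [eta1] moves, so the linear terms
    cancel and the cost is of order [eta1 ^+ 2], whereas the third arm is new and costs [eta2]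
    itself. Standardness at the tip then asks [eta2] to dominate [eps ^ b]. The quantiles of mass
    below [3 / N] may grow under [mu1]. The value [N = 192 p 5^(p-1) / m] is what makes this loss
    smaller than the gain on the quantiles between [3 / N] and [m / 2]. The half-distance [s] is
    fixed, independent of [n]: it is so small that a path leaving the ball of radius [rho / 2] costs
    too much even at the least value of d_mu. The rest is homogeneous in [rho], which is why [C]
    does not depend on [K]. A path is an arbitrary Lipschitz curve, and the integrand of its length
    is not known to be measurable. Lengths are bounded below by calibration: a scalar function of
    the path is found whose derivative is almost everywhere at most the integrand. *)

Definition dot u v : R := \sum_(i < d) u ord0 i * v ord0 i.

Lemma dotC u v : dot u v = dot v u.
Proof. by apply: eq_bigr => i _; rewrite mulrC. Qed.

Lemma dotDl u v w : dot (u + v) w = dot u w + dot v w.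
Proof. by rewrite -big_split/=; apply: eq_bigr => i _; rewrite mxE mulrDl. Qed.

Lemma dotZl a u w : dot (a *: u) w = a * dot u w.
Proof. by rewrite mulr_sumr; apply: eq_bigr => i _; rewrite mxE mulrA. Qed.

Lemma dotNl u w : dot (- u) w = - dot u w.
Proof. by rewrite -scaleN1r dotZl mulN1r. Qed.

Lemma dotBl u v w : dot (u - v) w = dot u w - dot v w.
Proof. by rewrite dotDl dotNl. Qed.

Lemma dotDr u v w : dot w (u + v) = dot w u + dot w v.
Proof. by rewrite dotC dotDl !(dotC w). Qed.

Lemma dotZr a u w : dot w (a *: u) = a * dot w u.
Proof. by rewrite dotC dotZl (dotC w). Qed.

Lemma dotNr u w : dot w (- u) = - dot w u.
Proof. by rewrite dotC dotNl (dotC w). Qed.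

Lemma dotBr u v w : dot w (u - v) = dot w u - dot w v.
Proof. by rewrite dotC dotBl !(dotC w). Qed.

Lemma dot_ge0 u : 0 <= dot u u.
Proof. by apply: sumr_ge0 => i _; rewrite -expr2 sqr_ge0. Qed.

Lemma enormE u : enorm u = Num.sqrt (dot u u).
Proof. by congr Num.sqrt; apply: eq_bigr => i _; rewrite expr2. Qed.

Lemma enorm_ge0 u : 0 <= enorm u. Proof. exact: sqrtr_ge0. Qed.

Lemma enorm_sqr u : enorm u ^+ 2 = dot u u.
Proof. by rewrite enormE sqr_sqrtr// dot_ge0. Qed.

Lemma dot_eq0 u : dot u u = 0 -> u = 0.
Proof.
move=> /eqP; rewrite psumr_eq0 => [/allP u0|i _]; last by rewrite -expr2 sqr_ge0.
apply/rowP => i; rewrite mxE; apply/eqP.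
by have := u0 i (mem_index_enum _); rewrite /= -expr2 sqrf_eq0.
Qed.

Lemma enorm0_eq0 u : enorm u = 0 -> u = 0.
Proof. by move=> u0; apply: dot_eq0; rewrite -enorm_sqr u0 expr0n. Qed.

Lemma enormZ a u : enorm (a *: u) = `|a| * enorm u.
Proof.
by rewrite !enormE dotZl dotZr mulrA -expr2 sqrtrM ?sqr_ge0// sqrtr_sqr.
Qed.

Lemma enormN u : enorm (- u) = enorm u.
Proof. by rewrite -scaleN1r enormZ normrN1 mul1r. Qed.

Lemma enorm_distC u v : enorm (u - v) = enorm (v - u).
Proof. by rewrite -enormN opprB. Qed.

Lemma enorm0 : enorm (0 : 'rV[R]_d) = 0.
Proof. by rewrite -(scale0r 0) enormZ normr0 mul0r. Qed.

Lemma dot_le u v : dot u v <= enorm u * enorm v.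
Proof.
have [v0|v0] := eqVneq (enorm v) 0.
  by rewrite v0 mulr0 (enorm0_eq0 v0) -(scale0r 0) dotZr mul0r.
have vv0 : 0 < dot v v by rewrite -enorm_sqr exprn_gt0// lt_neqAle eq_sym v0 enorm_ge0.
have := dot_ge0 (dot v v *: u - dot u v *: v).
rewrite dotBl !dotBr !dotZl !dotZr (dotC v u).
have -> : dot v v * (dot v v * dot u u) - dot v v * (dot u v * dot u v) -
  (dot u v * (dot v v * dot u v) - dot u v * (dot u v * dot v v)) =
  dot v v * (dot u u * dot v v - dot u v ^+ 2) by ring.
rewrite pmulr_rge0// subr_ge0 -!enorm_sqr -exprMn => h.
have [uv0|uv0] := leP (dot u v) 0; first by rewrite (le_trans uv0)// mulr_ge0// enorm_ge0.
by rewrite -(@ler_pXn2r _ 2) ?nnegrE ?(ltW uv0) ?mulr_ge0 ?enorm_ge0.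
Qed.

Lemma enormD u v : enorm (u + v) <= enorm u + enorm v.
Proof.
rewrite -(@ler_pXn2r _ 2) ?nnegrE ?addr_ge0 ?enorm_ge0//.
rewrite enorm_sqr dotDl !dotDr (dotC v u) sqrrD !enorm_sqr.
have := dot_le u v; lra.
Qed.

Lemma enorm_triangle u v w : enorm (u - w) <= enorm (u - v) + enorm (v - w).
Proof. by rewrite (le_trans _ (enormD _ _))// addrA subrK. Qed.

Lemma coord_le_enorm u i : `|u ord0 i| <= enorm u.
Proof.
rewrite -(@ler_pXn2r _ 2)// ?nnegrE ?enorm_ge0// enorm_sqr real_normK ?num_real//.
rewrite /dot (bigD1 i)//= -expr2 lerDl; apply: sumr_ge0 => j _.
by rewrite -expr2 sqr_ge0.
Qed.

Lemma norm_le_enorm u : `|u| <= enorm u.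
Proof.
rewrite /Num.Def.normr/= mx_normrE; apply: (big_ind (fun x => x <= enorm u)).
- exact: enorm_ge0.
- by move=> x y xu yu; rewrite ge_max xu yu.
- by move=> [i j] _ /=; rewrite (ord1 i) coord_le_enorm.
Qed.

Lemma enorm_le_norm u : enorm u <= d%:R * `|u|.
Proof.
have ui i : `|u ord0 i| <= `|u|.
  by rewrite {2}/Num.Def.normr/= mx_normrE; apply: (le_bigmax _ _ (ord0, i)).
rewrite -(@ler_pXn2r _ 2)// ?nnegrE ?enorm_ge0 ?mulr_ge0// enorm_sqr.
apply: (@le_trans _ _ (\sum_(i < d) `|u| ^+ 2)).
  apply: ler_sum => i _; rewrite -expr2 -real_normK ?num_real//.
  by rewrite ler_pXn2r ?nnegrE.
rewrite sumr_const card_ord exprMn -[X in X <= _]mulr_natl ler_wpM2r ?sqr_ge0//.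
by rewrite -natrX ler_nat; case: (d) => // k; rewrite leq_pmull.
Qed.

Lemma enorm_continuous : continuous (@enorm R d).
Proof.
move=> u; apply/(@cvgrPdist_le _ _ _ (nbhs u) (nbhs_filter u)) => e e0.
have d0 : (0 : R) < d%:R + 1 by rewrite ltr_wpDl.
near=> v; have uv : `|enorm u - enorm v| <= enorm (u - v).
  rewrite ler_norml; apply/andP; split.
    rewrite lerNl opprB enorm_distC lerBlDr -{1}(subrK u v); exact: enormD.
  by rewrite lerBlDr -{1}(subrK v u) enormD.
apply: (le_trans uv); apply: (le_trans (enorm_le_norm _)).
apply: (@le_trans _ _ ((d%:R + 1) * `|u - v|)); first by rewrite ler_wpM2r// lerDl.
rewrite mulrC -ler_pdivlMr//; near: v.
by apply: cvgr_dist_le; [exact: cvg_id|exact: divr_gt0].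
Unshelve. all: by end_near. Qed.

Lemma eball_open u r : open (eball u r).
Proof.
rewrite (_ : eball u r = (fun v => enorm (v - u)) @^-1` [set x | x < r])//.
apply: open_comp; last exact: open_lt.
move=> v _; apply: (@continuous_comp _ _ _ (fun w => w - u) (@enorm R d)).
  apply: (@continuousB _ _ _ id (fun=> u)); [exact: cvg_id|exact: cst_continuous].
exact: enorm_continuous.
Qed.

Lemma open_eballP (A : set 'rV[R]_d) u : open A -> A u ->
  exists2 r, 0 < r & eball u r `<=` A.
Proof.
move=> oA Au; have /nbhs_ballP[r /= r0 rA] : nbhs u A by exact: open_nbhs_nbhs.
exists r => // v vur; apply: rA; rewrite -ball_normE/= distrC.
exact: le_lt_trans (norm_le_enorm _) vur.
Qed.

Lemma measurable_open (A : set 'rV[R]_d) : open A ->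
  measurable (A : set (borelRd R d)).
Proof.
move=> oA; have h := @sub_sigma_algebra _ setT (@open 'rV[R]_d) A oA; exact: h.
Qed.

Lemma measurable_eball u r : measurable (eball u r : set (borelRd R d)).
Proof. apply: measurable_open; exact: eball_open. Qed.

End euclidean.

(** * Integrals of non-measurable functions and Lipschitz paths *)

Section integral_bounds.
Local Open Scope ereal_scope.
Context d (T : measurableType d) (R : realType).
Variable mu : {measure set T -> \bar R}.

(** The integral of a nonnegative function is a supremum over the simple functions below it, hence
    monotone with no measurability. This serves for [fdtm_length], whose integrand is arbitrary. *)
Lemma ge0_le_integral_nomeas (D : set T) (f1 f2 : T -> \bar R) :
  (forall x, D x -> 0 <= f1 x) -> (forall x, D x -> f1 x <= f2 x) ->
  \int[mu]_(x in D) f1 x <= \int[mu]_(x in D) f2 x.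
Proof.
move=> f10 f12.
rewrite !ge0_integralE//; last by move=> x Dx; exact: le_trans (f10 _ Dx) (f12 _ Dx).
apply: ge_ereal_sup => _ [h /= hf <-]; apply: ereal_sup_ubound; exists h => //= x.
by apply: (le_trans (hf x)); exact: lee_restrict.
Qed.

(** For lower bounds on lengths: the smaller function is an explicit density, which can be cut off
    on the null set; the larger one is the integrand of a length. *)
Lemma ae_le_integral_nomeas (D E N : set T) (f1 f2 : T -> \bar R) :
  measurable D -> D `<=` E -> mu.-negligible N -> measurable_fun D f1 ->
  (forall x, D x -> 0 <= f1 x) -> (forall x, E x -> 0 <= f2 x) ->
  (forall x, D x -> ~ N x -> f1 x <= f2 x) ->
  \int[mu]_(x in D) f1 x <= \int[mu]_(x in E) f2 x.
Proof.
move=> mD DE [A [mA A0 NA]] mf1 f10 f20 f12.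
rewrite (ge0_negligible_integral mA)// integral_mkcond [leRHS]integral_mkcond.
apply: ge0_le_integral_nomeas => x _.
  by apply: erestrict_ge0 => y [Dy _]; exact: f10.
rewrite !patchE; case: ifPn => [/set_mem[Dx nAx]|_].
  by rewrite mem_set; [apply: f12 => // /NA|exact: DE].
by case: ifPn => // /set_mem /f20.
Qed.

Lemma ge0_ae_le_integral_nomeas (D N : set T) (f1 f2 : T -> \bar R) :
  measurable D -> mu.-negligible N -> measurable_fun D f2 ->
  (forall x, D x -> 0 <= f1 x) -> (forall x, D x -> 0 <= f2 x) ->
  (forall x, D x -> ~ N x -> f1 x <= f2 x) ->
  \int[mu]_(x in D) f1 x <= \int[mu]_(x in D) f2 x.
Proof.
move=> mD [A [mA A0 NA]] mf2 f10 f20 f12.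
(* Infinite on the null set and equal to [f2] elsewhere, since [+oo * 0 = 0]: it dominates [f1] at
   every point and has the same integral as [f2]. *)
pose g x := f2 x + +oo * (\1_A x)%:E.
have i0 x : 0 <= +oo * (\1_A x)%:E :> \bar R by rewrite mule_ge0// lee_fin indicE.
have mi : measurable_fun D (fun x => +oo * (\1_A x)%:E : \bar R).
  by apply: emeasurable_funM => //; apply/measurable_EFinP; exact: measurable_indic.
have mg : measurable_fun D g by apply: emeasurable_funD.
have g0 x : D x -> 0 <= g x by move=> Dx; rewrite adde_ge0// f20.
apply: (@le_trans _ _ (\int[mu]_(x in D) g x)).
  apply: ge0_le_integral_nomeas => // x Dx; rewrite /g indicE.
  have [/set_mem Ax|/negP nA] := boolP (x \in A).
    by rewrite mule1 addey ?leey// -ltNye (lt_le_trans _ (f20 _ Dx))// ltNy0.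
  by rewrite mule0 adde0; apply: f12 => // /NA /mem_set.
rewrite (ge0_negligible_integral mA)// [leRHS](ge0_negligible_integral mA)//.
apply: ge0_le_integral_nomeas => x [Dx nAx]; first exact: g0.
by rewrite /g indicE memNset// mule0 adde0.
Qed.

End integral_bounds.

(** * Lipschitz functions as integrals of their derivatives *)

Section lipschitz_ftc.
Context (R : realType).
Local Notation mu := (@lebesgue_measure R).

Lemma lipschitz_continuous (h : R -> R) (k : R) :
  (forall x y, `|h x - h y| <= k * `|x - y|) -> continuous h.
Proof.
move=> hk x; apply/cvgrPdist_le => e e0.
have k0 : 0 < `|k| + 1 by rewrite ltr_wpDl.
near=> y; apply: (le_trans (hk _ _)).
apply: (@le_trans _ _ ((`|k| + 1) * `|x - y|)).
  by rewrite ler_wpM2r// (le_trans (ler_norm _))// lerDl.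
rewrite mulrC -ler_pdivlMr//; near: y.
by apply: cvgr_dist_le; [exact: cvg_id|exact: divr_gt0].
Unshelve. all: by end_near. Qed.

Lemma lebesgue_stieltjes_ocitv (f : cumulative R R) (a b : R) : a <= b ->
  lebesgue_stieltjes_measure f `]a, b]%classic = (f b - f a)%:E.
Proof.
move=> ab; rewrite /lebesgue_stieltjes_measure /measure_extension.
rewrite measurable_mu_extE/=; last exact: is_ocitv.
by rewrite wlength_itv_bnd.
Qed.

(** Almost everywhere differentiability and the fundamental theorem of calculus for Lipschitz
    functions. Both [h x + k x] and [k x - h x] are nondecreasing and their sum is [2 k x], so each
    Stieltjes measure is dominated by a multiple of Lebesgue measure. The Radon-Nikodym density
    [psi] of the first is h' + k; Lebesgue differentiation recovers the derivative from it. *)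
Lemma lipschitz_density (h : R -> R) (k : R) : 0 < k ->
  (forall x y, `|h x - h y| <= k * `|x - y|) ->
  exists psi : R -> R, [/\ forall x, 0 <= psi x, measurable_fun setT psi,
    {ae mu, forall x, 0 < x < 1 -> derivable h x 1 /\ derive1 h x = psi x - k} &
    forall s t, 0 <= s -> s <= t -> t <= 1 ->
      (\int[mu]_(x in `]s, t]) (psi x)%:E = (h t - h s + k * (t - s))%:E)%E].
Proof.
move=> k0 hk.
have hc := lipschitz_continuous hk.
have hb x y : x <= y -> - (k * (y - x)) <= h y - h x <= k * (y - x).
  by move=> xy; rewrite -ler_norml (le_trans (hk _ _))// ger0_norm// subr_ge0.
pose g1 x := h x + k * x; pose g2 x := k * x - h x.
have nd1 : nondecreasing g1.
  move=> x y xy; rewrite /g1 -subr_ge0; have /andP[+ _] := hb _ _ xy; lra.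
have nd2 : nondecreasing g2.
  move=> x y xy; rewrite /g2 -subr_ge0; have /andP[_ +] := hb _ _ xy; lra.
have kc : continuous (fun x : R => k * x).
  by move=> x; apply: cvgM; [exact: cvg_cst|exact: cvg_id].
have rc1 : right_continuous g1.
  by apply: right_continuousW => x; apply: cvgD; [exact: hc|exact: kc].
have rc2 : right_continuous g2.
  by apply: right_continuousW => x; apply: cvgB; [exact: kc|exact: hc].
pose c1 : cumulative R R := HB.pack g1 (isCumulative.Build R _ R g1 nd1 rc1).
pose c2 : cumulative R R := HB.pack g2 (isCumulative.Build R _ R g2 nd2 rc2).
pose nu1 := lebesgue_stieltjes_measure c1.
pose nu2 := lebesgue_stieltjes_measure c2.
have k20 : 0 <= (2 * k)^-1 by rewrite invr_ge0 mulr_ge0// ltW.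
pose la := mscale (NngNum k20) (measure_add nu1 nu2).
have laV A : (la A = ((2 * k)^-1)%:E * (nu1 A + nu2 A))%E.
  by rewrite /la /mscale; congr (_ * _)%E; exact: measure_addE.
have laE A : measurable A -> mu A = la A.
  move=> mA; apply: lebesgue_measure_unique => // _ [[a b] _ <-] /=.
  have [ab|/ltW ba] := leP a b; last first.
    by rewrite set_itv_ge ?measure0// bnd_simp -leNgt.
  rewrite [RHS]laV lebesgue_measure_itv/=.
  have -> : nu1 `]a, b]%classic = (g1 b - g1 a)%:E by exact: lebesgue_stieltjes_ocitv.
  have -> : nu2 `]a, b]%classic = (g2 b - g2 a)%:E by exact: lebesgue_stieltjes_ocitv.
  rewrite -EFinD -EFinM; case: ifPn => [_|].
    by congr (_%:E); rewrite /g1 /g2; field; rewrite gt_eqF.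
  rewrite lte_fin -leNgt => ba.
  have -> : a = b by apply/eqP; rewrite eq_le ab ba.
  by rewrite !subrr addr0 mulr0.
have m01 : measurable (`]0, 1]%classic : set (measurableTypeR R)) by exact: measurable_itv.
have nu1fin : (nu1 `]0%R, 1%R]%classic < +oo)%E.
  by rewrite /nu1 lebesgue_stieltjes_ocitv// ltry.
(* The restriction makes the measure finite, so that its density is integrable. *)
pose nu := mfrestr m01 nu1fin.
have numu : nu `<< mu.
  apply/null_content_dominatesP => A mA muA0.
  have /eqP : la A = 0%E by rewrite -laE.
  rewrite laV.
  rewrite mule_eq0 eqe invr_eq0 mulf_eq0 pnatr_eq0 (gt_eqF k0)/=.
  rewrite padde_eq0 ?measure_ge0// => /andP[/eqP nu10 _].
  apply/eqP; rewrite eq_le measure_ge0 andbT -nu10; apply: le_measure; rewrite ?inE//.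
  exact: measurableI.
have [f [f0 ffin fint fE]] := radon_nikodym_sigma_finite numu.
pose psi := fine \o f.
have psiE x : (psi x)%:E = f x by rewrite /psi/= fineK.
have psi0 x : 0 <= psi x by rewrite -lee_fin psiE.
have intpsi : mu.-integrable setT (EFin \o psi).
  by apply: eq_integrable fint => // x _; rewrite /= psiE.
have Fst s t : 0 <= s -> s <= t -> t <= 1 ->
    (\int[mu]_(x in `]s, t]) (psi x)%:E = (h t - h s + k * (t - s))%:E)%E.
  move=> s0 st t1; under eq_integral do rewrite psiE.
  have nust : nu `]s, t]%classic = nu1 `]s, t]%classic.
    rewrite /nu /mfrestr /mrestr; congr (nu1 _); apply: setIidl.
    by apply: subset_itv; rewrite bnd_simp.
  rewrite -fE//; apply: (eq_trans nust); rewrite /nu1.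
  by rewrite lebesgue_stieltjes_ocitv//=; congr (_%:E); rewrite /g1; lra.
exists psi; split => //.
  by have /integrableP[/measurable_EFinP] := intpsi.
have lpsi : locally_integrable setT psi.
  have := @integrable_locally_restrict R psi setT measurableT intpsi.
  by rewrite patch_setT.
have := lebesgue_differentiation lpsi.
apply: filterS; first exact: (ae_filter_ringOfSetsType mu).
move=> x lx /andP[x0 x1].
have [|||dF F'x] := @FTC1_lebesgue_pt R psi (BRight 0) x (x + 1) _ _ _ lx.
- by rewrite ltrDl.
- exact: integrableS intpsi.
- by rewrite lte_fin.
set F := (fun y => _) in dF F'x.
have dFx : is_derive x 1 F (psi x) by split; [exact: dF|rewrite -F'x derive1E].
have dhx : is_derive x 1 (fun y => F y + (h 0 - k * y)) (psi x - k).
  apply: is_deriveD; rewrite -[X in is_derive _ _ _ (- X)]mulr1 -sub0r.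
  by apply: is_deriveB; apply: is_deriveZ.
have : is_derive x 1 h (psi x - k).
  apply: near_eq_is_derive dhx; near=> y.
  have y01 : 0 < y < 1.
    by apply/andP; split; near: y; [exact: lt_nbhsr|exact: lt_nbhsl].
  have /andP[y0 y1] := y01.
  rewrite /F /Rintegral Fst ?(ltW y0) ?(ltW y1)//=; lra.
by move=> [dh h'x]; split => //; rewrite derive1E h'x.
Unshelve. all: by end_near. Qed.

(** Composition with the projection of the line onto [0, 1]: paths are controlled on [0, 1] only,
    while [lipschitz_density] concerns functions on the whole line. *)
Lemma lipschitz_clamp (h : R -> R) (k : R) : 0 <= k ->
  (forall x y, x \in `[0, 1] -> y \in `[0, 1] -> `|h x - h y| <= k * `|x - y|) ->
  exists2 H : R -> R, forall x y, `|H x - H y| <= k * `|x - y| &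
    forall x, x \in `[0, 1] -> H x = h x.
Proof.
move=> k0 hk; pose c (x : R) := Num.max 0 (Num.min x 1).
have c01 x : c x \in `[0, 1].
  by rewrite in_itv/= /c le_max lexx ge_max ler01 ge_min lexx orbT.
exists (h \o c) => [x y|x /=].
  apply: (le_trans (hk _ _ (c01 x) (c01 y))); rewrite ler_wpM2l// /c.
  wlog xy : x y / x <= y.
    move=> H; have [xy|/ltW yx] := leP x y; first exact: H.
    by rewrite distrC (distrC x) H.
  rewrite (ler0_norm (_ : x - y <= 0)) ?subr_le0// opprB.
  rewrite ler_norml; apply/andP; clear -xy.
  by case: (leP x 1) => x1; case: (leP y 1) => y1; rewrite /Order.max;
    repeat case: ltP => ?; split; lra.
rewrite in_itv/= => /andP[x0 x1]; congr h; rewrite /c.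
by rewrite min_l// max_r.
Qed.

(** The calibration principle, with [G] the integrand of a length and [h] a scalar function of the
    path. With [G = 0] it says that a coordinate with nonpositive derivative does not increase. *)
Lemma lipschitz_increment_le (h : R -> R) (k : R) (G : R -> \bar R)
    (N : set R) (s t : R) :
  (forall x y, x \in `[0, 1] -> y \in `[0, 1] -> `|h x - h y| <= k * `|x - y|) ->
  0 <= s -> s <= t -> t <= 1 -> (forall x, 0 <= G x)%E -> mu.-negligible N ->
  (forall v, s < v < t -> ~ N v -> derivable h v 1 -> ((derive1 h v)%:E <= G v)%E) ->
  ((h t - h s)%:E <= \int[mu]_(v in `[0%R, 1%R]) G v)%E.
Proof.
move=> hk s0 st t1 G0 nN hG.
have k0 : 0 < `|k| + 1 by rewrite ltr_wpDl.
have [|H Hk Hh] := @lipschitz_clamp h (`|k| + 1) (ltW k0).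
  move=> x y x01 y01; apply: (le_trans (hk _ _ x01 y01)).
  by rewrite ler_wpM2r// (le_trans (ler_norm _))// lerDl.
have [psi [psi0 mpsi [N1 [mN1 N10 dN1]] Ist]] := lipschitz_density k0 Hk.
have hH v : v \in `[0, 1] -> h v = H v by move=> /Hh.
rewrite !hH ?in_itv/= ?s0 ?t1 ?(le_trans s0 st) ?(le_trans st t1)//.
set K := `|k| + 1 in Hk psi0 Ist k0 dN1 *.
(* The positive part of the derivative is measurable and lies below [G]; being nonnegative, it
   allows the passage from []s, t]] to [0, 1]. *)
pose phi v := Num.max 0 (psi v - K).
have mphi : measurable_fun setT phi.
    apply: measurable_maxr; first exact: measurable_cst.
  by apply: measurable_funB => //; exact: measurable_cst.
have phi0 v : 0 <= phi v by rewrite /phi le_max lexx.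
have le1 : ((H t - H s)%:E <= \int[mu]_(v in `]s, t]) (phi v)%:E)%E.
  have mst : measurable (`]s, t]%classic : set (measurableTypeR R)) by exact: measurable_itv.
  have : (\int[mu]_(v in `]s, t]) (psi v)%:E <=
          \int[mu]_(v in `]s, t]) ((phi v)%:E + K%:E))%E.
    apply: ge0_le_integral => //.
    - by move=> v _; rewrite lee_fin.
    - by apply/measurable_EFinP; exact: measurable_funTS.
    - apply: emeasurable_funD; last exact: measurable_cst.
      by apply/measurable_EFinP; exact: measurable_funTS.
    - by move=> v _; rewrite -EFinD lee_fin -lerBlDr /phi le_max lexx orbT.
  have -> : (\int[mu]_(v in `]s, t]) ((phi v)%:E + K%:E) =
      \int[mu]_(v in `]s, t]) (phi v)%:E + \int[mu]_(v in `]s, t]) K%:E)%E.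
    apply: ge0_integralD => //.
    - by move=> v _; rewrite lee_fin.
    - by apply/measurable_EFinP; exact: measurable_funTS.
    - by move=> v _; rewrite lee_fin ltW.
  have -> : (\int[mu]_(v in `]s, t]) K%:E = (K * (t - s))%:E)%E.
    rewrite integral_cst// EFinM; congr (_ * _)%E.
    exact: (@lebesgue_stieltjes_ocitv idfun s t st).
  by rewrite Ist// EFinD leeD2rE.
apply: (le_trans le1).
have [N2 nN2 hN2] : exists2 N2, mu.-negligible N2 &
    forall v, ~ N2 v -> v != t.
  exists [set t]; last by move=> v vt; apply/eqP.
  by exists [set t]; split => //; exact: lebesgue_measure_set1.
apply: (@ae_le_integral_nomeas _ _ _ mu _ _ (N1 `|` N `|` N2)).
- exact: measurable_itv.
- by apply: subset_itv; rewrite bnd_simp.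
- apply: negligibleU => //; apply: negligibleU => //.
  by exists N1; split.
- by apply/measurable_EFinP; exact: measurable_funTS.
- by move=> v _; rewrite lee_fin.
- by move=> v _; exact: G0.
move=> v /=; rewrite in_itv/= => /andP[sv vt] nNv.
have {vt}vt : v < t.
  by rewrite lt_neqAle vt andbT; apply: hN2 => ?; apply: nNv; right.
have v01 : 0 < v < 1 by rewrite (le_lt_trans s0 sv) (lt_le_trans vt t1).
have [dH H'v] : derivable H v 1 /\ derive1 H v = psi v - K.
  by apply: contrapT => nd; apply: nNv; left; left; apply: dN1 => /(_ v01).
have nearHh : \near v, H v = h v.
  near=> y; apply: Hh; rewrite in_itv/=; apply/andP; split; apply: ltW; near: y.
    by apply: lt_nbhsr; case/andP: v01.
  by apply: lt_nbhsl; case/andP: v01.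
have dh : derivable h v 1 by exact: near_eq_derivable dH.
have svt : s < v < t by rewrite sv vt.
have nNv' : ~ N v by move=> ?; apply: nNv; left; right.
have := hG v svt nNv' dh.
rewrite derive1E -(near_eq_derive _ nearHh) -derive1E H'v => hGv.
by rewrite /phi; case: (leP 0 (psi v - K)).
Unshelve. all: by end_near. Qed.

End lipschitz_ftc.

Section lipschitz_paths.
Context (R : realType) (d : nat).
Local Notation mu := (@lebesgue_measure R).
Implicit Types gamma : R -> 'rV[R]_d.

Lemma negligible_big_ord n (F : 'I_n -> set R) :
  (forall i, mu.-negligible (F i)) -> mu.-negligible (\bigcup_i F i).
Proof.
move=> nF; pose G k := if insub k is Some i then F i else set0.
apply: (@negligibleS _ _ _ mu (\bigcup_k G k)).
  by move=> x [i _ Fx]; exists (nat_of_ord i) => //; rewrite /G valK.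
apply: negligible_bigcup => k; rewrite /G.
by case: insubP => [i _ _|_]; [exact: nF|exact: negligible_set0].
Qed.

Lemma rectifiable_derivable gamma : rectifiable_path gamma ->
  exists2 N, mu.-negligible N & forall v, 0 < v < 1 -> ~ N v -> derivable gamma v 1.
Proof.
move=> [k gk].
have cN i : exists N, mu.-negligible N /\
    forall v, 0 < v < 1 -> ~ N v -> derivable (fun x => gamma x ord0 i) v 1.
  pose h x := gamma x ord0 i.
  have k0 : 0 < `|k| + 1 by rewrite ltr_wpDl.
  have [|H Hk Hh] := @lipschitz_clamp R h (`|k| + 1) (ltW k0).
    move=> x y x01 y01; apply: (@le_trans _ _ (enorm (gamma x - gamma y))).
      by rewrite /h (_ : _ - _ = (gamma x - gamma y) ord0 i) ?coord_le_enorm// !mxE.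
    apply: (le_trans (gk _ _ x01 y01)).
    by rewrite ler_wpM2r// (le_trans (ler_norm _))// lerDl.
  have [psi [psi0 mpsi [N1 [mN1 N10 dN1]] Ist]] := lipschitz_density k0 Hk.
  exists N1; split; first by exists N1; split.
  move=> v v01 nNv.
  have [dH _] : derivable H v 1 /\ derive1 H v = psi v - (`|k| + 1).
    by apply: contrapT => nd; apply: nNv; apply: dN1 => /(_ v01).
  apply: near_eq_derivable dH; near=> y; apply: Hh.
  rewrite in_itv/=; apply/andP; split; apply: ltW; near: y.
    by apply: lt_nbhsr; case/andP: v01.
  by apply: lt_nbhsl; case/andP: v01.
have [F hF] := choice cN.
exists (\bigcup_i F i); first by apply: negligible_big_ord => i; exact: (hF i).1.
move=> v v01 nFv; apply/derivable_mxP => i j; rewrite (ord1 i).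
by apply: (hF j).2 => // Fj; apply: nFv; exists j.
Unshelve. all: by end_near. Qed.

End lipschitz_paths.

(** * Le Cam's bound for finite mixtures *)

Section mixtures.
Context d (T : measurableType d) (R : realType) (K : nat).
Variables (nu : 'I_K -> probability T R).
Implicit Types (a : 'I_K -> R) (P : probability T R).
Local Open Scope ereal_scope.

(** Weights on common components stand in for densities: the finite sum of [a k ^+ 2 / b k] bounds
    one plus the chi-square distance, and no likelihood ratio has to be integrated. *)
Definition mixture P a := [/\ forall k, (0 <= a k)%R, (\sum_k a k = 1)%R &
  forall A, measurable A -> P A = \sum_k (a k)%:E * nu k A].

Let component a (a0 : forall k, (0 <= a k)%R) (n : nat) :
    {measure set T -> \bar R} :=
  if insub n is Some k then mscale (NngNum (a0 k)) (nu k) else mzero.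

Let msum_component a (a0 : forall k, (0 <= a k)%R) A :
  msum (component a0) K A = \sum_k (a k)%:E * nu k A.
Proof. by apply: eq_bigr => k _; rewrite /component valK. Qed.

Lemma mixture_exists a : (forall k, (0 <= a k)%R) -> (\sum_k a k = 1)%R ->
  exists P, mixture P a.
Proof.
move=> a0 a1.
pose m : {measure set T -> \bar R} := msum (component a0) K.
have mT : m setT = 1.
  rewrite /m [LHS]msum_component -[RHS]/(1%R%:E) -a1 -sumEFin.
  by apply: eq_bigr => k _; rewrite probability_setT mule1.
pose P : probability T R := HB.pack (m : set T -> \bar R)
  (Measure.class m) (Measure_isProbability.Build _ _ _ m mT).
by exists P; split => // A _; exact: msum_component.
Qed.

Lemma mixture_integral P a (f : T -> \bar R) : mixture P a ->
  measurable_fun setT f -> (forall x, 0 <= f x) ->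
  \int[P]_x f x = \sum_k (a k)%:E * \int[nu k]_x f x.
Proof.
move=> [a0 a1 PE] mf f0.
rewrite (eq_measure_integral (msum (component a0) K)); last first.
  by move=> A mA _; rewrite [RHS]msum_component; exact: PE.
rewrite ge0_integral_measure_sum//; apply: eq_bigr => k _.
by rewrite /component valK ge0_integral_mscale.
Qed.

End mixtures.

Section iid_integral.
Context d (T : measurableType d) (R : realType).
Local Open Scope ereal_scope.

Lemma measurable_partial_integral (mu : probability T R) n
    (g : n.+1.-tuple T -> \bar R) :
  measurable_fun setT g -> (forall s, 0 <= g s) ->
  measurable_fun setT (fun x => \int[iid_law mu n]_s g (cons_sample (x, s))).
Proof.
move=> mg g0.
have mf : measurable_fun setT (g \o @cons_sample _ T n).
  by apply: measurableT_comp => //; exact: measurable_cons_sample.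
have := (@measurable_fun_fubini_tonelli_F _ _ _ _ _ (iid_law mu n) _ mf (fun z => g0 _)).
by [].
Qed.

Lemma iid_integralS (mu : probability T R) n (g : n.+1.-tuple T -> \bar R) :
  measurable_fun setT g -> (forall s, 0 <= g s) ->
  \int[iid_law mu n.+1]_s g s =
  \int[mu]_x \int[iid_law mu n]_s g (cons_sample (x, s)).
Proof.
move=> mg g0.
have mf : measurable_fun setT (g \o @cons_sample _ T n).
  by apply: measurableT_comp => //; exact: measurable_cons_sample.
have mc : measurable_fun setT (@cons_sample _ T n) := @measurable_cons_sample _ T n.
transitivity (\int[(mu \x iid_law mu n)]_z (g \o @cons_sample _ T n) z).
  rewrite -[LHS]/(\int[pushforward (mu \x iid_law mu n) (@cons_sample _ T n)]_s g s).
  by rewrite (ge0_integral_pushforward mc)//; move=> s _; exact: g0.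
by rewrite (@fubini_tonelli1 _ _ _ _ _ mu (iid_law mu n) _ mf (fun z => g0 _)).
Qed.

End iid_integral.

Section le_cam.
Context d (T : measurableType d) (R : realType).
Local Open Scope ereal_scope.

Lemma cst_le_integral (mu : probability T R) (c : R) (H : T -> \bar R) :
  measurable_fun setT H -> (forall x, 0 <= H x) -> (forall x, c%:E <= H x) ->
  c%:E <= \int[mu]_x H x.
Proof.
move=> mH H0 cH.
have -> : c%:E = \int[mu]_x (cst c%:E) x.
  rewrite integral_cst// -[LHS]mule1; congr (_ * _).
  exact/esym/(@probability_setT _ _ _ mu).
have [c0|c0] := leP 0%R c; first by apply: ge0_le_integral.
apply: (@le_trans _ _ 0); last exact: integral_ge0.
by rewrite integral_cst// nmule_rle0 ?lte_fin.
Qed.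

Variables (K : nat) (nu : 'I_K -> probability T R) (P Q : probability T R).
Variables (a b : 'I_K -> R) (D : R).
Hypotheses (Pa : mixture nu P a) (Qb : mixture nu Q b).
Hypothesis ab0 : forall k, b k = 0%R -> a k = 0%R.
Hypothesis D0 : (0 <= D)%R.

Let chi := (\sum_k a k ^+ 2 / b k)%R.

(* Conditioning on the first coordinate keeps the shape of the bound: the pair
   (alpha, beta) becomes (alpha a_k, beta b_k) on the k-th component. For n = 0
   the bound is min(alpha, beta) >= alpha - alpha^2 / (4 beta). *)
Lemma le_cam_weighted n (alpha beta : R) (g0 g1 : n.-tuple T -> \bar R) :
  (0 <= alpha)%R -> (0 <= beta)%R -> (beta = 0 -> alpha = 0)%R ->
  measurable_fun setT g0 -> measurable_fun setT g1 ->
  (forall s, 0 <= g0 s) -> (forall s, 0 <= g1 s) ->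
  (forall s, D%:E <= g0 s + g1 s) ->
  (D * (alpha - alpha ^+ 2 / (4 * beta) * chi ^+ n))%:E <=
  alpha%:E * \int[iid_law P n]_s g0 s + beta%:E * \int[iid_law Q n]_s g1 s.
Proof.
elim: n alpha beta g0 g1 => [|n IHn] alpha beta g0 g1 al0 be0 beal mg0 mg1 g00 g10 Dg.
  rewrite !integral_dirac// !diracT !mul1e expr0 mulr1.
  pose mn := Num.min alpha beta.
  have mn0 : (0 <= mn)%R by rewrite le_min al0.
  apply: (@le_trans _ _ (mn%:E * (g0 [tuple] + g1 [tuple]))).
    apply: (@le_trans _ _ (mn%:E * D%:E)); last exact: lee_wpmul2l.
    rewrite -EFinM lee_fin [leRHS]mulrC ler_wpM2l// /mn le_min.
    have [b0|b0] := eqVneq beta 0%R.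
      by rewrite (beal b0) b0 expr0n/= mul0r subr0 lexx.
    have {}b0 : (0 < beta)%R by rewrite lt_neqAle eq_sym b0.
    rewrite lerBlDr lerDl divr_ge0 ?sqr_ge0 ?mulr_ge0//=.
    rewrite lerBlDr -lerBlDl ler_pdivlMr ?mulr_gt0//.
    by have := sqr_ge0 (alpha - 2 * beta)%R; nra.
  rewrite ge0_muleDr//; apply: leeD; apply: lee_wpmul2r => //.
    by rewrite lee_fin ge_min lexx.
  by rewrite lee_fin ge_min lexx orbT.
rewrite !iid_integralS//.
set F0 := fun x => \int[iid_law P n]_s g0 (cons_sample (x, s)).
set F1 := fun x => \int[iid_law Q n]_s g1 (cons_sample (x, s)).
have mF0 : measurable_fun setT F0 by exact: measurable_partial_integral.
have mF1 : measurable_fun setT F1 by exact: measurable_partial_integral.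
have F00 x : 0 <= F0 x by apply: integral_ge0.
have F10 x : 0 <= F1 x by apply: integral_ge0.
have [a0 a1 _] := Pa; have [b0 b1 _] := Qb.
rewrite (mixture_integral Pa mF0 F00) (mixture_integral Qb mF1 F10).
rewrite !ge0_sume_distrr; last 2 first.
- by move=> k _; rewrite mule_ge0 ?lee_fin ?integral_ge0.
- by move=> k _; rewrite mule_ge0 ?lee_fin ?integral_ge0.
rewrite -big_split/=.
(* The bound is additive over the components because the [a k] sum to 1 and the quotients to [chi];
   with [x / 0 = 0] the identity also covers vanishing [b k]. *)
have -> : (D * (alpha - alpha ^+ 2 / (4 * beta) * chi ^+ n.+1))%R =
    (\sum_k D * (alpha * a k - (alpha * a k) ^+ 2 / (4 * (beta * b k)) * chi ^+ n))%R.
  rewrite -mulr_sumr sumrB -mulr_sumr a1 mulr1 (exprS chi) mulrA -mulr_suml.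
  congr (_ * (_ - _ * _))%R; rewrite /chi mulr_sumr; apply: eq_bigr => k _.
  by rewrite mulf_div exprMn (mulrA 4%R).
rewrite -sumEFin; apply: lee_sum => k _.
rewrite !muleA -!EFinM.
have -> : (alpha * a k)%:E * \int[nu k]_x F0 x = \int[nu k]_x ((alpha * a k)%:E * F0 x).
  by rewrite ge0_integralZl// lee_fin mulr_ge0.
have -> : (beta * b k)%:E * \int[nu k]_x F1 x = \int[nu k]_x ((beta * b k)%:E * F1 x).
  by rewrite ge0_integralZl// lee_fin mulr_ge0.
have msec (x : T) : measurable_fun setT (fun s : n.-tuple T => cons_sample (x, s)).
  by apply: (measurableT_comp (@measurable_cons_sample _ T n)); exact: measurable_fun_pair.
rewrite -ge0_integralD//.
- apply: cst_le_integral.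
  + by apply: emeasurable_funD; apply: measurable_funeM.
  + by move=> x; rewrite adde_ge0// mule_ge0// lee_fin mulr_ge0.
  move=> x; apply: IHn.
  + by rewrite mulr_ge0.
  + by rewrite mulr_ge0.
  + move=> /eqP; rewrite mulf_eq0 => /orP[/eqP/beal->|/eqP/ab0->]; by rewrite ?mul0r ?mulr0.
  + exact: measurableT_comp mg0 (msec x).
  + exact: measurableT_comp mg1 (msec x).
  + by [].
  + by [].
  + by [].
- by move=> x _; rewrite mule_ge0// lee_fin mulr_ge0.
- exact: measurable_funeM.
- by move=> x _; rewrite mule_ge0// lee_fin mulr_ge0.
- exact: measurable_funeM.
Qed.

End le_cam.

Section two_points.
Context (R : realType) (d : nat).
Local Open Scope ereal_scope.
Implicit Types mu : probability (borelRd R d) R.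

(** By the triangle inequality the two errors add up to at least [D] at every sample. With
    [alpha = beta = 1] and the n-th power of the chi-square sum at most 2, [le_cam_weighted] gives
    [D / 2] for the sum of the risks, hence [D / 4] for the larger. If the distance under [mu0] is
    infinite, so is the error. *)
Lemma minimax_risk_two_points (m p beta : R) (S : set 'rV[R]_d) (a b sigma : R)
    (n : nat) (x y : 'rV[R]_d) (K : nat)
    (nu : 'I_K -> probability (borelRd R d) R) mu0 mu1 (w0 w1 : 'I_K -> R) (D : R) :
  measure_class m p S a b sigma mu0 -> measure_class m p S a b sigma mu1 ->
  mixture nu mu0 w0 -> mixture nu mu1 w1 ->
  (forall k, w1 k = 0%R -> w0 k = 0%R) ->
  ((\sum_k w0 k ^+ 2 / w1 k) ^+ n <= 2)%R -> (0 <= D)%R ->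
  fdtm m p beta mu1 x y \is a fin_num ->
  D%:E + fdtm m p beta mu1 x y <= fdtm m p beta mu0 x y ->
  (D / 4)%:E <= minimax_risk m p beta S a b sigma n x y.
Proof.
move=> mc0 mc1 mix0 mix1 w10 chi2 D0 fin1 DD.
apply: le_ereal_inf_tmp => _ [Dhat mDhat <-].
set D0' := fdtm m p beta mu0 x y in DD *; set D1' := fdtm m p beta mu1 x y in fin1 DD *.
pose g (D' : \bar R) (X : n.-tuple (borelRd R d)) := `|(Dhat X)%:E - D'|.
have mg D' : measurable_fun setT (g D').
  apply: measurableT_comp => //; apply: emeasurable_funB; last exact: measurable_cst.
  by apply/measurable_EFinP.
have g0 D' X : 0 <= g D' X by rewrite /g abse_ge0.
have Dg X : D%:E <= g D0' X + g D1' X.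
  rewrite /g; move: fin1 DD; case: D1' => [r1| |]//= _.
  case: D0' => [r0| |]//= DD; last by rewrite addye ?leey// gt_eqF// ltNye.
  rewrite lee_fin; move: DD; rewrite lee_fin => DD.
  have := ler_distD (Dhat X) r0 r1; have := ler_norm (r0 - r1).
  rewrite (distrC r0 (Dhat X)); lra.
have one0 : (1 = 0 :> R -> 1 = 0 :> R)%R by [].
have lc := @le_cam_weighted _ _ _ _ _ _ _ _ _ _ mix0 mix1 w10 D0 n 1 1 _ _
  ler01 ler01 one0 (mg D0') (mg D1') (g0 D0') (g0 D1') Dg.
have aux (I0 I1 : \bar R) c : c <= 1%:E * I0 + 1%:E * I1 -> c <= I0 + I1.
  by rewrite !mul1e.
have {}lc := aux _ _ _ lc.
set s := ereal_sup _.
have s0 : \int[iid_law mu0 n]_X g D0' X <= s.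
  apply: ereal_sup_ubound; exists mu0; [exact: mc0|reflexivity].
have s1 : \int[iid_law mu1 n]_X g D1' X <= s.
  apply: ereal_sup_ubound; exists mu1; [exact: mc1|reflexivity].
have : (D / 2)%:E <= s + s.
  apply: le_trans (leeD s0 s1); apply: le_trans lc; rewrite lee_fin.
  rewrite expr1n mul1r mulr1; apply: ler_wpM2l => //.
  lra.
case: (s) => [r|_|//]; last by rewrite leey.
by rewrite -EFinD !lee_fin; lra.
Qed.

End two_points.

(** * Quantiles and the distance to measure *)

Section powR_bounds.
Context (R : realType).
Implicit Types (p x t : R).

(* Young's inequality for (1 - t) * 1. *)
Lemma bernoulli_powR p t : 1 <= p -> 0 <= t <= 1 -> 1 - p * t <= (1 - t) `^ p.
Proof.
move=> p1 /andP[t0 t1]; have t1' : 0 <= 1 - t by rewrite subr_ge0.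
have [->|p1'] := eqVneq p 1; first by rewrite powRr1// mul1r.
have {}p1 : 1 < p by rewrite lt_neqAle eq_sym p1'.
have p0 : 0 < p by apply: lt_trans p1.
pose q := (1 - p^-1)^-1.
have q0 : 0 < q by rewrite invr_gt0 subr_gt0 invf_lt1.
have pq : p^-1 + q^-1 = 1 by rewrite /q invrK; lra.
have := conjugate_powR t1' ler01 p0 q0 pq.
rewrite mulr1 powR1 mul1r.
have -> : q^-1 = 1 - p^-1 by rewrite /q invrK.
rewrite -lerBlDr ler_pdivlMr// => h; apply: le_trans h.
have -> : (1 - t - (1 - p^-1)) * p = p * p^-1 - p * t by lra.
by rewrite divff// gt_eqF.
Qed.

(** Bernoulli's inequality at [t = h / (x + h)], multiplied by [(x + h) ^ p]. *)
Lemma powR_add_le p x h b : 1 <= p -> 0 <= x -> x <= b -> 0 <= h ->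
  (x + h) `^ p <= x `^ p + p * h * (b + h) `^ (p - 1).
Proof.
move=> p1 x0 xb h0; have p0 : 0 < p by apply: lt_le_trans p1.
have [xh0|xh0] := eqVneq (x + h) 0.
  rewrite xh0 powR0 ?gt_eqF// addr_ge0 ?powR_ge0// mulr_ge0 ?powR_ge0//.
  by rewrite mulr_ge0// ltW.
have {}xh0 : 0 < x + h by rewrite lt_neqAle eq_sym xh0 addr_ge0.
have hle : h / (x + h) <= 1 by rewrite ler_pdivrMr// mul1r lerDr.
have h0' : 0 <= h / (x + h) by rewrite divr_ge0// ltW.
have := @bernoulli_powR p (h / (x + h)) p1; rewrite h0' hle => /(_ isT).
have -> : 1 - h / (x + h) = x / (x + h) by field; rewrite gt_eqF.
have xhp : 0 < (x + h) `^ p by rewrite powR_gt0.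
move=> /(ler_wpM2r (ltW xhp)); rewrite -powRM ?divr_ge0 ?(ltW xh0)//.
rewrite divfK ?gt_eqF// => hh.
have e : (x + h) `^ p = (x + h) * (x + h) `^ (p - 1) by rewrite mulr_powRB1// ltW.
have hh2 : (x + h) `^ p - p * h * (x + h) `^ (p - 1) <= x `^ p.
  apply: le_trans hh; rewrite mulrBl mul1r {3}e le_eqVlt; apply/orP; left.
  by apply/eqP; field; rewrite gt_eqF.
have : (x + h) `^ (p - 1) <= (b + h) `^ (p - 1).
  apply: ge0_ler_powR; rewrite ?nnegrE ?subr_ge0 ?lerD2r//; first exact: ltW.
  by rewrite addr_ge0// (le_trans x0).
move=> /(ler_wpM2l (mulr_ge0 (ltW p0) h0)); lra.
Qed.

(** Split [x ^ p] as [(x - g) x ^ (p - 1) + g x ^ (p - 1)] and decrease the base of each power. *)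
Lemma powR_sub_le p x g lo : 1 <= p -> 0 <= lo -> lo <= x -> 0 <= g -> g <= x ->
  (x - g) `^ p + g * lo `^ (p - 1) <= x `^ p.
Proof.
move=> p1 lo0 lox g0 gx; have p0 : 0 < p by apply: lt_le_trans p1.
have x0 := le_trans g0 gx.
rewrite -(mulr_powRB1 x0 p0) -[(x - g) `^ p]mulr_powRB1 ?subr_ge0//.
have h1 : (x - g) `^ (p - 1) <= x `^ (p - 1).
  by apply: ge0_ler_powR; rewrite ?nnegrE ?subr_ge0// lerBlDr lerDl.
have h2 : lo `^ (p - 1) <= x `^ (p - 1).
  by apply: ge0_ler_powR; rewrite ?nnegrE ?subr_ge0.
have := ler_wpM2l g0 h2; have : 0 <= x - g by rewrite subr_ge0.
by move=> /ler_wpM2l /(_ _ _ h1); lra.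
Qed.

End powR_bounds.

Lemma ge0_le_integral_add d (T : measurableType d) (R : realType)
    (mu : {measure set T -> \bar R}) (D : set T) (f0 f1 g0 g1 : T -> \bar R) :
  measurable D ->
  measurable_fun D f0 -> measurable_fun D f1 ->
  measurable_fun D g0 -> measurable_fun D g1 ->
  (forall x, D x -> 0 <= f0 x)%E -> (forall x, D x -> 0 <= f1 x)%E ->
  (forall x, D x -> 0 <= g0 x)%E -> (forall x, D x -> 0 <= g1 x)%E ->
  (forall x, D x -> f1 x + g1 x <= f0 x + g0 x)%E ->
  (\int[mu]_(x in D) f1 x + \int[mu]_(x in D) g1 x <=
   \int[mu]_(x in D) f0 x + \int[mu]_(x in D) g0 x)%E.
Proof.
move=> mD mf0 mf1 mg0 mg1 f00 f10 g00 g10 H.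
rewrite -!ge0_integralD//; apply: ge0_le_integral => //.
- by move=> x Dx; rewrite adde_ge0 ?f10 ?g10.
- exact: emeasurable_funD.
- exact: emeasurable_funD.
Qed.

Section quantiles.
Context (R : realType) (d : nat).
Local Open Scope ereal_scope.
Implicit Types (mu : probability (borelRd R d) R) (w : 'rV[R]_d).
Local Notation leb := (@lebesgue_measure R).

Lemma delta_le mu u w r : (0 < r)%R -> u%:E < mu (eball w r) ->
  delta mu u w <= r%:E.
Proof. by move=> r0 ur; apply: ereal_inf_lbound; exists r. Qed.

Lemma delta_ge mu u w L :
  (forall r, (0 < r)%R -> u%:E < mu (eball w r) -> (L <= r)%R) ->
  L%:E <= delta mu u w.
Proof.
by move=> h; apply: le_ereal_inf_tmp => _ [r [r0 ur] <-]; rewrite lee_fin h.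
Qed.

Lemma delta_ge0 mu u w : 0 <= delta mu u w.
Proof. by apply: delta_ge => r /ltW. Qed.

Lemma delta_nondecreasing mu w u v : (u <= v)%R -> delta mu u w <= delta mu v w.
Proof.
move=> uv; apply: le_ereal_inf => _ [r [r0 vr] <-]; exists r => //; split => //.
by apply: le_lt_trans vr; rewrite lee_fin.
Qed.

(** Comparing masses of balls translates into comparing quantiles. The shift [h] has any sign:
    positive for a gain, negative for a loss. *)
Lemma delta_shift mu0 mu1 u w0 w1 h :
  (forall r, (0 < r)%R -> u%:E < mu0 (eball w0 r) ->
     (0 < r - h)%R /\ u%:E < mu1 (eball w1 (r - h))) ->
  delta mu1 u w1 + h%:E <= delta mu0 u w0.
Proof.
move=> H; apply: le_ereal_inf_tmp => _ [r [r0 ur] <-].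
have [rh urh] := H r r0 ur.
by have := delta_le rh urh; rewrite EFinB leeBrDr.
Qed.

Lemma measurable_delta mu w : measurable_fun setT (fun u => delta mu u w).
Proof.
move=> _; apply: (measurability _ (ErealGenCInfty.measurableE R)) => //.
move=> _ [_ [x ->] <-]; rewrite setTI; apply: is_interval_measurable => s t /=.
rewrite !in_itv/= !andbT => xs _ u /andP[su _]; rewrite in_itv/= andbT.
exact: le_trans xs (delta_nondecreasing _ _ su).
Qed.

(** The integral inside [dtm]. Gains and losses on different quantiles add up here; the root and the
    power [beta] are applied at the end, in [dtm_pow_compare]. *)
Definition energy (m p : R) mu w : \bar R :=
  \int[leb]_(u in `[0%R, m]) (delta mu u w `^ p).

Lemma dtm_energy (m p : R) mu w j : energy m p mu w = j%:E ->
  dtm m p mu w = ((m^-1 * j) `^ p^-1)%:E.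
Proof. by move=> e; rewrite /dtm -/(energy _ _ _ _) e -EFinM poweR_EFin. Qed.

Lemma measurable_delta_pow (p : R) mu w (D : set R) :
  measurable_fun D (fun u => delta mu u w `^ p).
Proof.
apply: measurable_funTS.
exact: measurableT_comp (measurable_poweR p) (measurable_delta mu w).
Qed.

(** The endpoint has to go: for [m = 1] no ball has mass above [m], so [delta] is infinite at
    [u = m]. *)
Lemma energyE (m p : R) mu w : energy m p mu w =
  \int[leb]_(u in `[0%R, m[) (delta mu u w `^ p).
Proof. by rewrite /energy -integral_itv_bndo_bndc//; exact: measurable_delta_pow. Qed.

Lemma integral_cst_itv (a b c : R) : (a <= b)%R ->
  \int[leb]_(u in `[a, b[) c%:E = (c * (b - a))%:E.
Proof.
move=> ab; rewrite integral_cst//= EFinM; congr (_ * _).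
transitivity (leb `[a, b[%classic); first by [].
rewrite lebesgue_measure_itv/= lte_fin; case: ltP => [//|ba].
by rewrite (_ : a = b) ?subrr//; apply/eqP; rewrite eq_le ab ba.
Qed.

Lemma integral_itv_indic_sub (D : set R) (a b c : R) : (a <= b)%R ->
  `[a, b[%classic `<=` D ->
  \int[leb]_(u in D) ((c * \1_(`[a, b[%classic) u)%:E) = (c * (b - a))%:E.
Proof.
move=> ab sub; rewrite -(integral_cst_itv c ab) [RHS]integral_mkcond.
rewrite [LHS]integral_mkcond; apply: eq_integral => u _; rewrite !patchE.
case: ifPn => um.
  by rewrite indicE; case: (u \in _); rewrite ?mulr1// mulr0.
case: ifPn => // /set_mem /sub /mem_set; by rewrite (negbTE um).
Qed.

Lemma integral_itv_indic (m a b c : R) : (0 <= a)%R -> (a <= b)%R -> (b <= m)%R ->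
  \int[leb]_(u in `[0%R, m[) ((c * \1_(`[a, b[%classic) u)%:E) = (c * (b - a))%:E.
Proof.
by move=> a0 ab bm; apply: integral_itv_indic_sub => //; apply: subset_itv; rewrite bnd_simp.
Qed.

Lemma energy_ub (m p r : R) mu w : (0 <= m)%R -> (0 <= p)%R -> (0 <= r)%R ->
  (forall u, (0 <= u < m)%R -> delta mu u w <= r%:E) ->
  energy m p mu w <= (m * r `^ p)%:E.
Proof.
move=> m0 p0 r0 H; have -> : (m * r `^ p)%R = (r `^ p * (m - 0))%R by rewrite subr0 mulrC.
rewrite energyE -(integral_cst_itv (r `^ p) m0).
apply: ge0_le_integral => //.
- by move=> u _; exact: poweR_ge0.
- exact: measurable_delta_pow.
move=> u /=; rewrite in_itv/= => um; rewrite -poweR_EFin.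
by apply: gt0_ler_poweR; rewrite ?in_itv/= ?delta_ge0 ?leey ?lee_fin ?r0 ?H.
Qed.

Lemma energy_lb (m p a r : R) mu w : (0 <= a)%R -> (a <= m)%R -> (0 <= p)%R ->
  (0 <= r)%R -> (forall u, (a <= u < m)%R -> r%:E <= delta mu u w) ->
  (r `^ p * (m - a))%:E <= energy m p mu w.
Proof.
move=> a0 am p0 r0 H; rewrite energyE -(integral_itv_indic (r `^ p) a0 am (lexx m)).
apply: ge0_le_integral => //.
- by move=> u _; rewrite lee_fin mulr_ge0 ?powR_ge0.
- by apply/measurable_EFinP; apply: measurable_funM => //; exact: measurable_indic.
- exact: measurable_delta_pow.
move=> u /=; rewrite in_itv/= => um; rewrite indicE.
have [ua|ua] := boolP (u \in `[a, m[%classic); last by rewrite mulr0 poweR_ge0.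
rewrite mulr1 -poweR_EFin; apply: gt0_ler_poweR; rewrite ?in_itv/= ?delta_ge0 ?leey//.
  by rewrite lee_fin r0.
by apply: H; move: ua; rewrite inE/= in_itv.
Qed.

(** Three bands of quantiles: below [u1] the radius may grow by [h], between [u1] and [u2] it
    shrinks by [g], above [u2] it does not grow. The two corrections are integrals of constants over
    the first two bands. They are added to opposite sides because energies may be infinite. *)
Lemma energy_compare (m p u1 u2 lo hi g h : R) mu0 mu1 w0 w1 :
  (1 <= p)%R -> (0 <= u1)%R -> (u1 <= u2)%R -> (u2 <= m)%R ->
  (0 <= lo)%R -> (0 <= h)%R -> (0 <= g)%R ->
  (forall u, (0 <= u < u1)%R -> delta mu0 u w0 <= hi%:E) ->
  (forall u, (0 <= u < u1)%R -> delta mu1 u w1 <= delta mu0 u w0 + h%:E) ->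
  (forall u, (u1 <= u < u2)%R -> lo%:E <= delta mu0 u w0) ->
  (forall u, (u1 <= u < u2)%R -> delta mu1 u w1 + g%:E <= delta mu0 u w0) ->
  (forall u, (u2 <= u < m)%R -> delta mu1 u w1 <= delta mu0 u w0) ->
  energy m p mu1 w1 + (g * lo `^ (p - 1) * (u2 - u1))%:E <=
  energy m p mu0 w0 + (p * h * (hi + h) `^ (p - 1) * u1)%:E.
Proof.
move=> p1 u10 u12 u2m lo0 h0 g0 H1 H2 H3 H4 H5.
have p0 : (0 <= p)%R by apply: le_trans p1.
set B := (g * _)%R; set A := (p * h * _)%R.
have B0 : (0 <= B)%R by rewrite mulr_ge0 ?powR_ge0.
have A0 : (0 <= A)%R by rewrite !mulr_ge0 ?powR_ge0.
rewrite !energyE -(integral_itv_indic B u10 u12 u2m).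
have -> : (A * u1 = A * (u1 - 0))%R by rewrite subr0.
rewrite -(integral_itv_indic A (lexx 0%R) u10 (le_trans u12 u2m)).
have mi (c a b : R) : measurable_fun `[0%R, m[%classic
    (fun u : measurableTypeR R => (c * \1_(`[a, b[%classic) u)%:E).
  by apply/measurable_EFinP; apply: measurable_funM => //; exact: measurable_indic.
have m1 := @measurable_delta_pow p mu1 w1 `[0%R, m[%classic.
have m0 := @measurable_delta_pow p mu0 w0 `[0%R, m[%classic.
have i0 (c a b u : R) : (0 <= c)%R -> 0 <= (c * \1_(`[a, b[%classic) u)%:E :> \bar R.
  by move=> c0; rewrite lee_fin mulr_ge0.
have mD : measurable (`[0%R, m[%classic : set (measurableTypeR R)) by exact: measurable_itv.
apply: (ge0_le_integral_add leb mD m0 m1 (mi A 0%R u1) (mi B u1 u2)).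
- by move=> u _; exact: poweR_ge0.
- by move=> u _; exact: poweR_ge0.
- by move=> u _; exact: i0.
- by move=> u _; exact: i0.
move=> u /=; rewrite in_itv/= => /andP[u0 um].
have d1 := delta_ge0 mu1 u w1; have d0 := delta_ge0 mu0 u w0.
have ind (a b : R) : \1_(`[a, b[%classic) u = ((a <= u < b)%R)%:R :> R.
  rewrite indicE; congr (nat_of_bool _)%:R.
  by apply/idP/idP; rewrite inE /= in_itv.
rewrite !ind u0/=.
have [uu1|uu1] := ltP u u1.
  rewrite mulr0 adde0 mulr1.
  have := H1 u; rewrite u0 uu1 => /(_ isT) h1.
  have := H2 u; rewrite u0 uu1 => /(_ isT).
  move: d0 h1; case: (delta mu0 u w0) => [x| |]//; rewrite !lee_fin => x0 xhi.
  move: d1; case: (delta mu1 u w1) => [y| |]//; rewrite -EFinD !lee_fin => y0 yx.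
  apply: le_trans (powR_add_le p1 x0 xhi h0).
  by apply: ge0_ler_powR => //; rewrite nnegrE// addr_ge0.
rewrite mulr0 adde0.
have [uu2|uu2] := ltP u u2.
  rewrite mulr1; have := H3 u; rewrite uu1 uu2 => /(_ isT).
  have := H4 u; rewrite uu1 uu2 => /(_ isT).
  move: d0; case: (delta mu0 u w0) => [x| |]//; last first.
    by move=> _ _ _; rewrite [X in _ <= X]eqy_poweR ?leey// (lt_le_trans _ p1).
  move: d1; case: (delta mu1 u w1) => [y| |]//; rewrite -EFinD !lee_fin => y0 x0 yx lox.
  have gx : (g <= x)%R by rewrite (le_trans _ yx)// lerDr.
  apply: le_trans (powR_sub_le p1 lo0 lox g0 gx); rewrite lerD2r.
  by apply: ge0_ler_powR; rewrite ?nnegrE ?subr_ge0// lerBrDr.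
rewrite mulr0 adde0; apply: gt0_ler_poweR; rewrite ?in_itv/= ?d0 ?d1 ?leey//.
by apply: H5; rewrite uu2 um.
Qed.

End quantiles.

Section dtm_powers.
Context (R : realType) (d : nat).
Local Open Scope ereal_scope.
Implicit Types (mu : probability (borelRd R d) R) (w : 'rV[R]_d).

Lemma powR_onem_le (p c : R) : (1 <= p)%R -> (0 <= c <= 1)%R ->
  ((1 - c) `^ p^-1 <= 1 - c / p)%R.
Proof.
move=> p1 /andP[c0 c1]; have p0 : (0 < p)%R by apply: lt_le_trans p1.
have cp : (0 <= c / p <= 1)%R.
  by rewrite divr_ge0 ?(ltW p0)//= ler_pdivrMr// mul1r (le_trans c1).
have h := bernoulli_powR p1 cp; move: h.
have -> : (p * (c / p) = c)%R by field; rewrite gt_eqF.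
have cp1 : (0 <= 1 - c / p)%R by rewrite subr_ge0; case/andP: cp.
have e : (1 - c / p = ((1 - c / p) `^ p) `^ p^-1)%R.
  by rewrite -powRrM divff ?gt_eqF// powRr1.
move=> h; rewrite e.
have ip0 : (0 <= p^-1)%R by rewrite invr_ge0 ltW.
by apply: (ge0_ler_powR ip0) => //; rewrite ?nnegrE ?powR_ge0 ?subr_ge0.
Qed.

(** The factor on d_mu to the power [beta] is [(1 - c) ^ (beta / p)], which is at most
    [(1 - c) ^ (1 / p)] as [beta >= 1], hence at most [1 - c / p]. *)
Lemma dtm_pow_compare (m p beta c j : R) mu0 mu1 w0 w1 :
  (0 < m)%R -> (1 <= p)%R -> (1 <= beta)%R -> (0 <= c < 1)%R -> (0 <= j)%R ->
  energy m p mu0 w0 = j%:E -> energy m p mu1 w1 <= (j * (1 - c))%:E ->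
  dtm m p mu1 w1 `^ beta <= (((m^-1 * j) `^ p^-1) `^ beta * (1 - c / p))%:E.
Proof.
move=> m0 p1 b1 /andP[c0 c1] j0 e0 e1.
have p0 : (0 < p)%R by apply: lt_le_trans p1.
have e10 : 0 <= energy m p mu1 w1 by apply: integral_ge0 => u _; exact: poweR_ge0.
move: e1 e10; case e1: (energy m p mu1 w1) => [i| |]//; rewrite !lee_fin => ij i0.
rewrite (dtm_energy e1) poweR_EFin lee_fin -!powRrM.
have q0 : (0 <= p^-1 * beta)%R by rewrite mulr_ge0 ?invr_ge0 ?(ltW p0)// (le_trans _ b1).
have c1' : (0 < 1 - c)%R by rewrite subr_gt0.
have mj : (0 <= m^-1 * j)%R by rewrite mulr_ge0// invr_ge0 ltW.
apply: (@le_trans _ _ ((m^-1 * j * (1 - c)) `^ (p^-1 * beta))%R).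
  apply: ge0_ler_powR; rewrite // ?nnegrE ?mulr_ge0 ?invr_ge0 ?(ltW m0) ?(ltW c1')//.
  by rewrite -mulrA ler_wpM2l// invr_ge0 ltW.
rewrite powRM ?(ltW c1')//; apply: ler_wpM2l; first exact: powR_ge0.
apply: le_trans (powR_onem_le p1 _); last by rewrite c0 ltW.
apply: ger_powR; first by rewrite c1' lerBlDr lerDl.
by rewrite -[leLHS]mulr1 ler_wpM2l// invr_ge0 ltW.
Qed.

End dtm_powers.

(** * The uniform law on a segment *)

Section unit_law.
Context (R : realType).
Local Notation leb := (@lebesgue_measure R).

Definition unit_law : set (measurableTypeR R) -> \bar R :=
  mrestr leb (measurable_itv `[0%R, 1%R]).

HB.instance Definition _ := Measure.on unit_law.

Let unit_lawT : unit_law setT = 1%E.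
Proof.
rewrite /unit_law /mrestr setTI; transitivity (leb `[0%R, 1%R]%classic); first by [].
by rewrite lebesgue_measure_itv/= lte_fin ltr01 -EFinB subr0.
Qed.

HB.instance Definition _ := Measure_isProbability.Build _ _ _ unit_law unit_lawT.

End unit_law.

Section segment_law.
Context (R : realType) (d : nat).
Implicit Types (u v w : 'rV[R]_d) (r : R).
Local Notation leb := (@lebesgue_measure R).

Definition seg_point u v (t : measurableTypeR R) : borelRd R d := u + t *: (v - u).

Lemma seg_point_continuous u v : continuous (seg_point u v : R -> 'rV[R]_d).
Proof.
move=> t; apply: (@continuousD _ _ _ (fun=> u) (fun t : R => t *: (v - u))).
  exact: cst_continuous.
exact: scalel_continuous.
Qed.

Lemma measurable_seg_point u v : measurable_fun setT (seg_point u v).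
Proof.
apply: (@measurability _ _ _ (borelRd R d) _ _ (@open 'rV[R]_d)) => // _ [A oA <-].
rewrite setTI; apply: open_measurable.
by apply: open_comp => // t _; exact: seg_point_continuous.
Qed.

HB.instance Definition _ u v :=
  isMeasurableFun.Build _ _ _ _ (seg_point u v) (@measurable_seg_point u v).

(** For [u = v] this is a point mass; the third arm takes this form when [eps = 0]. *)
Definition seg_law u v : probability (borelRd R d) R :=
  distribution (@unit_law R) (seg_point u v).

Lemma seg_lawE u v A :
  seg_law u v A = leb ((seg_point u v @^-1` A) `&` `[0, 1]%classic).
Proof. by []. Qed.

Definition segm u v w r : R := fine (seg_law u v (eball w r)).

Lemma segmE u v w r : (segm u v w r)%:E = seg_law u v (eball w r).
Proof. by rewrite fineK// fin_num_measure//; exact: measurable_eball. Qed.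

Lemma segm_ge0 u v w r : 0 <= segm u v w r.
Proof. by rewrite fine_ge0. Qed.

Lemma segm_le1 u v w r : segm u v w r <= 1.
Proof. by rewrite -lee_fin segmE probability_le1//; exact: measurable_eball. Qed.

Let mpre u v w r : measurable ((seg_point u v @^-1` eball w r) `&` `[0, 1]%classic
  : set (measurableTypeR R)).
Proof.
apply: measurableI => //; rewrite -[X in measurable X]setTI.
by apply: measurable_seg_point => //; exact: measurable_eball.
Qed.

Let leb_itv (a b : R) : a <= b -> leb `[a, b]%classic = (b - a)%:E.
Proof.
move=> ab; rewrite lebesgue_measure_itv/= lte_fin; case: ltP => [//|ba].
by rewrite (_ : a = b) ?subrr//; apply/eqP; rewrite eq_le ab ba.
Qed.

Lemma segm_mono u v w r u' v' w' r' :
  (forall t, 0 <= t <= 1 -> eball w r (seg_point u v t) ->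
     eball w' r' (seg_point u' v' t)) ->
  segm u v w r <= segm u' v' w' r'.
Proof.
move=> H; rewrite -lee_fin !segmE !seg_lawE; apply: le_measure; rewrite ?inE//.
by move=> t [/= wt]; rewrite in_itv/= => t01; split => //; exact: H.
Qed.

Lemma segm_full u v w r :
  (forall t, 0 <= t <= 1 -> eball w r (seg_point u v t)) -> segm u v w r = 1.
Proof.
move=> H; apply: EFin_inj; rewrite segmE seg_lawE.
rewrite (_ : _ `&` _ = `[0, 1]%classic) ?leb_itv ?subr0//.
by apply: setIidr => t /=; rewrite in_itv/=; exact: H.
Qed.

Lemma segm_gt0P u v w r : 0 < segm u v w r ->
  exists2 t, 0 <= t <= 1 & eball w r (seg_point u v t).
Proof.
move=> s0; apply: contrapT => H; move: s0; rewrite -lte_fin segmE seg_lawE.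
rewrite (_ : _ `&` _ = set0) ?measure0 ?ltxx//.
apply/seteqP; split => // t [/= wt]; rewrite in_itv/= => t01.
by apply: H; exists t.
Qed.

Lemma segm_lb u v w r (a b : R) : 0 <= a -> a <= b -> b <= 1 ->
  (forall t, a < t < b -> eball w r (seg_point u v t)) -> b - a <= segm u v w r.
Proof.
move=> a0 ab b1 H; rewrite -lee_fin segmE seg_lawE.
have -> : (b - a)%:E = leb `]a, b[%classic.
  rewrite lebesgue_measure_itv/= lte_fin; case: ltP => [//|ba].
  by rewrite (_ : a = b) ?subrr//; apply/eqP; rewrite eq_le ab ba.
apply: le_measure; rewrite ?inE//.
move=> t /=; rewrite in_itv/= => /andP[ta tb]; split; first by apply: H; rewrite ta.
by rewrite in_itv/= (le_trans a0 (ltW ta)) (le_trans (ltW tb) b1).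
Qed.

Lemma segm_add u v w r r' (a b : R) : a <= b ->
  (forall t, 0 <= t <= 1 -> eball w r (seg_point u v t) ->
     eball w r' (seg_point u v t) \/ a <= t <= b) ->
  segm u v w r <= segm u v w r' + (b - a).
Proof.
move=> ab H; rewrite -lee_fin EFinD !segmE !seg_lawE -leb_itv//.
apply: (@le_trans _ _ (leb (((seg_point u v @^-1` eball w r') `&` `[0, 1]%classic) `|`
   `[a, b]%classic))).
  apply: le_measure; rewrite ?inE//; first exact: measurableU.
  move=> t [/= wt]; rewrite in_itv/= => t01.
  by have [w't|tab] := H t t01 wt; [left; split => //|right]; rewrite /= in_itv.
exact: measureU2.
Qed.

Lemma segm_ub u v w r (a b : R) : a <= b ->
  (forall t, 0 <= t <= 1 -> eball w r (seg_point u v t) -> a <= t <= b) ->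
  segm u v w r <= b - a.
Proof.
move=> ab H; rewrite -lee_fin segmE seg_lawE -leb_itv//.
apply: le_measure; rewrite ?inE//.
by move=> t [/= wt]; rewrite in_itv/= => t01; rewrite in_itv/=; exact: H.
Qed.

End segment_law.

(* Unfolding [segm] during unification makes rewriting intractable. *)
#[global] Opaque segm.

(** * Masses of balls around the axis *)

Lemma sqr_le_itv (R : realType) (x a : R) : - a <= x -> x <= a -> x ^+ 2 <= a ^+ 2.
Proof. by move=> h1 h2; nra. Qed.

Lemma sume_ord3 (R : realType) (F : 'I_3 -> \bar R) :
  (\sum_k F k = F ord0 + (F (lift ord0 ord0) + F ord_max))%E.
Proof.
rewrite !big_ord_recl big_ord0 adde0; congr (_ + (_ + F _))%E.
exact: val_inj.
Qed.

Section plane.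
Context (R : realType) (d : nat) (c e1 e2 : 'rV[R]_d) (rho : R).
Hypotheses (rho0 : 0 < rho) (e12 : dot e1 e2 = 0)
  (e11 : dot e1 e1 = rho ^+ 2) (e22 : dot e2 e2 = rho ^+ 2).

Definition pl (a b : R) : 'rV[R]_d := c + a *: e1 + b *: e2.

Lemma pl_sub a b a' b' : pl a b - pl a' b' = (a - a') *: e1 + (b - b') *: e2.
Proof. by apply/rowP => i; rewrite /pl !mxE; ring. Qed.

Lemma pl_dist a b a' b' :
  dot (pl a b - pl a' b') (pl a b - pl a' b') =
  rho ^+ 2 * ((a - a') ^+ 2 + (b - b') ^+ 2).
Proof.
rewrite pl_sub dotDl !dotDr !dotZl !dotZr (dotC e2 e1) e12 e11 e22; ring.
Qed.

Lemma enorm_pl_ltE a b a' b' r : 0 <= r ->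
  (enorm (pl a b - pl a' b') < rho * r) = ((a - a') ^+ 2 + (b - b') ^+ 2 < r ^+ 2).
Proof.
move=> r0; have rr0 : 0 <= rho * r by rewrite mulr_ge0// ltW.
rewrite -(@ltr_pXn2r _ 2)// ?nnegrE ?enorm_ge0// enorm_sqr pl_dist exprMn.
by rewrite ltr_pM2l// exprn_gt0.
Qed.

Lemma enorm_pl_le a b a' b' r : 0 <= r ->
  (a - a') ^+ 2 + (b - b') ^+ 2 <= r ^+ 2 -> enorm (pl a b - pl a' b') <= rho * r.
Proof.
move=> r0 h; have rr0 : 0 <= rho * r by rewrite mulr_ge0// ltW.
rewrite -(@ler_pXn2r _ 2)// ?nnegrE ?enorm_ge0// enorm_sqr pl_dist exprMn.
by rewrite ler_pM2l// exprn_gt0.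
Qed.

Lemma seg_point_pl a b a' b' t :
  seg_point (pl a b) (pl a' b') t = pl (a + t * (a' - a)) (b + t * (b' - b)).
Proof. by rewrite /seg_point pl_sub; apply/rowP => i; rewrite /pl !mxE; ring. Qed.

Lemma eball_pl a b a' b' a0 b0 r t : 0 <= r ->
  eball (pl a0 b0) (rho * r) (seg_point (pl a b) (pl a' b') t) <->
  (a + t * (a' - a) - a0) ^+ 2 + (b + t * (b' - b) - b0) ^+ 2 < r ^+ 2.
Proof. by move=> r0; rewrite seg_point_pl /eball/= enorm_pl_ltE. Qed.

Variables (N eps : R).
Hypotheses (N192 : 192 <= N) (eps08 : 0 <= eps <= 8^-1).

Definition S0 := segm (pl 0 0) (pl 0 1).
Definition S1 := segm (pl 0 1) (pl N 1).
Definition S2 := segm (pl 0 0) (pl eps 0).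

Let N0 : 0 < N. Proof. have := N192; lra. Qed.

Section near_axis.
Variables (v e : R).
Hypotheses (v8 : - 8^-1 <= v <= 8^-1) (e08 : 0 <= e <= 8^-1).

Lemma S0_full r : 3 / 2 <= r -> S0 (pl e v) (rho * r) = 1.
Proof.
move=> r32; apply: segm_full => t /andP[t0 t1]; apply/eball_pl; first lra.
case/andP: v8 => v1 v2; case/andP: e08 => e0 e8.
have h1 : e ^+ 2 <= 8^-1 ^+ 2 by apply: sqr_le_itv; lra.
have h2 : (t - v) ^+ 2 <= (9 / 8) ^+ 2 by apply: sqr_le_itv; lra.
have h3 : (3 / 2) ^+ 2 <= r ^+ 2 by rewrite ler_pXn2r ?nnegrE//; lra.
rewrite !subr0 mulr0 mulr1 !add0r sqrrN; lra.
Qed.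

Lemma S2_full r : 2^-1 <= r -> S2 (pl e v) (rho * r) = 1.
Proof.
move=> r12; apply: segm_full => t /andP[t0 t1]; apply/eball_pl; first lra.
case/andP: v8 => v1 v2; case/andP: e08 => e0 e8; case/andP: eps08 => p0 p8.
have /andP[te0 te8] : 0 <= t * eps <= 8^-1 by apply/andP; split; nra.
have h1 : (t * eps - e) ^+ 2 <= 8^-1 ^+ 2 by apply: sqr_le_itv; lra.
have h2 : v ^+ 2 <= 8^-1 ^+ 2 by apply: sqr_le_itv; lra.
have h3 : 2^-1 ^+ 2 <= r ^+ 2 by rewrite ler_pXn2r ?nnegrE//; lra.
rewrite !subr0 !add0r mulr0 sub0r sqrrN; lra.
Qed.

Lemma S1_low : S1 (pl 0 v) (rho * 2) <= 2 / N.
Proof.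
rewrite -(subr0 (2 / N)); apply: segm_ub; first by rewrite divr_ge0// ltW.
move=> t /andP[t0 t1] /eball_pl; rewrite t0/= => /(_ ltac:(lra)).
rewrite !subr0 subrr mulr0 addr0 add0r ler_pdivlMr// => h.
have tN0 : 0 <= t * N by rewrite mulr_ge0// ltW.
have h1 : (t * N) ^+ 2 < 2 ^+ 2 by have := sqr_ge0 (1 - v); lra.
by move: h1; rewrite ltr_pXn2r ?nnegrE// => /ltW.
Qed.

Lemma S1_lb4 : 3 / N <= S1 (pl 0 v) (rho * 4).
Proof.
have N3 : 3 / N <= 1 by rewrite ler_pdivrMr// mul1r; have := N192; lra.
rewrite -(subr0 (3 / N)); apply: segm_lb => //; first by rewrite divr_ge0// ltW.
move=> t /andP[t0]; rewrite ltr_pdivlMr// => t3; apply/eball_pl; first lra.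
case/andP: v8 => v1 v2.
have tN0 : 0 <= t * N by rewrite mulr_ge0// ltW.
have h1 : (t * N) ^+ 2 <= 3 ^+ 2 by rewrite ler_pXn2r ?nnegrE// ltW.
have h2 : (1 - v) ^+ 2 <= (9 / 8) ^+ 2 by apply: sqr_le_itv; lra.
rewrite !subr0 subrr mulr0 addr0 add0r; lra.
Qed.

(** A point of the second arm at abscissa at least 1 is seen from the axis at an angle to [e1] of
    cosine at least 4/7, so a displacement by [e] brings it nearer by [e / 2]. Nearer points lie in
    the smaller ball anyway, since [r - e / 2 >= 29 / 16]. *)
Lemma S1_shift r : 15 / 8 <= r ->
  S1 (pl 0 v) (rho * r) <= S1 (pl e v) (rho * (r - e / 2)).
Proof.
case/andP: v8 => v1 v2; case/andP: e08 => e0 e8.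
move=> r158; apply: segm_mono => t /andP[t0 t1] /eball_pl.
move=> /(_ ltac:(lra)) h; apply/eball_pl; first lra.
move: h; rewrite !subr0 subrr mulr0 addr0 !add0r.
have : 0 <= t * N by rewrite mulr_ge0// ltW.
set x := t * N; set q := 1 - v => x0 h.
have q1 : 7/8 <= q by rewrite /q; lra.
have q2 : q <= 9/8 by rewrite /q; lra.
have [x1|x1] := leP 1 x; last first.
  have : (x - e) ^+ 2 <= 1 by nra.
  have : q ^+ 2 <= 81 / 64 by nra.
  have : (29 / 16) ^+ 2 <= (r - e / 2) ^+ 2 by nra.
  nra.
(* With D^2 = x^2 + q^2 and x >= 1 one has D <= 7x/4, hence D + 3e/4 <= 2x. *)
have [D [D0 DE]] : exists D, 0 <= D /\ D ^+ 2 = x ^+ 2 + q ^+ 2.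
  by exists (Num.sqrt (x ^+ 2 + q ^+ 2)); rewrite sqrtr_ge0 sqr_sqrtr// addr_ge0 ?sqr_ge0.
have Dr : D < r by rewrite -(@ltr_pXn2r _ 2)// ?nnegrE ?DE//; lra.
have D74 : D <= 7 / 4 * x.
  rewrite -(@ler_pXn2r _ 2)// ?nnegrE ?DE//; nra.
have De : e / 2 <= D by nra.
have h1 : (x - e) ^+ 2 + q ^+ 2 <= (D - e / 2) ^+ 2 by nra.
have h2 : (D - e / 2) ^+ 2 < (r - e / 2) ^+ 2 by nra.
exact: le_lt_trans h2.
Qed.

(** The ball cuts the second arm at abscissa [X = sqrt (r^2 - q^2)], where [q] is the height of the
    arm above the centre. As [r <= 2 X], increasing [r] by [h / 8] moves this point by at most
    [h / 4], out of a total length [N]. *)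
Lemma S1_annulus r h : 15 / 8 <= r -> 0 <= h <= 1 ->
  S1 (pl 0 v) (rho * (r + h / 8)) <= S1 (pl 0 v) (rho * r) + h / (4 * N).
Proof.
case/andP: v8 => v1 v2 r158 /andP[h0 h1].
set q := 1 - v.
have q1 : 7/8 <= q by rewrite /q; lra.
have q2 : q <= 9/8 by rewrite /q; lra.
have [X [X0 XE]] : exists X, 0 <= X /\ X ^+ 2 = r ^+ 2 - q ^+ 2.
  by exists (Num.sqrt (r ^+ 2 - q ^+ 2)); rewrite sqrtr_ge0 sqr_sqrtr//; nra.
have -> : h / (4 * N) = (X + h / 4) / N - X / N.
  by field; rewrite gt_eqF.
apply: segm_add; first by rewrite ler_pM2r ?invr_gt0// lerDl divr_ge0.
move=> t /andP[t0 t1] /eball_pl => /(_ ltac:(lra)) hb.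
have xN0 : 0 <= t * N by rewrite mulr_ge0// ltW.
have [lt1|lt1] := ltP (t * N) X; [left|right].
  apply/eball_pl; first lra.
  rewrite !subr0 subrr mulr0 addr0 !add0r -/q; nra.
rewrite ler_pdivrMr// ler_pdivlMr// lt1/=.
move: hb; rewrite !subr0 subrr mulr0 addr0 !add0r -/q => hb.
have rX : r <= 2 * X by rewrite -(@ler_pXn2r _ 2)// ?nnegrE; nra.
have : (t * N) ^+ 2 <= (X + h / 4) ^+ 2 by nra.
by rewrite ler_pXn2r// nnegrE// addr_ge0// divr_ge0.
Qed.

(** The second arm lies farther from the axis point than every point of the third arm, and no nearer
    than any point of the first. A ball that meets it therefore gains from any transfer of its mass
    to the short arms. *)
Lemma S1_pos_full r : 0 < r -> 0 < S1 (pl 0 v) (rho * r) ->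
  S0 (pl 0 v) (rho * r) = 1 /\ S2 (pl 0 v) (rho * r) = 1.
Proof.
case/andP: v8 => v1 v2; case/andP: eps08 => p0 p8.
move=> r0 /segm_gt0P[t /andP[t0 t1] /eball_pl] => /(_ (ltW r0)).
rewrite !subr0 subrr mulr0 addr0 add0r => h.
have hr : (1 - v) ^+ 2 < r ^+ 2 by have := sqr_ge0 (t * N); lra.
split; apply: segm_full => u /andP[u0 u1]; apply/eball_pl; try exact: ltW.
  rewrite !subr0 !add0r mulr0 mulr1; apply: le_lt_trans hr; nra.
rewrite !subr0 !add0r mulr0 add0r; apply: le_lt_trans hr.
have : 0 <= u * eps <= 8^-1 by apply/andP; split; nra.
by move=> /andP[? ?]; nra.
Qed.

End near_axis.

Lemma segm_incl (a b w w' : 'rV[R]_d) r r' : enorm (w - w') + r <= r' ->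
  segm a b w r <= segm a b w' r'.
Proof.
move=> h; apply: segm_mono => t _; rewrite /eball/= => wt.
apply: lt_le_trans h; apply: le_lt_trans (enorm_triangle _ w _) _.
by rewrite addrC ltrD2l.
Qed.

Lemma segm_incr (a b w : 'rV[R]_d) r r' : r <= r' -> segm a b w r <= segm a b w r'.
Proof. by move=> h; apply: segm_incl; rewrite subrr enorm0 add0r. Qed.

(** Two points of the second arm in a ball of radius [rho], wherever centred, are less than [2 rho]
    apart, that is, [2 / N] in the parameter. *)
Lemma S1_small w : S1 w rho <= 4 / N.
Proof.
have N40 : 0 <= 4 / N by rewrite divr_ge0// ltW.
have [->//|S10] := eqVneq (S1 w rho) 0.
have /segm_gt0P[t0 _ wt0] : 0 < S1 w rho by rewrite lt_neqAle eq_sym S10 segm_ge0.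
have -> : 4 / N = (t0 + 2 / N) - (t0 - 2 / N) by field; rewrite gt_eqF.
apply: segm_ub; first by rewrite lerD2l ge0_cp// divr_ge0// ltW.
move=> t _ wt; have : enorm (seg_point (pl 0 1) (pl N 1) t -
    seg_point (pl 0 1) (pl N 1) t0) < rho * 2.
  apply: le_lt_trans (enorm_triangle _ w _) _.
  rewrite (enorm_distC w); move: wt wt0; rewrite /eball/=; lra.
rewrite !seg_point_pl enorm_pl_ltE//.
rewrite !subr0 subrr !mulr0 subrr !add0r expr0n/= addr0 -mulrBl => h.
have h2 : `|(t - t0) * N| < 2.
  by rewrite -(@ltr_pXn2r _ 2)// ?nnegrE// real_normK ?num_real.
move: h2; rewrite normrM (gtr0_norm N0) -ltr_pdivlMr// ltr_norml => /andP[? ?].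
by apply/andP; split; lra.
Qed.

Definition arms (k : 'I_3) : probability (borelRd R d) R :=
  match val k with
  | 0 => seg_law (pl 0 0) (pl 0 1)
  | 1 => seg_law (pl 0 1) (pl N 1)
  | _ => seg_law (pl 0 0) (pl eps 0)
  end.

(** Both measures are mixtures of the same three arms, as the two-point bound requires; [mu0] is the
    case [eta1 = eta2 = 0]. *)
Definition arm_weight (eta1 eta2 : R) (k : 'I_3) : R :=
  match val k with
  | 0 => N^-1 + eta1
  | 1 => 1 - N^-1 - eta1 - eta2
  | _ => eta2
  end.

Definition arm_mass eta1 eta2 w r : R :=
  (N^-1 + eta1) * S0 w r + (1 - N^-1 - eta1 - eta2) * S1 w r + eta2 * S2 w r.

Lemma arm_weight_sum eta1 eta2 : \sum_k arm_weight eta1 eta2 k = 1.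
Proof. rewrite !big_ord_recl big_ord0 /arm_weight/=; lra. Qed.

Lemma mixture_arm_mass eta1 eta2 mu w r : mixture arms mu (arm_weight eta1 eta2) ->
  mu (eball w r) = (arm_mass eta1 eta2 w r)%:E.
Proof.
move=> [_ _ ->]; last exact: measurable_eball.
rewrite sume_ord3 /arm_weight /arms/=.
transitivity ((N^-1 + eta1)%:E * (S0 w r)%:E +
  ((1 - N^-1 - eta1 - eta2)%:E * (S1 w r)%:E + eta2%:E * (S2 w r)%:E))%E.
  by congr (_ * _ + (_ * _ + _ * _))%E; exact/esym/segmE.
by rewrite -!EFinM -!EFinD addrA.
Qed.

Section masses.
Variables (eta1 eta2 v e : R).
Hypotheses (eta10 : 0 <= eta1) (eta20 : 0 <= eta2) (etaN : eta1 + eta2 <= N^-1).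
Hypotheses (v8 : - 8^-1 <= v <= 8^-1) (e08 : 0 <= e <= 8^-1).

Let NV : 0 < N^-1 <= 192^-1.
Proof. by rewrite invr_gt0 N0/= lef_pV2 ?posrE ?N0 ?ltr0n// N192. Qed.

(** Under [mu0] the first arm contributes at most [1 / N] and the second at most [2 / N] to a ball
    of radius below [2 rho]. So quantiles of level at least [3 / N] are at least [2 rho]. *)
Lemma arm_mass_low r : 0 < r -> 3 / N < arm_mass 0 0 (pl 0 v) (rho * r) -> 2 <= r.
Proof.
move=> r0; rewrite leNgt; apply: contraTN => r2; rewrite -leNgt /arm_mass.
have h1 : S1 (pl 0 v) (rho * r) <= 2 / N.
  apply: le_trans (S1_low v); apply: segm_incr.
  by rewrite ler_pM2l// ltW.
have h0 : S0 (pl 0 v) (rho * r) <= 1 by exact: segm_le1.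
have h1' : 0 <= S1 (pl 0 v) (rho * r) by exact: segm_ge0.
case/andP: NV => n0 n1; nra.
Qed.

(** The radius is reduced twice. The displacement pays for [e / 2], by [S1_shift]. Reducing by
    [eta1 / 8] loses mass at most [eta1 / (4 N)] on the second arm, while the transferred mass
    [eta1 + eta2], of which at most 3/4 was in the ball, is now all in it. *)
Lemma arm_mass_gain u r : 2 <= r -> u < 2^-1 ->
  u < arm_mass 0 0 (pl 0 v) (rho * r) ->
  u < arm_mass eta1 eta2 (pl e v) (rho * (r - (eta1 + e) / 8)).
Proof.
case/andP: e08 => e0 e8; case/andP: NV => n0 n1 r2 u12 ur.
have ee1 := etaN; have ee2 := eta10; have ee3 := eta20.
have h0 : S0 (pl 0 v) (rho * r) <= 1 by exact: segm_le1.
set r1 := r - eta1 / 8.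
set r3 := r1 - e / 2.
have le3 : arm_mass eta1 eta2 (pl e v) (rho * r3) <=
    arm_mass eta1 eta2 (pl e v) (rho * (r - (eta1 + e) / 8)).
  have rr : rho * r3 <= rho * (r - (eta1 + e) / 8).
    by rewrite ler_pM2l// /r3 /r1; lra.
  rewrite /arm_mass; apply: lerD; first apply: lerD.
  - by apply: ler_wpM2l; [lra|exact: segm_incr].
  - by apply: ler_wpM2l; [lra|exact: segm_incr].
  - by apply: ler_wpM2l; [lra|exact: segm_incr].
apply: lt_le_trans le3.
have r1b : 15 / 8 <= r1 by rewrite /r1; lra.
have ann : S1 (pl 0 v) (rho * r) <= S1 (pl 0 v) (rho * r1) + eta1 / (4 * N).
  have := @S1_annulus v v8 r1 eta1 r1b.
  by rewrite /r1 subrK; apply; apply/andP; split; lra.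
have shf := S1_shift v8 e08 r1b.
rewrite -/r3 in shf.
rewrite /arm_mass (S0_full v8 e08); last by rewrite /r3; lra.
rewrite (S2_full v8 e08); last by rewrite /r3; lra.
rewrite !mulr1; move: ur; rewrite /arm_mass !subr0 !addr0 mul0r addr0 => ur.
have s1 : S1 (pl e v) (rho * r3) <= 1 by exact: segm_le1.
set s := S1 (pl e v) (rho * r3) in shf s1 *.
have eN : eta1 / (4 * N) = eta1 * N^-1 / 4 by field; rewrite gt_eqF.
rewrite eN in ann.
set n := N^-1 in n0 n1 ur ann ee1 *.
(* A ball with more than 3/4 of the second arm has mass above 1/2, hence above [u]. *)
have [s34|s34] := leP s (3 / 4); last by nra.
have a1 : (1 - n) * S1 (pl 0 v) (rho * r) <= (1 - n) * (s + eta1 * n / 4).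
  by apply: ler_wpM2l; lra.
have a2 : n * S0 (pl 0 v) (rho * r) <= n by rewrite -[leRHS]mulr1 ler_wpM2l// ltW.
have a3 : eta1 * n <= eta1 by nra.
have a4 : 0 <= n * (eta1 * n) by rewrite !mulr_ge0// ltW.
have a5 : (eta1 + eta2) * s <= (eta1 + eta2) * (3 / 4) by apply: ler_wpM2l; lra.
lra.
Qed.

(** At a fixed centre the transfer loses no mass, by [S1_pos_full], and the displacement costs a
    radius [rho e]. The term [eta1] is slack, so that loss and gain are both proportional to
    [eta1 + e]. *)
Lemma arm_mass_shift r : 0 < r ->
  arm_mass 0 0 (pl 0 v) (rho * r) <= arm_mass eta1 eta2 (pl e v) (rho * (r + (eta1 + e))).
Proof.
case/andP: e08 => e0 e8; case/andP: NV => n0 n1 r0.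
have ee1 := etaN; have ee2 := eta10; have ee3 := eta20.
apply: (@le_trans _ _ (arm_mass eta1 eta2 (pl 0 v) (rho * r))).
  rewrite /arm_mass.
  have s00 : 0 <= S0 (pl 0 v) (rho * r) by exact: segm_ge0.
  have s10 : 0 <= S1 (pl 0 v) (rho * r) by exact: segm_ge0.
  have s20 : 0 <= S2 (pl 0 v) (rho * r) by exact: segm_ge0.
  have s11 : S1 (pl 0 v) (rho * r) <= 1 by exact: segm_le1.
  have [S10|S10] := eqVneq (S1 (pl 0 v) (rho * r)) 0.
    rewrite S10 !mulr0 mul0r; nra.
  have S1p : 0 < S1 (pl 0 v) (rho * r) by rewrite lt_def S10 s10.
  have [-> ->] := S1_pos_full v8 r0 S1p.
  rewrite !mulr1; nra.
have rr : enorm (pl 0 v - pl e v) + rho * r <= rho * (r + (eta1 + e)).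
  have : enorm (pl 0 v - pl e v) <= rho * e.
    by apply: enorm_pl_le => //; rewrite subrr sub0r sqrrN expr0n/= addr0.
  have : 0 <= rho * eta1 by rewrite mulr_ge0// ltW.
  lra.
rewrite /arm_mass; apply: lerD; first apply: lerD.
- by apply: ler_wpM2l; [lra|exact: segm_incl].
- by apply: ler_wpM2l; [lra|exact: segm_incl].
- by apply: ler_wpM2l; [lra|exact: segm_incl].
Qed.

(** For the quantiles above [m / 2], where [arm_mass_gain] no longer applies: both short arms lie in
    the ball, so the transferred mass is inside, and the displacement only helps on the second
    arm. *)
Lemma arm_mass_mono r : 2 <= r ->
  arm_mass 0 0 (pl 0 v) (rho * r) <= arm_mass eta1 eta2 (pl e v) (rho * r).
Proof.
case/andP: e08 => e0 e8; case/andP: NV => n0 n1 r2.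
have ee1 := etaN; have ee2 := eta10; have ee3 := eta20.
have r158 : 15 / 8 <= r by lra.
have r32 : 3 / 2 <= r by lra.
have r12 : 2^-1 <= r by lra.
have rr : rho * (r - e / 2) <= rho * r by rewrite ler_pM2l// lerBlDr lerDl divr_ge0.
have a1 := le_trans (S1_shift v8 e08 r158) (segm_incr _ _ _ rr).
rewrite /arm_mass (S0_full v8 e08 r32) (S2_full v8 e08 r12).
have s0 : S0 (pl 0 v) (rho * r) <= 1 by exact: segm_le1.
have s1 : S1 (pl e v) (rho * r) <= 1 by exact: segm_le1.
move: a1 s0 s1; rewrite -/S1.
move: (S0 (pl 0 v) (rho * r)) (S1 (pl 0 v) (rho * r)) (S1 (pl e v) (rho * r)) => x0 y0 y1.
move=> a1 s0 s1; clear rr.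
have a2 : (1 - N^-1) * y0 <= (1 - N^-1) * y1 by apply: ler_wpM2l; lra.
have a3 : N^-1 * x0 <= N^-1 by rewrite -[leRHS]mulr1 ler_wpM2l// ltW.
have a5 : (eta1 + eta2) * y1 <= (eta1 + eta2) * 1 by apply: ler_wpM2l; lra.
lra.
Qed.

Lemma arm_mass4 : 3 / N <= arm_mass 0 0 (pl 0 v) (rho * 4).
Proof.
case/andP: NV => n0 n1; have h := S1_lb4 v8.
have e0 : 0 <= (0 : R) <= 8^-1 by rewrite lexx invr_ge0 ler0n.
have r4 : 3 / 2 <= (4 : R) by lra.
rewrite /arm_mass (S0_full v8 e0 r4).
move: h; move: (S1 _ _) (S2 _ _) => x y h; nra.
Qed.

End masses.

End plane.

(** * Distance to measure near the axis *)

Section arm_energy.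
Context (R : realType) (d : nat) (c e1 e2 : 'rV[R]_d) (rho : R).
Hypotheses (rho0 : 0 < rho) (e12 : dot e1 e2 = 0)
  (e11 : dot e1 e1 = rho ^+ 2) (e22 : dot e2 e2 = rho ^+ 2).
Variables (N eps m p : R).
Hypotheses (m0 : 0 < m) (m1 : m <= 1) (p1 : 1 <= p) (eps08 : 0 <= eps <= 8^-1).
Hypothesis NE : N = 192 * p * 5 `^ (p - 1) / m.
Variables (eta1 eta2 : R) (mu0 mu1 : probability (borelRd R d) R).
Hypotheses (eta10 : 0 <= eta1) (eta20 : 0 <= eta2) (etaN : eta1 + eta2 <= N^-1).
Hypothesis mix0 : mixture (arms c e1 e2 N eps) mu0 (arm_weight N 0 0).
Hypothesis mix1 : mixture (arms c e1 e2 N eps) mu1 (arm_weight N eta1 eta2).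

Local Notation pl := (pl c e1 e2).

Lemma NmE : N * m = 192 * (p * 5 `^ (p - 1)).
Proof. by rewrite NE mulfVK ?gt_eqF// mulrA. Qed.

Lemma p5_ge1 : 1 <= p * 5 `^ (p - 1).
Proof.
have h : 1 <= 5 `^ (p - 1).
  by rewrite -[leLHS](powRr0 5) ler_powR ?subr_ge0// ler1n.
by have := p1; nra.
Qed.

Lemma Nm192 : 192 <= N * m.
Proof. by rewrite NmE; have := p5_ge1; lra. Qed.

Lemma N_ge192 : 192 <= N.
Proof. have := Nm192; have := m0; have := m1; nra. Qed.

Let N0 : 0 < N. Proof. have := N_ge192; lra. Qed.
Let p0 : 0 <= p. Proof. have := p1; lra. Qed.

Let rhoK r : rho * (r / rho) = r.
Proof. by rewrite mulrC divfK// gt_eqF. Qed.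

Let N3m : 3 / N <= m / 64.
Proof.
by rewrite ler_pdivrMr// mulrAC ler_pdivlMr// (mulrC m); have := Nm192; lra.
Qed.

(** The bands of [energy_compare] are cut at [3 / N], above which the radius is at least [2 rho] and
    below which it is at most [4 rho], and at [m / 2], which is at most 1/2 as [arm_mass_gain]
    demands. *)
Lemma energy_arm_compare v e : - 8^-1 <= v <= 8^-1 -> 0 <= e <= 8^-1 ->
  (energy m p mu1 (pl e v) + (rho * (eta1 + e) / 8 * (rho * 2) `^ (p - 1) * (m / 2 - 3 / N))%:E
   <= energy m p mu0 (pl 0 v) +
     (p * (rho * (eta1 + e)) * (rho * 4 + rho * (eta1 + e)) `^ (p - 1) * (3 / N))%:E)%E.
Proof.
move=> v8 e08; have e0 : 0 <= e by case/andP: e08.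
have N192 := N_ge192.
have h0 : 0 <= rho * (eta1 + e) by rewrite mulr_ge0 ?addr_ge0// ltW.
have N30 : 0 <= 3 / N by rewrite divr_ge0// ltW.
have u12 : 3 / N <= m / 2 by apply: le_trans N3m _; have := m0; lra.
have u2m : m / 2 <= m by have := m0; lra.
have u2h u : u < m / 2 -> u < 2^-1 by move=> hu; have := m1; lra.
have mass0 w r := mixture_arm_mass w r mix0.
have mass1 w r := mixture_arm_mass w r mix1.
have rr r : 0 < r -> 0 < r / rho by move=> r0; rewrite divr_gt0.
have low2 u r : 3 / N <= u -> 0 < r -> (u%:E < mu0 (eball (pl 0 v) r))%E -> 2 <= r / rho.
  move=> Nu r0; rewrite mass0 lte_fin -{1}(rhoK r) => hu.
  apply: (arm_mass_low rho0 e12 e11 e22 N192 (rr _ r0)).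
  exact: le_lt_trans hu.
have h80 : 0 <= rho * (eta1 + e) / 8 by rewrite divr_ge0.
have rho20 : 0 <= rho * 2 by rewrite mulr_ge0// ltW.
apply: (energy_compare p1 N30 u12 u2m rho20 h0 h80).
- move=> u /andP[_ u3]; apply: delta_le; first by rewrite mulr_gt0.
  rewrite mass0 lte_fin; apply: lt_le_trans u3 _.
  exact: arm_mass4.
- move=> u /andP[_ u3].
  have : (delta mu1 u (pl e v) + (- (rho * (eta1 + e)))%:E <= delta mu0 u (pl 0 v))%E.
    apply: delta_shift => r r0; rewrite opprK mass0 mass1 !lte_fin => hu.
    split; first by rewrite ltr_wpDr.
    apply: lt_le_trans hu _.
    have := arm_mass_shift c rho0 e12 e11 e22 N192 eps08 eta10 eta20 etaN v8 e08 (rr _ r0).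
    by rewrite mulrDr rhoK.
  by rewrite EFinN leeBlDr.
- move=> u /andP[u3 _]; apply: delta_ge => r r0 hu.
  by have := low2 u r u3 r0 hu; rewrite ler_pdivlMr// mulrC.
- move=> u /andP[u3 um]; apply: delta_shift => r r0 hu.
  have r2 := low2 u r u3 r0 hu.
  have rE : r - rho * (eta1 + e) / 8 = rho * (r / rho - (eta1 + e) / 8).
    by rewrite mulrBr rhoK mulrA.
  rewrite rE; move: hu; rewrite mass0 mass1 !lte_fin -{1}(rhoK r) => hu; split.
    rewrite mulr_gt0// subr_gt0.
    have NV : N^-1 <= 1 by rewrite invf_le1//; lra.
    by case/andP: e08 => ? ?; have := etaN; have := eta20; lra.
  exact: (arm_mass_gain rho0 e12 e11 e22 N192 eps08 eta10 eta20 etaN v8 e08 r2 (u2h _ um) hu).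
- move=> u /andP[um2 um].
  have : (delta mu1 u (pl e v) + 0%:E <= delta mu0 u (pl 0 v))%E; last by rewrite adde0.
  apply: delta_shift => r r0 hu; rewrite subr0; split => //.
  have r2 := low2 u r (le_trans u12 um2) r0 hu.
  rewrite mass0 lte_fin in hu; rewrite mass1 lte_fin; apply: lt_le_trans hu _.
  have := arm_mass_mono c rho0 e12 e11 e22 N192 eps08 eta10 eta20 etaN v8 e08 r2.
  by rewrite rhoK.
Qed.

Let arm_mass_le_far (w : 'rV[R]_d) r :
  (forall a b, 0 <= a <= N -> 0 <= b <= 1 -> enorm (pl a b - w) < r) ->
  mu0 (eball w r) = 1%E.
Proof.
move=> H; rewrite (mixture_arm_mass w r mix0) /arm_mass.
have N192 := N_ge192.
rewrite (_ : S0 _ _ _ _ _ = 1); last first.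
  apply: segm_full => t t01; rewrite seg_point_pl /eball/=.
  by apply: H; rewrite ?subr0 ?mulr0 ?addr0 ?add0r ?mulr1 ?lexx//; exact: ltW.
rewrite (_ : S1 _ _ _ _ _ _ = 1); last first.
  apply: segm_full => t /andP[t0 t1]; rewrite seg_point_pl /eball/=.
  apply: H; rewrite ?subr0 ?subrr ?mulr0 ?addr0 ?add0r ?mulr1 ?lexx ?ler01//.
  by rewrite mulr_ge0 ?(ltW N0)//= ger_pMl.
by rewrite !addr0 !subr0 !mulr1 mul0r addr0 subrKC.
Qed.

Lemma delta_arm_ub v u : 0 <= u < 1 ->
  (delta mu0 u (pl 0 v) <= (rho * (N + 2 + `|v|))%:E)%E.
Proof.
move=> /andP[u0 u1].
have r0 : 0 <= N + 2 + `|v| by rewrite !addr_ge0// ltW.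
apply: delta_le; first by rewrite mulr_gt0// ltr_wpDr// addr_gt0.
rewrite arm_mass_le_far ?lte_fin// => a b /andP[a0 aN] /andP[b0 b1].
rewrite (enorm_pl_ltE c rho0 e12 e11 e22)//.
apply: (@lt_le_trans _ _ ((N + 1 + `|v|) ^+ 2 + 1)).
  have h1 : (a - 0) ^+ 2 <= N ^+ 2 by rewrite subr0 ler_pXn2r ?nnegrE ?(ltW N0).
  have h2 : (b - v) ^+ 2 <= (1 + `|v|) ^+ 2.
    rewrite -(@real_normK _ (b - v)) ?num_real// ler_pXn2r ?nnegrE ?addr_ge0//.
    apply: (le_trans (ler_normB _ _)); rewrite lerD2r ger0_norm//.
  have h3 : 0 <= N * (1 + `|v|) by rewrite mulr_ge0 ?(ltW N0)// addr_ge0.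
  lra.
have h4 : 0 <= `|v| by []; have := N_ge192; nra.
Qed.

(** A ball of radius [rho] has mass at most [6 / N]: the short arms weigh at most [2 / N] together
    and [S1_small] bounds the rest. The choice of [N] puts this below [m / 2]. *)
Lemma delta_arm_lb (eta1' eta2' : R) mu w u :
  mixture (arms c e1 e2 N eps) mu (arm_weight N eta1' eta2') ->
  0 <= eta1' -> 0 <= eta2' -> eta1' + eta2' <= N^-1 ->
  m / 2 <= u -> (rho%:E <= delta mu u w)%E.
Proof.
move=> mix e10 e20 eN mu2; apply: delta_ge => r r0.
rewrite (mixture_arm_mass w r mix) lte_fin leNgt; apply: contraTN => rr.
rewrite -leNgt /arm_mass.
have N192 := N_ge192.
have s1 : S1 c e1 e2 N w r <= 4 / N.
  apply: le_trans (S1_small c rho0 e12 e11 e22 N192 w); apply: segm_incr.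
  exact: ltW.
have s10 : 0 <= S1 c e1 e2 N w r by exact: segm_ge0.
have s0 : S0 c e1 e2 w r <= 1 by exact: segm_le1.
have s2 : S2 c e1 e2 eps w r <= 1 by exact: segm_le1.
move: s1 s0 s10 s2; move: (S1 _ _ _ _ _ _) (S0 _ _ _ _ _) (S2 _ _ _ _ _ _) => x y z.
have Nm3 := N3m; have NV : 0 < N^-1 by rewrite invr_gt0.
move=> s1 s0 s10 s2.
have a1 : (N^-1 + eta1') * y <= N^-1 + eta1'.
  by rewrite -[leRHS]mulr1; apply: ler_wpM2l => //; rewrite addr_ge0// ltW.
have a2 : eta2' * z <= eta2' by rewrite -[leRHS]mulr1; apply: ler_wpM2l.
have a3 : (1 - N^-1 - eta1' - eta2') * x <= x.
  by rewrite -[leRHS]mul1r; apply: ler_wpM2r => //; lra.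
have := m0; lra.
Qed.

Lemma energy_arm_lb (eta1' eta2' : R) mu w :
  mixture (arms c e1 e2 N eps) mu (arm_weight N eta1' eta2') ->
  0 <= eta1' -> 0 <= eta2' -> eta1' + eta2' <= N^-1 ->
  ((rho `^ p * (m / 2))%:E <= energy m p mu w)%E.
Proof.
move=> mix e10 e20 eN; have -> : m / 2 = m - m / 2 by lra.
have mm := m0.
apply: energy_lb => //; [lra|lra|exact: ltW|].
by move=> u /andP[u2 _]; exact: (delta_arm_lb _ mix).
Qed.

Lemma dtm_arm_lb (eta1' eta2' : R) mu w :
  mixture (arms c e1 e2 N eps) mu (arm_weight N eta1' eta2') ->
  0 <= eta1' -> 0 <= eta2' -> eta1' + eta2' <= N^-1 ->
  ((rho / 2)%:E <= dtm m p mu w)%E.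
Proof.
move=> mix e10 e20 eN; rewrite /dtm -/(energy _ _ _ _).
have pp : 0 < p by apply: lt_le_trans p1.
have ip0 : 0 <= p^-1 by rewrite invr_ge0 ltW.
apply: (@le_trans _ _ (((m^-1)%:E * (rho `^ p * (m / 2))%:E) `^ p^-1)%E); last first.
  apply: (gt0_ler_poweR ip0); rewrite ?in_itv/= ?leey ?andbT.
  - by rewrite -EFinM lee_fin !mulr_ge0 ?powR_ge0 ?invr_ge0 ?(ltW m0)//.
  - rewrite mule_ge0 ?lee_fin ?invr_ge0 ?(ltW m0)//.
    by apply: integral_ge0 => u _; exact: poweR_ge0.
  - apply: lee_wpmul2l; first by rewrite lee_fin invr_ge0 ltW.
    exact: (energy_arm_lb _ mix).
rewrite -EFinM poweR_EFin lee_fin.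
have -> : m^-1 * (rho `^ p * (m / 2)) = rho `^ p * 2^-1 by field; rewrite gt_eqF.
rewrite powRM ?powR_ge0// -powRrM divff ?gt_eqF// powRr1 ?(ltW rho0)//.
rewrite ler_pM2l// ger1_powR//; first by rewrite invr_gt0 ltr0n invf_le1// ler1n.
by rewrite invf_le1.
Qed.

Definition arm_energy v : R := fine (energy m p mu0 (pl 0 v)).

Let energy_arm_ub v :
  (energy m p mu0 (pl 0 v) <= (m * (rho * (N + 2 + `|v|)) `^ p)%:E)%E.
Proof.
apply: energy_ub; rewrite ?(ltW m0)//.
  by rewrite mulr_ge0 ?(ltW rho0)// !addr_ge0// ltW.
move=> u /andP[u0 um]; apply: delta_arm_ub; rewrite u0/=.
exact: lt_le_trans um m1.
Qed.

Lemma arm_energyE v : energy m p mu0 (pl 0 v) = (arm_energy v)%:E.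
Proof.
rewrite /arm_energy fineK// ge0_fin_numE; last first.
  by apply: integral_ge0 => u _; exact: poweR_ge0.
by apply: le_lt_trans (energy_arm_ub v) _; rewrite ltry.
Qed.

Lemma arm_energy_ub v : arm_energy v <= m * (rho * (N + 2 + `|v|)) `^ p.
Proof. by rewrite -lee_fin -arm_energyE. Qed.

Lemma arm_energy_lb v : rho `^ p * (m / 2) <= arm_energy v.
Proof.
rewrite -lee_fin -arm_energyE; apply: (energy_arm_lb _ mix0) => //.
by rewrite addr0 invr_ge0 ltW.
Qed.

Variable beta : R.
Hypothesis beta1 : 1 <= beta.

Definition arm_cost v : R := ((m^-1 * arm_energy v) `^ p^-1) `^ beta.

Lemma arm_costE v : (dtm m p mu0 (pl 0 v) `^ beta = (arm_cost v)%:E)%E.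
Proof. by rewrite (dtm_energy (arm_energyE v)) poweR_EFin. Qed.

(** The energy drops by at least [m rho^p (eta1 + e) / 64] and is at most [m (rho (N + 3))^p]. The
    quotient, divided by [p] because of the root, gives the factor. *)
Lemma dtm_arm_compare v e : - 8^-1 <= v <= 8^-1 -> 0 <= e <= 8^-1 ->
  (dtm m p mu1 (pl e v) `^ beta <=
   (arm_cost v * (1 - (64 * p * (N + 3) `^ p)^-1 * (eta1 + e)))%:E)%E.
Proof.
move=> v8 e08.
have N192 := N_ge192; have mm := m0; have pp := p1; have e10 := eta10; have e20 := eta20.
have N3p : 1 <= (N + 3) `^ p by rewrite -[leLHS](powRr0 (N + 3)) ler_powR//; lra.
have N3p0 : 0 < (N + 3) `^ p by apply: lt_le_trans N3p.
have NV1 : N^-1 <= 1 by rewrite invf_le1//; lra.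
have h0 : 0 <= eta1 + e <= 2 by case/andP: e08 => ? ?; have eN := etaN; apply/andP; split; lra.
set h := eta1 + e in h0 *.
set cc := (64 * (N + 3) `^ p)^-1.
have cc0 : 0 < cc by rewrite invr_gt0 mulr_gt0.
have cc64 : cc <= 64^-1.
  by rewrite /cc lef_pV2 ?posrE ?mulr_gt0 ?ltr0n// -[leLHS]mulr1 ler_pM2l ?ltr0n.
have -> : (64 * p * (N + 3) `^ p)^-1 * h = cc * h / p.
  by rewrite /cc; field; rewrite !gt_eqF//; lra.
case/andP: h0 => h0 h2.
have ch : 0 <= cc * h < 1.
  apply/andP; split; first by rewrite mulr_ge0// ltW.
  by apply: (@le_lt_trans _ _ (64^-1 * 2)); [apply: ler_pM => //; exact: ltW|lra].
have ja : 0 <= arm_energy v.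
  by apply: le_trans (arm_energy_lb v); rewrite mulr_ge0 ?powR_ge0// divr_ge0// ltW.
apply: (dtm_pow_compare m0 p1 beta1 ch ja (arm_energyE v)).
have := energy_arm_compare v8 e08; rewrite -/h arm_energyE.
have e1e0 : (0 <= energy m p mu1 (pl e v))%E.
  by apply: integral_ge0 => u _; exact: poweR_ge0.
move: e1e0; case: (energy m p mu1 (pl e v)) => [j1 | |]//; rewrite -!EFinD !lee_fin => j10 H.
have jub : arm_energy v <= m * (rho * (N + 3)) `^ p.
  apply: le_trans (arm_energy_ub v) _; rewrite ler_pM2l//.
  have v1 : `|v| <= 8^-1 by rewrite ler_norml.
  apply: ge0_ler_powR; rewrite ?nnegrE ?mulr_ge0 ?(ltW rho0) ?addr_ge0 ?(ltW N0)//.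
    by rewrite ler_pM2l//; lra.
rewrite powRM ?(ltW rho0) ?addr_ge0 ?(ltW N0)// in jub.
have rp : rho `^ p = rho * rho `^ (p - 1) by rewrite mulr_powRB1 ?(ltW rho0)//; lra.
have rp0 : 0 < rho `^ (p - 1) by rewrite powR_gt0.
have g1 : rho `^ (p - 1) <= (rho * 2) `^ (p - 1).
  apply: ge0_ler_powR; rewrite ?nnegrE ?mulr_ge0 ?(ltW rho0)//; first by rewrite subr_ge0.
  by rewrite -[leLHS]mulr1 ler_pM2l// ler1n.
have hle1 : h <= 1.
  by case/andP: e08 => ? ?; rewrite /h; have := etaN; have : N^-1 <= 192^-1;
    [rewrite lef_pV2 ?posrE ?ltr0n|lra].
have g2 : (rho * 4 + rho * h) `^ (p - 1) <= rho `^ (p - 1) * 5 `^ (p - 1).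
  rewrite -powRM ?(ltW rho0)//.
  apply: ge0_ler_powR; rewrite ?nnegrE ?mulr_ge0 ?(ltW rho0)//; first by rewrite subr_ge0.
    by rewrite addr_ge0// mulr_ge0// ltW.
  have : rho * h <= rho by rewrite -[leRHS]mulr1 ler_pM2l.
  lra.
(* gain and loss, in units of m rho^p h: 31/512 and 1/64 *)
have gain : rho `^ p * h * (m * (31 / 512)) <=
    rho * h / 8 * (rho * 2) `^ (p - 1) * (m / 2 - 3 / N).
  have -> : rho `^ p * h * (m * (31 / 512)) =
    rho * h / 8 * rho `^ (p - 1) * (m * (31 / 64)) by rewrite rp; field.
  have rh : 0 <= rho * h / 8 by rewrite divr_ge0// mulr_ge0// ltW.
  apply: ler_pM => //.
  - by rewrite mulr_ge0// ltW.
  - by rewrite mulr_ge0 ?(ltW mm)//.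
  - by apply: ler_wpM2l.
  - by have := N3m; lra.
have loss : p * (rho * h) * (rho * 4 + rho * h) `^ (p - 1) * (3 / N) <=
    rho `^ p * h * (m / 64).
  apply: (@le_trans _ _ (p * (rho * h) * (rho `^ (p - 1) * 5 `^ (p - 1)) * (3 / N))).
    apply: ler_wpM2r; first by rewrite divr_ge0// ltW.
    by apply: ler_wpM2l => //; rewrite !mulr_ge0// ltW.
  have -> : p * (rho * h) * (rho `^ (p - 1) * 5 `^ (p - 1)) * (3 / N) =
     rho `^ p * h * (p * 5 `^ (p - 1) * (3 / N)) by rewrite rp; ring.
  apply: ler_wpM2l; first by rewrite mulr_ge0 ?powR_ge0.
  by rewrite mulrA ler_pdivrMr//; have := NmE; lra.
have key : cc * h * arm_energy v <= rho `^ p * h * (m / 64).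
  have : cc * h * arm_energy v <= cc * h * (m * (rho `^ p * (N + 3) `^ p)).
    by apply: ler_wpM2l => //; rewrite mulr_ge0// ltW.
  have -> : cc * h * (m * (rho `^ p * (N + 3) `^ p)) = rho `^ p * h * (m / 64).
    by rewrite /cc; field; rewrite gt_eqF.
  by [].
have X0 : 0 <= rho `^ p * h * m by rewrite !mulr_ge0 ?powR_ge0// ltW.
rewrite mulrBr mulr1 (mulrC (arm_energy v)).
move: gain loss key H X0.
move: (_ * (3 / N)) (_ * (m / 2 - 3 / N)) (cc * h * arm_energy v) (rho `^ p * h) => x1 x2 x3 x4.
lra.
Qed.

End arm_energy.

(** * Membership in the class *)

Section segment_sets.
Context (R : realType) (d : nat).
Implicit Types (u v w : 'rV[R]_d).

Definition seg_set u v : set 'rV[R]_d := seg_point u v @` `[0, 1]%classic.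

Lemma seg_set_connected u v : connected (seg_set u v).
Proof.
apply: connected_continuous_connected; first exact: segment_connected.
exact/continuous_subspaceT/seg_point_continuous.
Qed.

Lemma seg_set_compact u v : compact (seg_set u v).
Proof.
apply: continuous_compact; last exact: segment_compact.
exact/continuous_subspaceT/seg_point_continuous.
Qed.

Lemma seg_set_closed u v : closed (seg_set u v).
Proof.
apply: compact_closed; last exact: seg_set_compact.
exact: norm_hausdorff.
Qed.

Lemma seg_set_l u v : seg_set u v u.
Proof. by exists 0; rewrite /= ?in_itv/= ?lexx ?ler01// /seg_point scale0r addr0. Qed.

Lemma seg_set_r u v : seg_set u v v.
Proof.
exists 1; rewrite /= ?in_itv/= ?lexx ?ler01// /seg_point scale1r.
by rewrite addrC subrK.
Qed.

(** Of the two parameter intervals of length [q <= 1/2] adjacent to [t0], at least one stays in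
    [0, 1]. *)
Lemma segm_self_lb u v w r l : seg_set u v w -> 0 < r -> 0 < l ->
  enorm (v - u) <= l -> Num.min 2^-1 (r / l) <= segm u v w r.
Proof.
move=> [t0 + <-] r0 l0 vul; rewrite /= in_itv/= => /andP[t00 t01].
set q := Num.min _ _.
have q0 : 0 <= q by rewrite le_min invr_ge0 ler0n divr_ge0// ltW.
have q12 : q <= 2^-1 by rewrite ge_min lexx.
have qr : q * l <= r by rewrite -ler_pdivlMr// ge_min lexx orbT.
have inb t : t0 - q < t < t0 + q -> eball (seg_point u v t0) r (seg_point u v t).
  move=> tq; rewrite /eball/= /seg_point.
  rewrite (_ : _ - _ = (t - t0) *: (v - u)); last first.
    by apply/rowP => i; rewrite !mxE; ring.
  rewrite enormZ; have tq' : `|t - t0| < q.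
    by rewrite ltr_norml; move: tq => /andP[? ?]; apply/andP; split; lra.
  apply: lt_le_trans qr; apply: (@le_lt_trans _ _ (`|t - t0| * l)).
    exact: ler_wpM2l.
  by rewrite ltr_pM2r.
have [t2|t2] := leP t0 2^-1.
  have -> : q = (t0 + q) - t0 by ring.
  apply: segm_lb => //; [by rewrite lerDl|lra|].
  by move=> t /andP[? ?]; apply: inb; apply/andP; split; lra.
have -> : q = t0 - (t0 - q) by ring.
apply: segm_lb => //; [lra|by rewrite lerBlDr lerDl|].
by move=> t /andP[? ?]; apply: inb; apply/andP; split; lra.
Qed.

End segment_sets.

Section arm_class.
Context (R : realType) (d : nat) (c e1 e2 : 'rV[R]_d) (rho : R).
Hypotheses (rho0 : 0 < rho) (e12 : dot e1 e2 = 0)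
  (e11 : dot e1 e1 = rho ^+ 2) (e22 : dot e2 e2 = rho ^+ 2).
Variables (N eps : R).
Hypotheses (N192 : 192 <= N) (eps08 : 0 <= eps <= 8^-1).
Variables (eta1 eta2 : R) (mu : probability (borelRd R d) R).
Hypotheses (eta10 : 0 <= eta1) (eta20 : 0 <= eta2) (etaN : eta1 + eta2 <= N^-1).
Hypothesis mix : mixture (arms c e1 e2 N eps) mu (arm_weight N eta1 eta2).
Hypothesis eta2_eps : eta2 = 0 -> eps = 0.

Local Notation pl := (pl c e1 e2).

Definition arm_set : set 'rV[R]_d :=
  seg_set (pl 0 0) (pl 0 1) `|` seg_set (pl 0 1) (pl N 1) `|` seg_set (pl 0 0) (pl eps 0).

Let NV : 0 < N^-1 <= 192^-1.
Proof.
have N0 : 0 < N by have := N192; lra.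
by rewrite invr_gt0 N0/= lef_pV2 ?posrE ?N0 ?ltr0n// N192.
Qed.

Lemma arm_set_pl x : arm_set x ->
  exists a b, [/\ 0 <= a <= N, 0 <= b <= 1 & x = pl a b].
Proof.
have N0 : 0 <= N by have := N192; lra.
case/andP: eps08 => ep0 ep8.
move=> [[|]|] [t]; rewrite /= in_itv/= => /andP[t0 t1] <-; rewrite seg_point_pl.
- exists 0, t; split; rewrite ?lexx ?t0//.
  by rewrite !subr0 mulr0 mulr1 !add0r.
- exists (t * N), 1; split; rewrite ?lexx ?ler01 ?mulr_ge0 ?ler_piMl//.
  by rewrite subr0 subrr mulr0 add0r addr0.
- exists (t * eps), 0; split; rewrite ?lexx ?ler01 ?mulr_ge0//=.
    by have := N192; nra.
  by rewrite !subr0 mulr0 !add0r.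
Qed.

Lemma arm_set_connected : connected arm_set.
Proof.
apply: connectedU; [|apply: connectedU|]; try exact: seg_set_connected.
  exists (pl 0 0); split; last exact: seg_set_l.
  by left; exact: seg_set_l.
by exists (pl 0 1); split; [exact: seg_set_r|exact: seg_set_l].
Qed.

Lemma arm_set_closed : closed arm_set.
Proof. by do 2?apply: closedU; exact: seg_set_closed. Qed.

Let w0 : 0 < N^-1 + eta1. Proof. by case/andP: NV => ? ?; rewrite ltr_pwDl. Qed.
Let w1 : 2^-1 <= 1 - N^-1 - eta1 - eta2.
Proof. case/andP: NV => ? ?; have := etaN; lra. Qed.

Let len0 : enorm (pl 0 1 - pl 0 0) <= rho.
Proof.
rewrite -[leRHS]mulr1; apply: (enorm_pl_le c rho0 e12 e11 e22) => //.
by rewrite !subr0 expr0n expr1n/= add0r.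
Qed.

Let len1 : enorm (pl N 1 - pl 0 1) <= rho * N.
Proof.
apply: (enorm_pl_le c rho0 e12 e11 e22); first by have := N192; lra.
by rewrite !subr0 subrr expr0n/= addr0.
Qed.

Let len2 : enorm (pl eps 0 - pl 0 0) <= rho * eps.
Proof.
case/andP: eps08 => ep0 ep8.
by apply: (enorm_pl_le c rho0 e12 e11 e22) => //; rewrite !subr0 expr0n/= addr0.
Qed.

Let armE w r := mixture_arm_mass w r mix.

Let mass_ge0 w r : 0 <= S0 c e1 e2 w r /\ 0 <= S1 c e1 e2 N w r /\ 0 <= S2 c e1 e2 eps w r.
Proof. by split; [|split]; exact: segm_ge0. Qed.

Let mass_S0 w r : N^-1 * S0 c e1 e2 w r <= arm_mass c e1 e2 N eps eta1 eta2 w r.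
Proof.
rewrite /arm_mass; have [] := mass_ge0 w r.
move: (S0 _ _ _ _ _) (S1 _ _ _ _ _ _) (S2 _ _ _ _ _ _) => x y z x0 [y0 z0].
have h1 : 0 <= eta1 * x by rewrite mulr_ge0.
have h2 : 0 <= eta2 * z by rewrite mulr_ge0.
have h3 : 0 <= (1 - N^-1 - eta1 - eta2) * y by rewrite mulr_ge0// (le_trans _ w1).
lra.
Qed.

Let mass_S1 w r : 2^-1 * S1 c e1 e2 N w r <= arm_mass c e1 e2 N eps eta1 eta2 w r.
Proof.
rewrite /arm_mass; have [] := mass_ge0 w r.
move: (S0 _ _ _ _ _) (S1 _ _ _ _ _ _) (S2 _ _ _ _ _ _) => x y z x0 [y0 z0].
have h1 : 0 <= (N^-1 + eta1) * x by rewrite mulr_ge0// ltW.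
have h2 : 0 <= eta2 * z by rewrite mulr_ge0.
have h3 : 2^-1 * y <= (1 - N^-1 - eta1 - eta2) * y by exact: ler_wpM2r.
lra.
Qed.

Let mass_S2 w r : eta2 * S2 c e1 e2 eps w r <= arm_mass c e1 e2 N eps eta1 eta2 w r.
Proof.
rewrite /arm_mass; have [] := mass_ge0 w r.
move: (S0 _ _ _ _ _) (S1 _ _ _ _ _ _) (S2 _ _ _ _ _ _) => x y z x0 [y0 z0].
have h1 : 0 <= (N^-1 + eta1) * x by rewrite mulr_ge0// ltW.
have h3 : 0 <= (1 - N^-1 - eta1 - eta2) * y by rewrite mulr_ge0// (le_trans _ w1).
lra.
Qed.

Lemma supp_arms : supp mu = arm_set.
Proof.
apply/seteqP; split => x.
  move=> sx; apply: contrapT => nx.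
  have /open_eballP/(_ nx)[r r0 xr] : open (~` arm_set) by exact/closed_openC/arm_set_closed.
  have := sx r r0; rewrite armE lte_fin /arm_mass.
  have z u v : seg_set u v `<=` arm_set -> segm u v x r = 0.
    move=> uv; apply/eqP; rewrite eq_le segm_ge0 andbT leNgt; apply/negP => /segm_gt0P[t t01 xt].
    by have := xr _ xt; apply; apply: uv; exists t.
  rewrite /S0 /S1 /S2 !z ?mulr0 ?addr0 ?ltxx// => y; rewrite /arm_set.
  - by right.
  - by left; right.
  - by left; left.
have hmin (r l : R) : 0 < r -> 0 < l -> 0 < Num.min 2^-1 (r / l).
  by move=> r0 l0; rewrite lt_min invr_gt0 ltr0n divr_gt0.
move=> [[|]|] xs r r0; rewrite armE lte_fin.
- apply: lt_le_trans (mass_S0 x r); apply: mulr_gt0; first by case/andP: NV.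
  exact: lt_le_trans (hmin _ _ r0 rho0) (segm_self_lb xs r0 rho0 len0).
- have rN : 0 < rho * N by rewrite mulr_gt0//; have := N192; lra.
  apply: lt_le_trans (mass_S1 x r); apply: mulr_gt0 => //.
  exact: lt_le_trans (hmin _ _ r0 rN) (segm_self_lb xs r0 rN len1).
(* If [eps = 0] the third arm is the corner [pl 0 0], which the first arm charges even when
   [eta2 = 0]. *)
have [ep0|ep0] := eqVneq eps 0.
  have xO : x = pl 0 0.
    by case: xs => t _ <-; rewrite seg_point_pl ep0 !subr0 mulr0 addr0.
  apply: lt_le_trans (mass_S0 x r); apply: mulr_gt0; first by case/andP: NV.
  apply: lt_le_trans (hmin _ _ r0 rho0) (segm_self_lb _ r0 rho0 len0).
  by rewrite xO; exact: seg_set_l.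
have ep : 0 < eps by rewrite lt_def ep0; case/andP: eps08.
have eta2p : 0 < eta2.
  rewrite lt_def eta20 andbT; apply/eqP => /eta2_eps /eqP; by rewrite (negbTE ep0).
have rE : 0 < rho * eps by rewrite mulr_gt0.
apply: lt_le_trans (mass_S2 x r); apply: mulr_gt0 => //.
exact: lt_le_trans (hmin _ _ r0 rE) (segm_self_lb xs r0 rE len2).
Qed.

Hypothesis rhoN : rho * (N + 3) <= 1.

Let rho1 : rho <= 1.
Proof. have := N192; have := rhoN; have := rho0; nra. Qed.

(** The link between [eps] and [eta2]: the worst case is a ball about a point of the third arm with
    radius comparable to its length, where the mass is of order [eta2]. *)
Lemma arms_standard (a b : R) : 1 <= b -> 0 < a -> a <= N^-1 / 4 ->
  a * (2 * eps) `^ b <= eta2 / 2 -> standard a b mu.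
Proof.
move=> b1 a0 aN aeps x r; rewrite supp_arms => sx r0 ra.
have b0 : 0 < b by apply: lt_le_trans b1.
have N0 : 0 < N by have := N192; lra.
have [n0 n1] := andP NV.
have [ep0 ep8] := andP eps08.
(* For [r >= 1] the ball contains all the arms, by [rhoN], and the bound on [r] says that
   [a r^b <= 1]. Below 1, [b >= 1] gives [r^b <= r]. *)
have [r1|r1] := leP 1 r.
  have -> : mu (eball x r) = 1%E.
    have [a' [b' [/andP[a0' aN'] /andP[b0' b1'] ->]]] := arm_set_pl sx.
    have full u v : seg_set u v `<=` arm_set -> segm u v (pl a' b') r = 1.
      move=> uv; apply: segm_full => t t01; apply: lt_le_trans r1.
      have /arm_set_pl[a2 [b2 [/andP[a20 a2N] /andP[b20 b21] ->]]] : arm_set (seg_point u v t).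
        by apply: uv; exists t.
      have rN2 : rho * (N + 2) < 1.
        by apply: lt_le_trans rhoN; rewrite ltr_pM2l// ltrD2l ltr_nat.
      apply: le_lt_trans rN2; apply: (enorm_pl_le c rho0 e12 e11 e22); first lra.
      have h1 : (a2 - a') ^+ 2 <= N ^+ 2 by apply: sqr_le_itv; lra.
      have h2 : (b2 - b') ^+ 2 <= 1 ^+ 2 by apply: sqr_le_itv; lra.
      nra.
    rewrite armE /arm_mass /S0 /S1 /S2 !full => [|y|y|y].
    - by congr (_%:E); lra.
    - by rewrite /arm_set; right.
    - by rewrite /arm_set; left; right.
    - by rewrite /arm_set; left; left.
  rewrite lee_fin.
  have -> : 1 = a * (a `^ (- b^-1)) `^ b.
    by rewrite -powRrM mulNr mulVf ?gt_eqF// powR_inv1 ?(ltW a0)// divff// gt_eqF.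
  apply: ler_wpM2l; first exact: ltW.
  by apply: ge0_ler_powR; rewrite ?nnegrE ?powR_ge0 ?(ltW b0) ?(ltW r0).
have rb : r `^ b <= r by apply: ge1r_powR; rewrite // r0 ltW.
have arb : a * r `^ b <= a * r by apply: ler_wpM2l => //; exact: ltW.
rewrite armE lee_fin.
have hmin (r' l : R) : 0 < r' -> r' <= 1 -> 0 < l -> l <= 1 -> r' / 2 <= Num.min 2^-1 (r' / l).
  move=> r'0 r'1 l0 l1; rewrite le_min; apply/andP; split; first lra.
  rewrite ler_pM2l// lef_pV2 ?posrE ?ltr0n//; lra.
have O0 (r' : R) : 0 < r' -> r' <= 1 -> r' / 2 <= S0 c e1 e2 (pl 0 0) r'.
  move=> r'0 r'1; apply: le_trans (hmin _ _ r'0 r'1 rho0 rho1) _.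
  by apply: segm_self_lb => //; exact: seg_set_l.
case: sx => [[xs|xs]|xs].
- apply: le_trans (mass_S0 x r); apply: le_trans arb _.
  apply: (@le_trans _ _ (N^-1 * (r / 2))); first nra.
  apply: ler_wpM2l; first exact: ltW.
  exact: le_trans (hmin _ _ r0 (ltW r1) rho0 rho1) (segm_self_lb xs r0 rho0 len0).
- apply: le_trans (mass_S1 x r); apply: le_trans arb _.
  have rN : 0 < rho * N by rewrite mulr_gt0.
  have rN1 : rho * N <= 1 by apply: le_trans rhoN; rewrite ler_pM2l//; lra.
  apply: (@le_trans _ _ (2^-1 * (r / 2))); first nra.
  apply: ler_wpM2l; first by rewrite invr_ge0.
  exact: le_trans (hmin _ _ r0 (ltW r1) rN rN1) (segm_self_lb xs r0 rN len1).
(* A ball at least twice as large as the third arm contains the ball of radius [r / 2] about the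
   corner, where the first arm has enough mass. *)
have [re|re] := leP (2 * (rho * eps)) r.
  apply: le_trans (mass_S0 x r); apply: le_trans arb _.
  apply: (@le_trans _ _ (N^-1 * (r / 2 / 2))); first nra.
  apply: ler_wpM2l; first exact: ltW.
  apply: (@le_trans _ _ (S0 c e1 e2 (pl 0 0) (r / 2))); first by apply: O0; lra.
  apply: segm_incl; have : enorm (pl 0 0 - x) <= rho * eps; last lra.
  case: xs => t; rewrite /= in_itv/= => /andP[t0 t1] <-; rewrite seg_point_pl.
  apply: (enorm_pl_le c rho0 e12 e11 e22) => //.
  have -> : (0 - (0 + t * (eps - 0))) ^+ 2 + (0 - (0 + t * (0 - 0))) ^+ 2 = (t * eps) ^+ 2.
    by ring.
  by apply: sqr_le_itv; nra.
have ep : 0 < eps.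
  rewrite lt_def ep0 andbT; apply/eqP => ez; move: re; rewrite ez !mulr0; lra.
have rE : 0 < rho * eps by rewrite mulr_gt0.
apply: le_trans (mass_S2 x r).
(* For smaller radii [a r^b] decreases at least like [q], as [b >= 1], and the mass of the third arm
   in the ball is at least [eta2 * q / 2]. *)
set q := r / (2 * (rho * eps)).
have q0 : 0 < q by rewrite divr_gt0// mulr_gt0.
have q1 : q <= 1 by rewrite ler_pdivrMr ?mulr_gt0// mul1r ltW.
have rq : r <= q * (2 * eps).
  rewrite /q mulrAC ler_pdivlMr ?mulr_gt0// ler_wpM2l ?(ltW r0)//.
  by rewrite ler_pM2l ?ltr0n// ger_pMl.
have h1 : a * r `^ b <= q * (eta2 / 2).
  apply: (@le_trans _ _ (a * (q * (2 * eps) `^ b))).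
    apply: ler_wpM2l; first exact: ltW.
    apply: (@le_trans _ _ ((q * (2 * eps)) `^ b)).
      apply: (ge0_ler_powR (ltW b0)) => //; rewrite nnegrE; first exact: ltW.
      by apply: mulr_ge0; [exact: ltW|exact: mulr_ge0].
    have e20 : 0 <= 2 * eps by rewrite mulr_ge0.
    rewrite (powRM b (ltW q0) e20); apply: ler_wpM2r; first exact: powR_ge0.
    by apply: ge1r_powR => //; rewrite q0.
  by rewrite mulrCA; apply: ler_wpM2l => //; exact: ltW.
apply: le_trans h1 _; rewrite mulrCA; apply: ler_wpM2l => //.
apply: le_trans (segm_self_lb xs r0 rE len2).
have qE : r / (rho * eps) = 2 * q by rewrite /q; field; rewrite !gt_eqF.
rewrite le_min qE; apply/andP; split; lra.
Qed.

Lemma arms_measure_class (m p a b sigma : R) (K : set 'rV[R]_d) :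
  0 < m -> m <= 1 -> 1 <= p -> N = 192 * p * 5 `^ (p - 1) / m ->
  (forall a' b', 0 <= a' <= N -> 0 <= b' <= 1 -> K (pl a' b')) ->
  1 <= b -> 0 < a -> a <= N^-1 / 4 -> a * (2 * eps) `^ b <= eta2 / 2 ->
  sigma <= rho / 2 ->
  measure_class m p K a b sigma mu.
Proof.
move=> m0 m1 p1 NE HK b1 a0 aN aeps sr; split.
- by rewrite supp_arms => x /arm_set_pl[a' [b' [h1 h2 ->]]]; exact: HK.
- exact: arms_standard.
- move=> x; apply: le_trans (dtm_arm_lb rho0 e12 e11 e22 m0 m1 p1 NE x mix _ _ _) => //.
- by rewrite supp_arms; exact: arm_set_connected.
Qed.

End arm_class.

(** * Lower bound on the length of paths *)

Section path_calculus.
Context (R : realType) (d : nat).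
Implicit Types (gamma : R -> 'rV[R]_d).
Local Notation leb := (@lebesgue_measure R).

Lemma is_derive_dot gamma (w z : 'rV[R]_d) v : derivable gamma v 1 ->
  is_derive v 1 (fun t => dot (gamma t - w) z) (dot (derive1 gamma v) z).
Proof.
move=> dg; have dgi i : derivable (fun t => gamma t ord0 i) v 1.
  by move/derivable_mxP : dg => /(_ ord0 i).
have -> : (fun t => dot (gamma t - w) z) =
    (\sum_(i < d) (fun t => z ord0 i *: (gamma t ord0 i - w ord0 i))).
  apply/funext => t; rewrite fct_sumE; apply: eq_bigr => i _.
  by rewrite !mxE mulrC.
have -> : dot (derive1 gamma v) z =
    \sum_(i < d) z ord0 i *: (derive1 (fun t => gamma t ord0 i) v).
  apply: eq_bigr => i _; rewrite [LHS]mulrC; congr (_ * _).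
  by rewrite !derive1E derive_mx// mxE.
apply: is_derive_sum => i; apply: is_deriveZ.
rewrite -[derive1 _ _]subr0; apply: is_deriveB; rewrite derive1E.
exact: derivableP.
Qed.

Lemma dot_lipschitz gamma (k : R) (w z : 'rV[R]_d) :
  (forall s t, s \in `[0, 1] -> t \in `[0, 1] ->
     enorm (gamma s - gamma t) <= k * `|s - t|) ->
  forall s t, s \in `[0, 1] -> t \in `[0, 1] ->
    `|dot (gamma s - w) z - dot (gamma t - w) z| <= k * enorm z * `|s - t|.
Proof.
move=> gk s t s01 t01; rewrite -dotBl.
have -> : gamma s - w - (gamma t - w) = gamma s - gamma t.
  by rewrite opprB addrA subrK.
apply: (@le_trans _ _ (enorm (gamma s - gamma t) * enorm z)).
  rewrite ler_norml dot_le andbT lerNl -dotNl; apply: le_trans (dot_le _ _) _.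
  by rewrite enormN.
by rewrite mulrAC; apply: ler_wpM2r; [exact: enorm_ge0|exact: gk].
Qed.

(** The last zero before [t1] and the first one after it exist by compactness of the zero set.
    Applied to the distance to the axis, this yields a maximal excursion of a path. *)
Lemma zero_free_interval (r : R -> R) (k t1 : R) : 0 <= k ->
  (forall x y, x \in `[0, 1] -> y \in `[0, 1] -> `|r x - r y| <= k * `|x - y|) ->
  r 0 = 0 -> r 1 = 0 -> 0 <= t1 <= 1 -> r t1 <> 0 ->
  exists a b, [/\ 0 <= a, a < t1, t1 < b, b <= 1 &
    [/\ r a = 0, r b = 0 & forall t, a < t < b -> r t <> 0]].
Proof.
move=> k0 rk r0 r1 /andP[t0 t1'] rt1.
have [H Hk Hr] := lipschitz_clamp k0 rk.
have Hc := lipschitz_continuous Hk.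
have r_H x : 0 <= x <= 1 -> r x = H x by move=> x01; rewrite Hr// in_itv.
have cZ (x y : R) : compact (`[x, y]%classic `&` H @^-1` [set 0]).
  apply: compact_closedI; first exact: segment_compact.
  by apply: closed_comp => [t _|]; [exact: Hc|exact: closed_eq].
have [||a /set_mem[/= + Ha] amax] := @compact_EVT_max _ R id _ _ (cZ 0 t1).
- by exists 0; split; rewrite /= ?in_itv/= ?lexx// -r_H ?lexx ?ler01.
- by apply/continuous_subspaceT => x; exact: cvg_id.
rewrite in_itv/= => /andP[a0 at1].
have [||b /set_mem[/= + Hb] bmin] := @compact_EVT_max _ R -%R _ _ (cZ t1 1).
- by exists 1; split; rewrite /= ?in_itv/= ?lexx ?t1'// -r_H ?lexx ?ler01.
- by apply/continuous_subspaceT => x; exact: opp_continuous.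
rewrite in_itv/= => /andP[t1b b1].
have t1H : H t1 <> 0 by rewrite -r_H ?t0.
have ra : r a = 0 by rewrite r_H// a0 (le_trans at1).
have rb : r b = 0 by rewrite r_H// b1 (le_trans t0).
exists a, b; split => //.
- by rewrite lt_neqAle at1 andbT; apply/eqP => e; apply: t1H; rewrite -e.
- by rewrite lt_neqAle t1b andbT; apply/eqP => e; apply: t1H; rewrite e.
split => // t /andP[ta tb]; rewrite r_H; last first.
  by rewrite (le_trans a0 (ltW ta)) (le_trans (ltW tb) b1).
move=> Ht; have [tt1|tt1] := leP t t1.
  have /amax : t \in `[0, t1]%classic `&` H @^-1` [set 0].
    by rewrite inE; split => //=; rewrite in_itv/= tt1 andbT (le_trans a0 (ltW ta)).
  by rewrite leNgt ta.
have /bmin : t \in `[t1, 1]%classic `&` H @^-1` [set 0].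
  by rewrite inE; split => //=; rewrite in_itv/= (ltW tt1) (le_trans (ltW tb) b1).
by rewrite lerN2 leNgt tb.
Qed.

End path_calculus.

Section path_lower_bound.
Context (R : realType) (d : nat) (c e1 e2 : 'rV[R]_d) (rho : R).
Hypotheses (rho0 : 0 < rho) (e22 : dot e2 e2 = rho ^+ 2).
Local Notation leb := (@lebesgue_measure R).
Local Notation pl := (pl c e1 e2).
Variables (f : 'rV[R]_d -> \bar R) (fmin : R) (cost : R -> R) (F : set 'rV[R]_d).
Hypotheses (fmin0 : 0 <= fmin) (fminP : forall w, (fmin%:E <= f w)%E).
Hypotheses (costE : forall v, f (pl 0 v) = (cost v)%:E) (cost_cont : continuous cost).
Hypothesis F_near : forall w, F w -> enorm (w - c) < rho / 2 -> exists v, w = pl 0 v.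
Variable s : R.
Hypothesis s8 : 0 < s <= 8^-1.

Let f0 w : (0 <= f w)%E. Proof. by apply: le_trans (fminP w); rewrite lee_fin. Qed.

Let G (gamma : R -> 'rV[R]_d) (t : R) : \bar R :=
  (f (gamma t) * (enorm (derive1 gamma t))%:E)%E.

Let G0 gamma t : (0 <= G gamma t)%E.
Proof. by rewrite mule_ge0// lee_fin enorm_ge0. Qed.

Let e2n : enorm e2 = rho.
Proof.
by rewrite enormE e22 sqrtr_sqr gtr0_norm.
Qed.

Let pl0 v : pl 0 v = c + v *: e2.
Proof. by rewrite /pl scale0r addr0. Qed.

Let pl_norm v v' : enorm (pl 0 v - pl 0 v') = rho * `|v - v'|.
Proof.
rewrite !pl0 (_ : _ - _ = (v - v') *: e2) ?enormZ ?e2n 1?mulrC//.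
by apply/rowP => i; rewrite !mxE; ring.
Qed.

(* The direction from x to the far point calibrates the length. *)
Lemma far_path_lb gamma tau : admissible_path F (pl 0 (- s)) (pl 0 s) gamma ->
  0 <= tau <= 1 -> rho / 2 <= enorm (gamma tau - c) ->
  ((fmin * (rho * (3 / 8)))%:E <= \int[leb]_(t in `[0%R, 1%R]) G gamma t)%E.
Proof.
move=> [rg g0 g1 _] /andP[t0 t1] far.
have [N nN dN] := rectifiable_derivable rg; have [k gk] := rg.
set x := pl 0 (- s) in g0.
have dist : rho * (3 / 8) <= enorm (gamma tau - x).
  have : enorm (gamma tau - c) <= enorm (gamma tau - x) + enorm (x - c).
    exact: enorm_triangle.
  have -> : enorm (x - c) = rho * s.
    have -> : c = pl 0 0 by rewrite pl0 scale0r addr0.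
    by rewrite /x pl_norm subr0 normrN gtr0_norm//; case/andP: s8.
  case/andP: s8 => s0 s18; have : rho * s <= rho * 8^-1 by rewrite ler_pM2l.
  lra.
set L := enorm (gamma tau - x) in dist.
have L0 : 0 < L by apply: lt_le_trans dist; rewrite mulr_gt0// divr_gt0.
pose z := (fmin / L) *: (gamma tau - x).
have zn : enorm z = fmin.
  by rewrite enormZ -/L ger0_norm ?divfK ?gt_eqF// divr_ge0// ltW.
have := lipschitz_increment_le (dot_lipschitz x z gk) (lexx 0) t0 t1 (G0 gamma) nN.
have -> : dot (gamma tau - x) z - dot (gamma 0 - x) z = fmin * L.
  have d0 : dot (0 : 'rV[R]_d) z = 0 by rewrite -(scale0r (0 : 'rV[R]_d)) dotZl mul0r.
  rewrite g0 subrr d0 subr0 dotZr -enorm_sqr -/L.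
  by field; rewrite gt_eqF.
move=> H; apply: le_trans (H _); first by rewrite lee_fin ler_wpM2l.
move=> v /andP[v0 vt] nNv _.
have v01 : 0 < v < 1 by rewrite v0 (lt_le_trans vt).
have := is_derive_dot x z (dN v v01 nNv) => -[_ dE].
rewrite derive1E dE; apply: (@le_trans _ _ (fmin%:E * (enorm (derive1 gamma v))%:E)%E).
  by rewrite -EFinM lee_fin mulrC -{1}zn dot_le.
by apply: lee_wpmul2r; rewrite ?lee_fin ?enorm_ge0.
Qed.

(** During an excursion off the axis the path avoids [F], so its direction is a constant [u]. Let
    [z] be the component of [gamma t1 - c] orthogonal to the axis. The product of [gamma - c] with
    [z] vanishes at both ends of the excursion and is positive at [t1], yet its derivative keeps the
    sign of [dot u z]. *)
Lemma near_path_on_axis gamma : admissible_path F (pl 0 (- s)) (pl 0 s) gamma ->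
  (forall t, 0 <= t <= 1 -> enorm (gamma t - c) < rho / 2) ->
  forall t, 0 <= t <= 1 -> gamma t = pl 0 (dot (gamma t - c) e2 / rho ^+ 2).
Proof.
move=> [rg g0 g1 dirg] near t1 t101.
have [N nN dN] := rectifiable_derivable rg; have [k gk] := rg.
have rho2 : rho ^+ 2 != 0 by rewrite expf_eq0/= gt_eqF.
(* The projection along the axis onto the orthogonal complement of [e2]. *)
pose T (w : 'rV[R]_d) := w - (dot w e2 / rho ^+ 2) *: e2.
have T_e2 w : dot (T w) e2 = 0.
  by rewrite /T dotBl dotZl e22 divfK ?subrr.
have TB w w' : T w - T w' = T (w - w').
  by rewrite /T dotBl; apply/rowP => i; rewrite !mxE; ring.
have TZ v : T (v *: e2) = 0.
  by rewrite /T dotZl e22 mulfK// subrr.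
have Tn w : enorm (T w) <= enorm w.
  have -> : T w = w - (dot w e2 / rho ^+ 2) *: e2 by [].
  rewrite -(@ler_pXn2r _ 2)// ?nnegrE ?enorm_ge0// !enorm_sqr.
  rewrite dotBl !dotBr !dotZl !dotZr (dotC e2 w) e22.
  have -> : dot w w - dot w e2 / rho ^+ 2 * dot w e2 -
    (dot w e2 / rho ^+ 2 * dot w e2 - dot w e2 / rho ^+ 2 * (dot w e2 / rho ^+ 2 * rho ^+ 2))
    = dot w w - dot w e2 ^+ 2 / rho ^+ 2 by field; rewrite gt_eqF.
  by rewrite lerBlDr lerDl divr_ge0// ?sqr_ge0.
pose r t := enorm (T (gamma t - c)).
suff r0 : r t1 = 0.
  have /eqP := enorm0_eq0 r0; rewrite subr_eq0 => /eqP e.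
  by rewrite pl0 -e addrC subrK.
apply: contrapT => rt1.
have k0 : 0 <= `|k| by [].
have [|||a [b [a0 at1 t1b b1 [ra rb rab]]]] := @zero_free_interval R r `|k| t1 k0 _ _ _ t101 rt1.
- move=> x y x01 y01; apply: (@le_trans _ _ (enorm (gamma x - gamma y))).
    have xy : enorm (T (gamma x - c) - T (gamma y - c)) <= enorm (gamma x - gamma y).
      by rewrite TB opprB addrA subrK; exact: Tn.
    apply: le_trans xy; rewrite /r ler_norml; apply/andP; split.
      by rewrite lerNl opprB enorm_distC lerBlDr -{1}(subrK (T (gamma x - c)) (T (gamma y - c))) enormD.
    by rewrite lerBlDr -{1}(subrK (T (gamma y - c)) (T (gamma x - c))) enormD.
  by apply: le_trans (gk _ _ x01 y01) _; apply: ler_wpM2r => //; exact: ler_norm.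
- by rewrite /r g0 pl0 addrAC subrr add0r TZ enorm0.
- by rewrite /r g1 pl0 addrAC subrr add0r TZ enorm0.
pose z := T (gamma t1 - c).
have axis_z t : r t = 0 -> dot (gamma t - c) z = 0.
  move=> /enorm0_eq0 /eqP; rewrite subr_eq0 => /eqP ->.
  by rewrite dotZl (dotC e2 z) /z T_e2 mulr0.
have t1z : 0 < dot (gamma t1 - c) z.
  have -> : dot (gamma t1 - c) z = enorm z ^+ 2.
    have ez : dot e2 z = 0 by rewrite dotC /z T_e2.
    have -> : enorm z ^+ 2 = dot (gamma t1 - c) z - dot (gamma t1 - c) e2 / rho ^+ 2 * dot e2 z.
      by rewrite enorm_sqr -dotZl -dotBl.
    by rewrite ez mulr0 subr0.
  by rewrite exprn_gt0// lt_neqAle enorm_ge0 andbT eq_sym; apply/eqP.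
have offF : gamma @` `]a, b[%classic `<=` ~` F.
  move=> _ [t /= + <-] Ft; rewrite in_itv/= => tab.
  have t01 : 0 <= t <= 1.
    by case/andP: tab => h1 h2; rewrite (le_trans a0 (ltW h1)) (le_trans (ltW h2) b1).
  have [v ev] := F_near Ft (near t t01).
  by apply: (rab t tab); rewrite /r ev pl0 addrAC subrr add0r TZ enorm0.
have [u un gu] := dirg a b a0 (lt_trans at1 t1b) b1 offF.
have G00 (v : R) : (0 <= (fun=> 0%E : \bar R) v)%E by [].
have gd v : a < v < b -> ~ N v -> is_derive v 1 (fun t => dot (gamma t - c) z)
    (enorm (derive1 gamma v) * dot u z).
  move=> /andP[av vb] nNv.
  have dv : derivable gamma v 1.
    by apply: dN => //; rewrite (le_lt_trans a0 av) (lt_le_trans vb b1).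
  have vab : v \in `]a, b[ by rewrite in_itv/= av vb.
  by rewrite -dotZl -(gu v vab dv); exact: is_derive_dot.
have [uz|uz] := leP 0 (dot u z).
  have gkN := dot_lipschitz c (- z) gk.
  have := lipschitz_increment_le gkN (le_trans a0 (ltW at1)) (ltW t1b) b1 G00 nN.
  rewrite integral0 lee_fin => H.
  have : dot (gamma b - c) (- z) - dot (gamma t1 - c) (- z) <= 0.
    apply: H => v /andP[tv vb] nNv _.
    have dv : derivable gamma v 1.
      by apply: dN => //; rewrite (le_lt_trans (le_trans a0 (ltW at1)) tv) (lt_le_trans vb b1).
    have [_ dE] := is_derive_dot c (- z) dv.
    have vab : v \in `]a, b[ by rewrite in_itv/= (lt_trans at1 tv) vb.
    rewrite derive1E dE (gu v vab dv).
    by rewrite dotZl dotNr lee_fin mulrN oppr_le0 mulr_ge0 ?enorm_ge0.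
  by rewrite !dotNr (axis_z b rb) oppr0 sub0r opprK leNgt t1z.
have := lipschitz_increment_le (dot_lipschitz c z gk) a0 (ltW at1) (le_trans (ltW t1b) b1) G00 nN.
rewrite integral0 lee_fin => H.
have : dot (gamma t1 - c) z - dot (gamma a - c) z <= 0.
  apply: H => v /andP[av vt] nNv _.
  have [_ dE] := gd v (introT andP (conj av (lt_trans vt t1b))) nNv.
  by rewrite derive1E dE lee_fin mulr_ge0_le0 ?enorm_ge0// ltW.
by rewrite (axis_z a ra) subr0 leNgt t1z.
Qed.

Let cost0 v : 0 <= cost v.
Proof. by rewrite -lee_fin -costE. Qed.

Definition axis_cost (t : R) : R := cost (s * (2 * t - 1)).

Let axis_cost_continuous : continuous axis_cost.
Proof.
have -> : axis_cost = cost \o (fun t => s * (2 * t - 1)) by [].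
move=> t; apply: continuous_comp; last exact: cost_cont.
apply: (@continuousM _ _ (cst s)); first exact: cst_continuous.
apply: (@continuousB _ _ _ (fun t : R => 2 * t) (cst 1)); last exact: cst_continuous.
by apply: (@continuousM _ _ (cst 2)); [exact: cst_continuous|exact: cvg_id].
Qed.

(** It starts at [- B], not at 0, so as to be differentiable at negative points: a path may
    overshoot its endpoints. *)
Let primitive (B x : R) : R := (\int[leb]_(t in `[- B, x]) axis_cost t)%R.

Let primitive_derive (B x : R) : - B < x -> is_derive x 1 (primitive B) (axis_cost x).
Proof.
move=> Bx; have int : leb.-integrable `[- B, x + 1] (EFin \o axis_cost).
  apply: continuous_compact_integrable; first exact: segment_compact.
  exact/continuous_subspaceT/axis_cost_continuous.
have [|dF F'] := continuous_FTC1_closed _ int Bx (@axis_cost_continuous x).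
  by rewrite ltrDl.
apply: DeriveDef; first exact: dF.
rewrite -derive1E; exact: F'.
Qed.

Let primitive_lip (B Q M a b : R) : Q < B -> - Q <= a -> a <= b -> b <= Q ->
  (forall x, - Q <= x <= Q -> `|axis_cost x| <= M) ->
  `|primitive B b - primitive B a| <= M * (b - a).
Proof.
move=> QB Qa ab bQ hM.
have dP (x : R) : - Q <= x -> is_derive x 1 (primitive B) (axis_cost x).
  by move=> Qx; apply: primitive_derive; apply: lt_le_trans Qx; rewrite ltrN2.
have [||x xab ->] := @MVT_segment R (primitive B) axis_cost a b ab.
- move=> x; rewrite in_itv/= => /andP[ax _].
  by apply: dP; exact: le_trans Qa (ltW ax).
- apply: derivable_within_continuous => x; rewrite in_itv/= => /andP[ax _].
  by have [] := dP x (le_trans Qa ax).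
rewrite normrM (ger0_norm (_ : 0 <= b - a)) ?subr_ge0// ler_wpM2r ?subr_ge0//.
by apply: hM; move: xab; rewrite in_itv/= => /andP[ax xb]; rewrite (le_trans Qa ax) (le_trans xb).
Qed.

(** The calibrating function is a primitive of the cost along the axis, evaluated at the position of
    the path. Its derivative is at most cost times speed, and its increment depends on the endpoints
    only, so paths that go back and forth need no separate treatment. *)
Lemma axis_path_lb gamma : admissible_path F (pl 0 (- s)) (pl 0 s) gamma ->
  (forall t, 0 <= t <= 1 -> enorm (gamma t - c) < rho / 2) ->
  ((2 * s * rho)%:E * \int[leb]_(t in `[0%R, 1%R]) (axis_cost t)%:E <=
   \int[leb]_(t in `[0%R, 1%R]) G gamma t)%E.
Proof.
move=> adm near; have onaxis := near_path_on_axis adm near.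
have [rg g0 g1 _] := adm.
have [N nN dN] := rectifiable_derivable rg; have [k gk] := rg.
have [s0 s18] := andP s8.
have rho2 : rho ^+ 2 != 0 by rewrite expf_eq0/= gt_eqF.
pose K := (2 * s * rho ^+ 2)^-1.
have K0 : 0 < K by rewrite invr_gt0 !mulr_gt0// exprn_gt0.
(* The position on the axis in the affine coordinate that is 0 at the start and 1 at the end. *)
pose q t := K * dot (gamma t - c) e2 + 2^-1.
have gq t : 0 <= t <= 1 -> gamma t = pl 0 (s * (2 * q t - 1)).
  move=> t01; rewrite {1}onaxis//; congr (pl 0 _); rewrite /q /K; field.
  by rewrite !gt_eqF.
have dotpl v : dot (pl 0 v - c) e2 = v * rho ^+ 2.
  by rewrite pl0 addrAC subrr add0r dotZl e22.
have q0 : q 0 = 0.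
  by rewrite /q g0 dotpl /K; field; rewrite !gt_eqF.
have q1 : q 1 = 1.
  by rewrite /q g1 dotpl /K; field; rewrite !gt_eqF.
(* The path stays within [rho / 2] of [c], hence its coordinate in [[- Q, Q]]; there the primitive
   is Lipschitz. *)
pose Q := K * (rho ^+ 2 / 2) + 1.
have Q1 : 1 <= Q by rewrite lerDr mulr_ge0 ?(ltW K0)// divr_ge0// sqr_ge0.
have qQ t : 0 <= t <= 1 -> - Q <= q t <= Q.
  move=> t01; have : `|dot (gamma t - c) e2| <= rho ^+ 2 / 2.
    have h : enorm (gamma t - c) * enorm e2 <= rho ^+ 2 / 2.
      rewrite e2n expr2 mulrAC; apply: ler_wpM2r; first exact: ltW.
      exact: ltW (near t t01).
    rewrite ler_norml (le_trans (dot_le _ _) h) andbT lerNl -dotNl.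
    by apply: le_trans (dot_le _ _) _; rewrite enormN.
  rewrite ler_norml => /andP[h1 h2]; rewrite /q /Q.
  have := ler_wpM2l (ltW K0) h1; have := ler_wpM2l (ltW K0) h2; rewrite mulrN.
  by move=> ? ?; apply/andP; split; lra.
have [M hM] : exists M, forall x, - Q <= x <= Q -> `|axis_cost x| <= M.
  have [|||x _ hx] := @compact_EVT_max _ R axis_cost `[- Q, Q]%classic.
  - by exists 0; rewrite /= in_itv/=; apply/andP; split; lra.
  - exact: segment_compact.
  - exact/continuous_subspaceT/axis_cost_continuous.
  exists (axis_cost x) => y yQ; rewrite ger0_norm; last exact: cost0.
  by apply: hx; rewrite inE /= in_itv.
pose P := primitive (Q + 1).
pose h t := 2 * s * rho * P (q t).
have M0 : 0 <= M.
  by apply: le_trans (hM 0 _); rewrite ?normr_ge0//; apply/andP; split; lra.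
have QB : Q < Q + 1 by rewrite ltrDl.
have PM x y : - Q <= x <= Q -> - Q <= y <= Q -> `|P x - P y| <= M * `|x - y|.
  move=> /andP[xa xb] /andP[ya yb]; have [xy|/ltW yx] := leP x y.
    rewrite distrC (distrC x) (ger0_norm (_ : 0 <= y - x)) ?subr_ge0//.
    exact: (primitive_lip QB xa xy yb hM).
  rewrite (ger0_norm (_ : 0 <= x - y)) ?subr_ge0//.
  exact: (primitive_lip QB ya yx xb hM).
have c2 : 0 <= 2 * s * rho by rewrite !mulr_ge0// ltW.
have hlip x y : x \in `[0, 1] -> y \in `[0, 1] ->
    `|h x - h y| <= (2 * s * rho) * (M * (K * (k * enorm e2))) * `|x - y|.
  move=> x01 y01; rewrite /h -mulrBr normrM (ger0_norm c2) -!mulrA.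
  do 3!(apply: ler_wpM2l; first by rewrite // ltW).
  move: (x01) (y01); rewrite !in_itv/= => x01' y01'.
  apply: le_trans (PM _ _ (qQ x x01') (qQ y y01')) _; apply: ler_wpM2l => //.
  have -> : q x - q y = K * (dot (gamma x - c) e2 - dot (gamma y - c) e2).
    by rewrite /q; ring.
  rewrite normrM (gtr0_norm K0); apply: ler_wpM2l; first exact: ltW.
  by rewrite mulrA; exact: dot_lipschitz.
have dP01 (x : R) : 0 <= x -> is_derive x 1 P (axis_cost x).
  by move=> x0; apply: primitive_derive; lra.
have cP01 (x : R) : 0 <= x -> {for x, continuous P}.
  by move=> x0; apply/differentiable_continuous/derivable1_diffP; have [] := dP01 x x0.
have := lipschitz_increment_le hlip (lexx 0) ler01 (lexx 1) (G0 gamma) nN.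
have -> : ((h 1 - h 0)%:E = (2 * s * rho)%:E * \int[leb]_(t in `[0%R, 1%R]) (axis_cost t)%:E)%E.
  rewrite (@continuous_FTC2 _ axis_cost P); last 4 first.
  - exact: ltr01.
  - exact/continuous_subspaceT/axis_cost_continuous.
  - split => [x||]; rewrite ?in_itv/=.
    + by move=> /andP[x0 _]; have [] := dP01 x (ltW x0).
    + by apply: cvg_at_right_filter; exact: cP01.
    + by apply: cvg_at_left_filter; exact: cP01.
  - by move=> x; rewrite in_itv/= => /andP[x0 _]; have [_ <-] := dP01 x (ltW x0); rewrite derive1E.
  by rewrite /h q0 q1 -EFinB -EFinM mulrBr.
apply => v /andP[v0 v1] nNv _.
have v01 : 0 < v < 1 by rewrite v0.
have v01' : 0 <= v <= 1 by rewrite !ltW.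
have dg := dN v v01 nNv.
have dq : is_derive v 1 q (K * dot (derive1 gamma v) e2).
  rewrite -[X in is_derive _ _ _ X]addr0; apply: is_deriveD.
  by apply: is_deriveZ; exact: is_derive_dot.
have dP : is_derive (q v) 1 P (axis_cost (q v)).
  apply: primitive_derive; have /andP[h1 _] := qQ v v01'.
  by apply: lt_le_trans h1; rewrite ltrN2.
have [_ dh] : is_derive v 1 h (2 * s * rho * (axis_cost (q v) * (K * dot (derive1 gamma v) e2))).
  by apply: is_deriveZ; exact: is_derive1_comp.
rewrite derive1E dh /G (gq v v01') costE -/(axis_cost (q v)) -EFinM lee_fin.
have -> : 2 * s * rho * (axis_cost (q v) * (K * dot (derive1 gamma v) e2)) =
   axis_cost (q v) * (dot (derive1 gamma v) e2 / rho).
  by rewrite /K; field; rewrite !gt_eqF.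
apply: ler_wpM2l; first exact: cost0.
by rewrite ler_pdivrMr// -e2n dot_le.
Qed.

Lemma path_lb gamma : admissible_path F (pl 0 (- s)) (pl 0 s) gamma ->
  ((2 * s * rho)%:E * \int[leb]_(t in `[0%R, 1%R]) (axis_cost t)%:E <=
    (fmin * (rho * (3 / 8)))%:E)%E ->
  ((2 * s * rho)%:E * \int[leb]_(t in `[0%R, 1%R]) (axis_cost t)%:E <=
   \int[leb]_(t in `[0%R, 1%R]) G gamma t)%E.
Proof.
move=> adm h; have [near|] := pselect (forall t, 0 <= t <= 1 -> enorm (gamma t - c) < rho / 2).
  exact: axis_path_lb.
move=> /existsNP[tau /not_implyP[tau01 /negP]]; rewrite -leNgt => far.
exact: le_trans h (far_path_lb adm tau01 far).
Qed.

End path_lower_bound.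

(** * The path through the tip *)

Section affine_path.
Context (R : realType) (d : nat).

Lemma near_affine_is_derive (g : R -> 'rV[R]_d) (A w : 'rV[R]_d) (v : R) :
  (\forall t \near v, g t = A + t *: w) -> derivable g v 1 /\ derive1 g v = w.
Proof.
move=> gE.
have dc j : is_derive v 1 (fun t : R => g t ord0 j) (w ord0 j).
  have : is_derive v 1 (fun t : R => A ord0 j + t * w ord0 j) (w ord0 j).
    rewrite -[X in is_derive _ _ _ X]add0r; apply: is_deriveD.
    under eq_fun do rewrite mulrC.
    rewrite -[X in is_derive _ _ _ X]mulr1; exact: is_deriveZ.
  apply: near_eq_is_derive; near=> t.
  have -> : g t = A + t *: w by near: t.
  by rewrite !mxE.
have dg : derivable g v 1.
  by apply/derivable_mxP => i j; rewrite (ord1 i); have [] := dc j.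
split => //; rewrite derive1E derive_mx//; apply/rowP => j; rewrite mxE.
by have [_ ->] := dc j.
Unshelve. all: by end_near. Qed.

End affine_path.

Section tent_path.
Context (R : realType) (d : nat) (c e1 e2 : 'rV[R]_d) (rho : R).
Hypotheses (rho0 : 0 < rho) (e12 : dot e1 e2 = 0)
  (e11 : dot e1 e1 = rho ^+ 2) (e22 : dot e2 e2 = rho ^+ 2).
Variables (eps s : R).
Hypotheses (eps08 : 0 <= eps <= 8^-1) (s8 : 0 < s <= 8^-1).
Local Notation pl := (pl c e1 e2).

Definition tent (t : R) : R := Num.min (2 * t) (2 - 2 * t).

Definition tent_path (t : R) : 'rV[R]_d := pl (eps * tent t) (s * (2 * t - 1)).

Lemma tent_lip x y : `|tent x - tent y| <= 2 * `|x - y|.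
Proof.
rewrite -(@ger0_norm _ 2)// -normrM ler_norml.
have [h1 h2] := (ler_norm (2 * (x - y)), ler_norm (- (2 * (x - y)))).
rewrite normrN in h2.
rewrite /tent; apply/andP; split; rewrite /Order.min; do 2 case: ltP => ?; lra.
Qed.

Lemma tent_left t : t <= 2^-1 -> tent t = 2 * t.
Proof. by move=> h; rewrite /tent min_l//; lra. Qed.

Lemma tent_right t : 2^-1 <= t -> tent t = 2 - 2 * t.
Proof. by move=> h; rewrite /tent min_r//; lra. Qed.

Lemma tent_path_derive t : t != 2^-1 ->
  exists e : R, [/\ e ^+ 2 = eps ^+ 2, derivable tent_path t 1 &
   derive1 tent_path t = (2 * e) *: e1 + (2 * s) *: e2].
Proof.
rewrite neq_lt => /orP[t2|t2].
  have /near_affine_is_derive[dp dE] : \forall u \near t, tent_path u =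
      (c - s *: e2) + u *: ((2 * eps) *: e1 + (2 * s) *: e2).
    near=> u; have u2 : u < 2^-1 by near: u; exact: lt_nbhsl.
    rewrite /tent_path (tent_left (ltW u2)) /pl; apply/rowP => i; rewrite !mxE; ring.
  by exists eps.
have /near_affine_is_derive[dp dE] : \forall u \near t, tent_path u =
    (c + (2 * eps) *: e1 - s *: e2) + u *: ((2 * - eps) *: e1 + (2 * s) *: e2).
  near=> u; have u2 : 2^-1 < u by near: u; exact: lt_nbhsr.
  rewrite /tent_path (tent_right (ltW u2)) /pl; apply/rowP => i; rewrite !mxE; ring.
by exists (- eps); split => //; exact: sqrrN.
Unshelve. all: by end_near. Qed.

Definition tent_speed : R := 2 * rho * Num.sqrt (eps ^+ 2 + s ^+ 2).

Lemma enorm_tent_dir e : e ^+ 2 = eps ^+ 2 ->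
  enorm ((2 * e) *: e1 + (2 * s) *: e2) = tent_speed.
Proof.
move=> ee; rewrite enormE dotDl !dotDr !dotZl !dotZr (dotC e2 e1) e12 e11 e22.
have -> : 2 * e * (2 * e * rho ^+ 2) + 2 * e * (2 * s * 0) +
  (2 * s * (2 * e * 0) + 2 * s * (2 * s * rho ^+ 2)) =
  (2 * rho) ^+ 2 * (e ^+ 2 + s ^+ 2) by ring.
by rewrite sqrtrM ?sqr_ge0// sqrtr_sqr ee ger0_norm// mulr_ge0// ltW.
Qed.

Lemma tent_speed_gt0 : 0 < tent_speed.
Proof.
have [s0 _] := andP s8.
by rewrite !mulr_gt0// sqrtr_gt0 ltr_wpDl ?sqr_ge0// exprn_gt0.
Qed.

(** From [sqrt (1 + t) <= 1 + t]. The excess length is quadratic in [eps], which lets a gain linear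
    in [eps] win. *)
Lemma tent_speed_le : tent_speed <= 2 * s * rho * (1 + eps ^+ 2 / s ^+ 2).
Proof.
have [s0 _] := andP s8.
have -> : 2 * s * rho * (1 + eps ^+ 2 / s ^+ 2) =
  2 * rho * (s * (1 + eps ^+ 2 / s ^+ 2)) by ring.
have q0 : 0 <= eps ^+ 2 / s ^+ 2 by rewrite divr_ge0 ?sqr_ge0.
rewrite ler_pM2l ?mulr_gt0//.
rewrite -(@ler_pXn2r _ 2)// ?nnegrE ?sqrtr_ge0//; last by rewrite mulr_ge0 ?(ltW s0)// addr_ge0.
rewrite sqr_sqrtr ?addr_ge0 ?sqr_ge0// exprMn.
have -> : eps ^+ 2 + s ^+ 2 = s ^+ 2 * (1 + eps ^+ 2 / s ^+ 2).
  by field; rewrite gt_eqF.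
rewrite ler_pM2l ?exprn_gt0//.
move: q0; move: (eps ^+ 2 / s ^+ 2) => q q0; have := mulr_ge0 q0 q0; nra.
Qed.

(** The direction changes at the tip alone, and the tip is in [F]: an open interval on which the
    path avoids [F] lies in one half of the path. *)
Lemma tent_path_admissible (F : set 'rV[R]_d) : F (pl eps 0) ->
  admissible_path F (pl 0 (- s)) (pl 0 s) tent_path.
Proof.
move=> Ftip; have [s0 s1] := andP s8; have [ep0 ep1] := andP eps08.
split.
- exists (rho * 2) => x y _ _; rewrite -mulrA; apply: (enorm_pl_le c rho0 e12 e11 e22).
    by rewrite mulr_ge0.
  have h1 : (tent x - tent y) ^+ 2 <= (2 * `|x - y|) ^+ 2.
    by rewrite -[leLHS]real_normK ?num_real// ler_pXn2r ?nnegrE ?mulr_ge0// tent_lip.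
  have -> : (eps * tent x - eps * tent y) ^+ 2 + (s * (2 * x - 1) - s * (2 * y - 1)) ^+ 2 =
    eps ^+ 2 * (tent x - tent y) ^+ 2 + s ^+ 2 * (4 * (x - y) ^+ 2) by ring.
  rewrite -(@real_normK _ (x - y)) ?num_real//.
  have e4 : (2 * `|x - y|) ^+ 2 = 4 * `|x - y| ^+ 2 by ring.
  rewrite e4 in h1 *.
  have w0 : 0 <= 4 * `|x - y| ^+ 2 by rewrite mulr_ge0// sqr_ge0.
  have he : eps ^+ 2 <= 2^-1 by nra.
  have hs : s ^+ 2 <= 2^-1 by nra.
  have he0 : 0 <= eps ^+ 2 by exact: sqr_ge0.
  move: (4 * _) ((tent x - tent y) ^+ 2) (eps ^+ 2) (s ^+ 2) h1 w0 he hs he0 => W T E S *.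
  have a1 : E * T <= E * W by apply: ler_wpM2l.
  nra.
- by rewrite /tent_path tent_left ?mulr0 ?invr_ge0// sub0r mulrN1.
- rewrite /tent_path tent_right; last by rewrite invf_le1// ler1n.
  by congr (pl _ _); ring.
move=> a b a0 ab b1 off.
have hv (v : R) : v \in `]a, b[ -> v != 2^-1.
  apply: contraTneq => ->; apply/negP => h2.
  apply: (off (tent_path 2^-1)); first by exists 2^-1.
  rewrite /tent_path tent_left// mulfV ?pnatr_eq0// subrr !mulr0.
  by rewrite mulr1.
have sp0 := tent_speed_gt0.
have unit e : e ^+ 2 = eps ^+ 2 ->
    enorm (tent_speed^-1 *: ((2 * e) *: e1 + (2 * s) *: e2)) = 1.
  by move=> ee; rewrite enormZ enorm_tent_dir// gtr0_norm ?invr_gt0// mulVf ?gt_eqF.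
have half : b <= 2^-1 \/ 2^-1 <= a.
  have [b2|b2] := leP b 2^-1; first by left.
  right; rewrite leNgt; apply/negP => a2.
  have := hv 2^-1; rewrite in_itv/= a2 b2 => /(_ isT).
  by rewrite eqxx.
have main (e : R) (A : 'rV[R]_d) : e ^+ 2 = eps ^+ 2 ->
   (forall t, a < t < b -> tent_path t = A + t *: ((2 * e) *: e1 + (2 * s) *: e2)) ->
   exists2 u : 'rV[R]_d, enorm u = 1 & forall v : R, v \in `]a, b[ ->
     derivable tent_path v 1 ->
     derive1 tent_path v = enorm (derive1 tent_path v) *: u.
  move=> ee tE; exists (tent_speed^-1 *: ((2 * e) *: e1 + (2 * s) *: e2)); first exact: unit.
  move=> v; rewrite in_itv/= => /andP[av vb] _.
  have /near_affine_is_derive[_ ->] : \forall t \near v,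
      tent_path t = A + t *: ((2 * e) *: e1 + (2 * s) *: e2).
    near=> t; apply: tE; apply/andP; split; near: t; [exact: lt_nbhsr|exact: lt_nbhsl].
  by rewrite enorm_tent_dir// scalerA mulfV ?gt_eqF// scale1r.
case: half => h.
  apply: (main eps (c - s *: e2)) => // t /andP[_ tb].
  rewrite /tent_path tent_left /pl; last by apply: ltW; apply: lt_le_trans tb h.
  by apply/rowP => i; rewrite !mxE; ring.
apply: (main (- eps) (c + (2 * eps) *: e1 - s *: e2)); first exact: sqrrN.
move=> t /andP[ta _].
rewrite /tent_path tent_right /pl; last by apply: ltW; apply: le_lt_trans h ta.
by apply/rowP => i; rewrite !mxE; ring.
Unshelve. all: by end_near. Qed.

End tent_path.

(** * The Fermat distances under the two measures *)

Section arm_paths.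
Context (R : realType) (d : nat) (c e1 e2 : 'rV[R]_d) (rho : R).
Hypotheses (rho0 : 0 < rho) (e12 : dot e1 e2 = 0)
  (e11 : dot e1 e1 = rho ^+ 2) (e22 : dot e2 e2 = rho ^+ 2).
Variables (N eps m p beta s : R).
Hypotheses (m0 : 0 < m) (m1 : m <= 1) (p1 : 1 <= p) (beta1 : 1 <= beta)
  (eps08 : 0 <= eps <= 8^-1).
Hypothesis NE : N = 192 * p * 5 `^ (p - 1) / m.
Variables (eta1 eta2 : R) (mu0 mu1 : probability (borelRd R d) R).
Hypotheses (eta10 : 0 <= eta1) (eta20 : 0 <= eta2) (etaN : eta1 + eta2 <= N^-1).
Hypothesis mix0 : mixture (arms c e1 e2 N eps) mu0 (arm_weight N 0 0).
Hypothesis mix1 : mixture (arms c e1 e2 N eps) mu1 (arm_weight N eta1 eta2).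
Hypothesis eta2_eps : eta2 = 0 -> eps = 0.
Local Notation leb := (@lebesgue_measure R).
Local Notation pl := (pl c e1 e2).
Local Notation j := (arm_energy c e1 e2 m p mu0).
Local Notation cost := (arm_cost c e1 e2 m p mu0 beta).

Let N192 : 192 <= N := N_ge192 m0 m1 p1 NE.
Let N0 : 0 < N. Proof. have := N192; lra. Qed.
Let p0 : 0 < p. Proof. by apply: lt_le_trans p1. Qed.
Let b0 : 0 < beta. Proof. by apply: lt_le_trans beta1. Qed.
Let jE v : energy m p mu0 (pl 0 v) = (j v)%:E :=
  arm_energyE rho0 e12 e11 e22 m0 m1 p1 NE mix0 v.

Let j_lip v v' : j v' <= j v + p * (rho * `|v - v'|) *
  (rho * (N + 2 + `|v|) + rho * `|v - v'|) `^ (p - 1) * m.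
Proof.
have h0 : 0 <= rho * `|v - v'| by rewrite mulr_ge0// ltW.
have dlt u : (delta mu0 u (pl 0 v') <= delta mu0 u (pl 0 v) + (rho * `|v - v'|)%:E)%E.
  have : (delta mu0 u (pl 0 v') + (- (rho * `|v - v'|))%:E <= delta mu0 u (pl 0 v))%E.
    apply: delta_shift => r r0; rewrite opprK => ur; split; first by rewrite ltr_wpDr.
    apply: lt_le_trans ur _; apply: le_measure; rewrite ?inE; try exact: measurable_eball.
    move=> w; rewrite /eball/= => wv.
    apply: le_lt_trans (enorm_triangle _ (pl 0 v) _) _; rewrite ltr_leD//.
    apply: (enorm_pl_le c rho0 e12 e11 e22) => //.
    by rewrite subr0 expr0n/= add0r -[leRHS]/(`|v - v'| ^+ 2) real_normK ?num_real.
  by rewrite EFinN leeBlDr.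
have hi u : 0 <= u < m -> (delta mu0 u (pl 0 v) <= (rho * (N + 2 + `|v|))%:E)%E.
  move=> /andP[u0 um]; apply: (delta_arm_ub rho0 e12 e11 e22 m0 m1 p1 NE mix0).
  by rewrite u0 (lt_le_trans um).
have vac (P : R -> Prop) u : m <= u < m -> P u.
  by move=> /andP[mu um]; have := le_lt_trans mu um; rewrite ltxx.
(* With [u1 = u2 = m] the two upper bands are empty, and only the bound on the growth remains. *)
have := energy_compare p1 (ltW m0) (lexx m) (lexx m) (lexx 0) h0 (lexx 0) hi
  (fun u _ => dlt u) (vac _) (vac _) (vac _).
rewrite (jE v) (jE v') subrr mulr0; move: (j v) (j v') => x y.
by rewrite -!EFinD lee_fin addr0.
Qed.

Let j_continuous : continuous j.
Proof.
move=> v; apply/cvgrPdist_le => e e0.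
pose C := p * rho * (rho * (N + 2 + (`|v| + 1)) + rho) `^ (p - 1) * m.
have C0 : 0 <= C by rewrite /C !mulr_ge0 ?powR_ge0// ltW.
have NN : 0 <= N by exact: ltW.
have step a b : `|a| <= `|v| + 1 -> `|a - b| <= 1 -> j b <= j a + C * `|a - b|.
  move=> av ab; apply: le_trans (j_lip a b) _; rewrite lerD2l.
  have -> : C * `|a - b| = p * (rho * `|a - b|) *
      (rho * (N + 2 + (`|v| + 1)) + rho) `^ (p - 1) * m by rewrite /C; ring.
  apply: ler_wpM2r; first exact: ltW.
  apply: ler_wpM2l; first by rewrite !mulr_ge0// ltW.
  have q0 : 0 <= p - 1 by rewrite subr_ge0.
  have r1 : 0 <= rho by exact: ltW.
  apply: (ge0_ler_powR q0); rewrite ?nnegrE.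
  - by rewrite addr_ge0// mulr_ge0// !addr_ge0.
  - by rewrite addr_ge0// mulr_ge0// !addr_ge0.
  by apply: lerD; [rewrite ler_pM2l// lerD2l|rewrite -[leRHS]mulr1 ler_pM2l].
near=> w.
have vw1 : `|v - w| <= 1.
  by near: w; apply: cvgr_dist_le; [exact: cvg_id|exact: ltr01].
have vwe : `|v - w| <= e / (C + 1).
  near: w; apply: cvgr_dist_le; first exact: cvg_id.
  by rewrite divr_gt0// ltr_wpDl.
have Ce : C * `|v - w| <= e.
  apply: (@le_trans _ _ ((C + 1) * `|v - w|)); first by rewrite ler_wpM2r// lerDl.
  by rewrite mulrC -ler_pdivlMr// ltr_wpDl.
have s1 : j w <= j v + C * `|v - w| by apply: step => //; rewrite lerDl.
have s2 : j v <= j w + C * `|w - v|.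
  apply: step; last by rewrite distrC.
  by rewrite -[w](subrK v) addrC (le_trans (ler_normD _ _))// lerD2l distrC.
rewrite (distrC w v) in s2.
rewrite ler_norml; move: s1 s2 Ce; move: (j v) (j w) (C * `|v - w|) => x y z s1 s2 Ce.
by apply/andP; split; lra.
Unshelve. all: by end_near. Qed.

Let j_lb v : rho `^ p * (m / 2) <= j v :=
  arm_energy_lb rho0 e12 e11 e22 m0 m1 p1 NE mix0 v.

Let j0 v : 0 < j v.
Proof. by apply: lt_le_trans (j_lb v); rewrite mulr_gt0 ?powR_gt0// divr_gt0. Qed.

Lemma arm_cost_continuous : continuous cost.
Proof.
move=> v; rewrite (_ : cost = (fun x => x `^ (p^-1 * beta)) \o (fun v => m^-1 * j v)); last first.
  by apply/funext => w /=; rewrite powRrM.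
apply: continuous_comp.
  by apply: (@continuousM _ _ (cst m^-1)); [exact: cst_continuous|exact: j_continuous].
apply/differentiable_continuous/derivable1_diffP.
have mj0 : 0 < m^-1 * j v by rewrite mulr_gt0 ?invr_gt0.
by have [] := is_derive1_powR (p^-1 * beta) mj0.
Qed.

(** [fm] bounds d_mu to the power [beta] from below on the whole space, under both measures; [fM]
    bounds it from above on the axis near the origin, under [mu0]. *)
Let fm := (rho / 2) `^ beta.
Let fM := (rho * (N + 3)) `^ beta.

Let dtm_lb mu (eta1' eta2' : R) w : mixture (arms c e1 e2 N eps) mu (arm_weight N eta1' eta2') ->
  0 <= eta1' -> 0 <= eta2' -> eta1' + eta2' <= N^-1 ->
  (fm%:E <= dtm m p mu w `^ beta)%E.
Proof.
move=> mix e10 e20 eN.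
have h := dtm_arm_lb rho0 e12 e11 e22 m0 m1 p1 NE w mix e10 e20 eN.
have r2 : 0 <= rho / 2 by rewrite divr_ge0// ltW.
rewrite /fm -poweR_EFin; apply: (gt0_ler_poweR (ltW b0)) => //.
  by rewrite in_itv/= leey lee_fin r2.
by rewrite in_itv/= leey andbT (le_trans _ h)// lee_fin.
Qed.

Let NV0 : 0 + 0 <= N^-1. Proof. by rewrite addr0 invr_ge0 ltW. Qed.

Let costE v : (dtm m p mu0 (pl 0 v) `^ beta = (cost v)%:E)%E :=
  arm_costE rho0 e12 e11 e22 m0 m1 p1 NE mix0 beta v.

Lemma arm_cost_lb v : fm <= cost v.
Proof. by rewrite -lee_fin -costE; exact: (dtm_lb _ mix0). Qed.

Lemma arm_cost_ub v : - 1 <= v <= 1 -> cost v <= fM.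
Proof.
move=> v1; rewrite /fM /arm_cost.
have NN : 0 <= N by exact: ltW.
have rN : 0 <= rho * (N + 3) by rewrite mulr_ge0 ?addr_ge0// ltW.
apply: (ge0_ler_powR (ltW b0)); rewrite ?nnegrE ?powR_ge0//.
have -> : rho * (N + 3) = ((rho * (N + 3)) `^ p) `^ p^-1.
  by rewrite -powRrM divff ?gt_eqF// powRr1.
have ip0 : 0 <= p^-1 by rewrite invr_ge0 ltW.
apply: (ge0_ler_powR ip0); rewrite ?nnegrE ?powR_ge0//.
  by rewrite mulr_ge0 ?invr_ge0 ?(ltW m0)// ltW.
rewrite mulrC ler_pdivrMr// mulrC.
apply: le_trans (arm_energy_ub rho0 e12 e11 e22 m0 m1 p1 NE mix0 v) _.
rewrite ler_pM2l//; apply: (ge0_ler_powR (ltW p0)); rewrite ?nnegrE//.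
  by rewrite mulr_ge0 ?(ltW rho0)// !addr_ge0.
rewrite ler_pM2l// -addrA lerD2l; have : `|v| <= 1 by rewrite ler_norml.
lra.
Qed.

Hypothesis s_def : s = (2 * (N + 3)) `^ (- beta) / 8.

Let N3 : 1 <= 2 * (N + 3). Proof. have := N192; lra. Qed.

(** This is what [s] is chosen for: the segment costs at most [2 s rho fM = rho fm / 4], less than
    the [3 rho fm / 8] that any path leaving the ball of radius [rho / 2] must pay. *)
Lemma arm_scale : fm = 8 * s * fM.
Proof.
have NN : 0 <= N + 3 by have := N192; lra.
have N30 : 0 < 2 * (N + 3) by apply: lt_le_trans N3.
have r2 : 0 <= rho / 2 by rewrite divr_ge0// ltW.
have -> : fM = (2 * (N + 3)) `^ beta * fm.
  rewrite /fM /fm -powRM//; last exact: ltW.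
  by congr (_ `^ _); field.
rewrite s_def powRN; field.
by rewrite gt_eqF// powR_gt0.
Qed.

Lemma arm_scale_bounds : 0 < s <= 8^-1.
Proof.
have N30 : 0 < 2 * (N + 3) by apply: lt_le_trans N3.
rewrite s_def divr_gt0 ?powR_gt0//= -[leRHS]mul1r ler_pM2r ?invr_gt0//.
rewrite powRN invf_le1 ?powR_gt0// -[leLHS](powRr0 (2 * (N + 3))).
by apply: ler_powR => //; exact: ltW.
Qed.

Let s8 := arm_scale_bounds.

Let s0 : 0 < s. Proof. by case/andP: s8. Qed.

Let fm0 : 0 < fm. Proof. by rewrite powR_gt0// divr_gt0. Qed.

Local Notation phi := (axis_cost cost s).

Let sv t : 0 <= t <= 1 -> - 8^-1 <= s * (2 * t - 1) <= 8^-1.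
Proof.
move=> /andP[t0 t1]; have [h1 h2] := andP s8.
have a1 : s * (2 * t - 1) <= s * 1 by apply: ler_wpM2l; lra.
have a2 : s * (- 1) <= s * (2 * t - 1) by apply: ler_wpM2l; lra.
by apply/andP; split; lra.
Qed.

Let phi_continuous : continuous phi.
Proof.
have -> : phi = cost \o (fun t => s * (2 * t - 1)) by [].
move=> t; apply: continuous_comp; last exact: arm_cost_continuous.
apply: (@continuousM _ _ (cst s)); first exact: cst_continuous.
apply: (@continuousB _ _ _ (fun t : R => 2 * t) (cst 1)); last exact: cst_continuous.
by apply: (@continuousM _ _ (cst 2)); [exact: cst_continuous|exact: cvg_id].
Qed.

Let phi_lb t : fm <= phi t. Proof. exact: arm_cost_lb. Qed.

Let phi_ub t : 0 <= t <= 1 -> phi t <= fM.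
Proof.
move=> /sv /andP[h1 h2]; apply: arm_cost_ub; apply/andP; split; lra.
Qed.

Let mphi (D : set R) : measurable_fun D (EFin \o phi).
Proof.
apply/measurable_EFinP; apply: measurable_funTS.
exact: continuous_measurable_fun.
Qed.

Definition axis_integral : R := fine (\int[leb]_(t in `[0%R, 1%R]) (phi t)%:E).

Let int01 (k : R) : (\int[leb]_(t in `[0%R, 1%R]) k%:E = k%:E)%E.
Proof.
rewrite integral_cst//= -[RHS]mule1; congr (_ * _)%E.
transitivity (leb `[0%R, 1%R]%classic); first by [].
by rewrite lebesgue_measure_itv/= lte_fin ltr01 -EFinB subr0.
Qed.

Let phi_int_ub : (\int[leb]_(t in `[0%R, 1%R]) (phi t)%:E <= fM%:E)%E.
Proof.
rewrite -int01; apply: ge0_le_integral_nomeas.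
  by move=> t _; rewrite lee_fin; apply: le_trans (phi_lb t); exact: ltW.
by move=> t /=; rewrite in_itv/= => t01; rewrite lee_fin phi_ub.
Qed.

Let axis_integralE :
  (\int[leb]_(t in `[0%R, 1%R]) (phi t)%:E = axis_integral%:E)%E.
Proof.
rewrite /axis_integral fineK// ge0_fin_numE.
  by apply: le_lt_trans phi_int_ub _; rewrite ltry.
by apply: integral_ge0 => t _; rewrite lee_fin (le_trans _ (phi_lb t))// ltW.
Qed.

Let axis_integral_ub : axis_integral <= fM.
Proof. by rewrite -lee_fin -axis_integralE. Qed.

(** The third arm has weight zero in [mu0], so its length may be set to 0. The results on the
    support, which want [eps = 0] when [eta2 = 0], then apply to [mu0]. *)
Lemma mixture_arms_eps0 : mixture (arms c e1 e2 N 0) mu0 (arm_weight N 0 0).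
Proof.
have [a0 a1 aE] := mix0; split => // A mA; rewrite aE//.
apply: eq_bigr => k _; rewrite /arms /arm_weight.
by case: (val k) => [|[|n]]; [reflexivity|reflexivity|exact: etrans (mul0e _) (esym (mul0e _))].
Qed.

Let supp0_near w : supp mu0 w -> enorm (w - c) < rho / 2 -> exists v, w = pl 0 v.
Proof.
have e0 : 0 <= (0 : R) <= 8^-1 by rewrite lexx invr_ge0 ler0n.
have eta0 : (0 : R) = 0 -> (0 : R) = 0 by [].
rewrite (supp_arms rho0 e12 e11 e22 N192 e0 (lexx 0) (lexx 0) NV0 mixture_arms_eps0 eta0).
move=> [[|]|] [t]; rewrite /= in_itv/= => /andP[t0 t1] <-; rewrite seg_point_pl.
- by move=> _; rewrite !subr0 mulr0 addr0; eexists.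
- have cE : pl 0 0 = c by rewrite /pl !scale0r !addr0.
  have i20 : 0 <= (2^-1 : R) by rewrite invr_ge0.
  have := enorm_pl_ltE c rho0 e12 e11 e22 (0 + t * (N - 0)) (1 + t * (1 - 1)) 0 0 i20.
  rewrite cE => ->; rewrite subrr mulr0 addr0 !subr0 expr1n add0r => h.
  by have := sqr_ge0 (t * N); lra.
- by move=> _; rewrite !subr0 mulr0 addr0; eexists.
Qed.

Lemma fdtm_arm_lb :
  ((2 * s * rho * axis_integral)%:E <= fdtm m p beta mu0 (pl 0 (- s)) (pl 0 s))%E.
Proof.
rewrite EFinM -axis_integralE; apply: le_ereal_inf_tmp => _ [gamma adm <-].
apply: (@path_lb _ _ c e1 e2 rho rho0 e22 (fun w => dtm m p mu0 w `^ beta)%E fm cost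
  (supp mu0) (ltW fm0) _ costE arm_cost_continuous supp0_near s s8 gamma adm).
  by move=> w; exact: (dtm_lb _ mix0).
rewrite axis_integralE -EFinM lee_fin.
have h : axis_integral * s <= fm / 8.
  by rewrite arm_scale; have := ler_wpM2r (ltW s0) axis_integral_ub; lra.
have := ler_wpM2l (ltW rho0) h.
have : 0 <= rho * fm by rewrite mulr_ge0// ltW.
lra.
Qed.

Let r := eta1 + eps.
Let c' := (64 * p * (N + 3) `^ p)^-1.
Local Notation L := (tent_speed rho eps s).

Lemma arm_gain_bounds : 0 < c' <= 64^-1.
Proof.
have NN : 1 <= N + 3 by have := N192; lra.
have Np : 1 <= (N + 3) `^ p by rewrite -[leLHS](powRr0 (N + 3)) ler_powR// ltW.
have h : 64 <= 64 * p * (N + 3) `^ p.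
  rewrite -mulrA -[leLHS]mulr1; apply: ler_pM => //.
  by rewrite -[leLHS]mulr1; apply: ler_pM.
have h0 : 0 < 64 * p * (N + 3) `^ p by apply: lt_le_trans h.
by rewrite /c' invr_gt0 h0 lef_pV2 ?posrE.
Qed.

Let r02 : 0 <= r <= 2.
Proof.
case/andP: eps08 => ? ?; rewrite /r addr_ge0//=.
have NV1 : N^-1 <= 192^-1 by rewrite lef_pV2 ?posrE.
by have := etaN; have := eta20; lra.
Qed.

(** At each height the tent path is compared with the axis under [mu0]: the cost drops by the
    fraction [c' * (eta1 + eps * tent t)], and the cost is at least [fm]. *)
Lemma fdtm_length_tent_ub :
  (fdtm_length m p beta mu1 (tent_path c e1 e2 eps s) +
     (c' * r / 4 * fm * L)%:E <= (L * axis_integral)%:E)%E.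
Proof.
have L0 : 0 < L := tent_speed_gt0 rho0 eps s8.
have [c00 c64] := andP arm_gain_bounds; have [r0 r2] := andP r02.
have [ep0 ep8] := andP eps08.
pose k := c' * r / 2 * fm * L.
have k0 : 0 <= k by rewrite !mulr_ge0// ltW.
have kL : k <= L * fm.
  have : c' * r <= 1 by apply: (@le_trans _ _ (64^-1 * 2)); [apply: ler_pM => //; exact: ltW|lra].
  have : 0 <= L * fm by rewrite mulr_ge0// ltW.
  rewrite /k => h1 h2; have := ler_wpM2r h1 h2; lra.
(* On the middle half [tent] is at least 1/2, so [eta1 + eps * tent t >= r / 2]; elsewhere it
   suffices that the drop is nonnegative. *)
pose I := `[4^-1, 3 / 4[%classic : set R.
pose G t := (L * phi t - k * \1_I t)%:E.
have iI t : 0 <= (\1_I t : R) <= 1 by rewrite indicE; case: (_ \in _); rewrite /= ?lexx ?ler01.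
have G0 t : (0 <= G t)%E.
  rewrite lee_fin subr_ge0; apply: (@le_trans _ _ k).
    by rewrite -[leRHS]mulr1; apply: ler_wpM2l => //; case/andP: (iI t).
  by apply: le_trans kL _; rewrite ler_pM2l.
have mI : measurable_fun (`[0%R, 1%R]%classic : set (measurableTypeR R)) (fun t => k * \1_I t).
  apply: measurable_funM => //; apply: measurable_indic; rewrite /I; exact: measurable_itv.
have mLp : measurable_fun (`[0%R, 1%R]%classic : set (measurableTypeR R)) (fun t => L * phi t).
  by apply: measurable_funM => //; apply/measurable_EFinP; exact: mphi.
have mG : measurable_fun (`[0%R, 1%R]%classic : set (measurableTypeR R)) G.
  by apply/measurable_EFinP; exact: measurable_funB.
have intG : (\int[leb]_(t in `[0%R, 1%R]) G t + (c' * r / 4 * fm * L)%:E =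
    (L * axis_integral)%:E)%E.
  have -> : (c' * r / 4 * fm * L)%:E = (\int[leb]_(t in `[0%R, 1%R]) (k * \1_I t)%:E)%E.
    rewrite integral_itv_indic_sub; last 2 first.
    - lra.
    - by apply: subset_itv; rewrite bnd_simp; lra.
    by congr (_%:E); rewrite /k; field.
  rewrite -ge0_integralD//; first last.
  - exact/measurable_EFinP.
  - by move=> t _; rewrite lee_fin mulr_ge0//; case/andP: (iI t).
  under eq_integral do rewrite -EFinD subrK EFinM.
  rewrite ge0_integralZl//; last 3 first.
  - exact: mphi.
  - by move=> t _; rewrite lee_fin (le_trans _ (phi_lb t))// ltW.
  - by rewrite lee_fin ltW.
  by rewrite axis_integralE.
rewrite -intG leeD2r// /fdtm_length.
apply: (@ge0_ae_le_integral_nomeas _ _ R leb _ [set (2^-1 : R)] _ G) => //.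
- by exists [set 2^-1]; split => //; exact: lebesgue_measure_set1.
- by move=> t _; rewrite mule_ge0 ?poweR_ge0// lee_fin enorm_ge0.
move=> t /=; rewrite in_itv/= => t01 /eqP t2.
have [e [ee _ ->]] := tent_path_derive c e1 e2 eps s t2.
rewrite (enorm_tent_dir rho0 e12 e11 e22 s ee) /tent_path.
have [t0 t1] := andP t01.
have tt : 0 <= tent t <= 1.
  by have [h|h] := leP t 2^-1; [rewrite (tent_left h)|rewrite (tent_right (ltW h))];
     apply/andP; split; lra.
have et : 0 <= eps * tent t <= 8^-1.
  have [h1 h2] := andP tt; rewrite mulr_ge0//=.
  by apply: le_trans ep8; rewrite -[leRHS]mulr1; apply: ler_wpM2l.
have H := dtm_arm_compare rho0 e12 e11 e22 m0 m1 p1 eps08 NE eta10 eta20 etaN mix0 mix1 beta1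
  (sv t01) et.
apply: (le_trans (lee_wpmul2r _ H)); first by rewrite lee_fin ltW.
rewrite -EFinM lee_fin mulrC -/(phi t) -/c'.
have -> : L * phi t - k * \1_I t = L * (phi t - c' * r / 2 * fm * \1_I t).
  by rewrite /k; ring.
rewrite ler_pM2l// mulrBr mulr1 lerD2l lerN2 indicE.
have ph0 : 0 < phi t by apply: lt_le_trans (phi_lb t).
have [/set_mem|_] := boolP (t \in I); last first.
  by rewrite mulr0 mulr_ge0 ?(ltW ph0)// mulr_ge0 ?(ltW c00)// addr_ge0//; case/andP: et.
rewrite /I/= in_itv/= => /andP[t4 t34].
have tt2 : 2^-1 <= tent t.
  by have [h|h] := leP t 2^-1; [rewrite (tent_left h)|rewrite (tent_right (ltW h))]; lra.
have hr : r / 2 <= eta1 + eps * tent t.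
  have : eps * 2^-1 <= eps * tent t by apply: ler_wpM2l.
  by rewrite /r; have := eta10; lra.
have -> : c' * r / 2 * fm * 1 = fm * (c' * (r / 2)) by ring.
apply: ler_pM => //.
- exact: ltW.
- by rewrite mulr_ge0 ?(ltW c00)// divr_ge0.
by apply: ler_wpM2l => //; exact: ltW.
Qed.

Hypothesis eps_small : eps <= c' * s ^+ 3.

(** With [q = eps^2 / s^2], the tent costs at most [2 s rho (1 + q) (axis_integral - k)]. Half of
    the gain [k] absorbs the excess length, the other half is the gap. *)
Lemma fdtm_arm_gap :
  fdtm m p beta mu1 (pl 0 (- s)) (pl 0 s) \is a fin_num /\
  ((s * rho * (c' * r / 4 * fm))%:E + fdtm m p beta mu1 (pl 0 (- s)) (pl 0 s) <=
   fdtm m p beta mu0 (pl 0 (- s)) (pl 0 s))%E.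
Proof.
have L0 : 0 < L := tent_speed_gt0 rho0 eps s8.
have [c00 c64] := andP arm_gain_bounds; have [r0 r2] := andP r02; have [ep0 ep8] := andP eps08.
have tip : supp mu1 (pl eps 0).
  rewrite (supp_arms rho0 e12 e11 e22 N192 eps08 eta10 eta20 etaN mix1 eta2_eps).
  by right; exact: seg_set_r.
have ub : (fdtm m p beta mu1 (pl 0 (- s)) (pl 0 s) <=
    fdtm_length m p beta mu1 (tent_path c e1 e2 eps s))%E.
  apply: ereal_inf_lbound; eexists; last reflexivity.
  exact: (tent_path_admissible rho0 e12 e11 e22 eps08 s8 tip).
have lb : (0 <= fdtm m p beta mu1 (pl 0 (- s)) (pl 0 s))%E.
  apply: le_ereal_inf_tmp => _ [gamma _ <-]; apply: integral_ge0 => t _.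
  by rewrite mule_ge0 ?poweR_ge0// lee_fin enorm_ge0.
have main := fdtm_length_tent_ub.
move: lb ub main; case: (fdtm m p beta mu1 _ _) => [x| |] //; last first.
  by case: (fdtm_length _ _ _ _ _) => [y| |].
case: (fdtm_length _ _ _ _ _) => [y| |] //; rewrite -!EFinD !lee_fin => x0 xy yL.
split => //; apply: le_trans fdtm_arm_lb; rewrite lee_fin.
pose k := c' * r / 4 * fm; pose q := eps ^+ 2 / s ^+ 2.
have q0 : 0 <= q by rewrite divr_ge0// sqr_ge0.
have k0 : 0 <= k by rewrite mulr_ge0 ?(ltW fm0)// divr_ge0// mulr_ge0// ltW.
have AI0 : 0 <= axis_integral - k.
  rewrite -(pmulr_rge0 _ L0) mulrBr subr_ge0; apply: le_trans yL.
  by rewrite (mulrC L) -/k lerDr (le_trans x0).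
have h1 : L * (axis_integral - k) <= 2 * s * rho * (1 + q) * (axis_integral - k).
  by apply: ler_wpM2r => //; exact: tent_speed_le.
(* The origin of [eps_small]: by [arm_scale] the left side is [eps^2 fm / (8 s^3)], at most
   [c' eps fm / 8]. *)
have qk : q * fM <= k / 2.
  have -> : q * fM = eps ^+ 2 / (8 * s ^+ 3) * fm.
    by rewrite arm_scale /q; field; rewrite gt_eqF.
  have -> : k / 2 = c' * r / 8 * fm by rewrite /k; field.
  apply: ler_wpM2r; first exact: ltW.
  have s30 : 0 < s ^+ 3 by rewrite exprn_gt0.
  rewrite invfM mulrA mulrAC; apply: ler_wpM2r; first by rewrite invr_ge0.
  rewrite ler_pdivrMr// expr2 (mulrC c') -mulrA.
  by apply: ler_pM => //; rewrite /r lerDr.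
have h2 : (1 + q) * (axis_integral - k) <= axis_integral - k / 2.
  have a1 : q * (axis_integral - k) <= q * fM.
    by apply: ler_wpM2l => //; have := axis_integral_ub; lra.
  by rewrite mulrDl mul1r; lra.
have sr : 0 <= 2 * s * rho by rewrite !mulr_ge0// ltW.
have h3 := ler_wpM2l sr h2; rewrite -/k -/q in h1 h3 *.
have -> : s * rho * k = 2 * s * rho * (k / 2) by field.
have -> : 2 * s * rho * axis_integral = 2 * s * rho * (axis_integral - k / 2) + 2 * s * rho * (k / 2) by ring.
rewrite addrC lerD2r; apply: le_trans h3; rewrite mulrA; apply: le_trans h1.
rewrite mulrBr lerBrDr; apply: le_trans yL; rewrite (mulrC L) lerD2r//.
Qed.

End arm_paths.

(** * A rectangle inside a convex set *)

Section planar_rectangle.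
Context (R : realType) (d : nat).
Implicit Types (K : set 'rV[R]_d) (u v w : 'rV[R]_d).

Lemma dot_continuous u : continuous (dot u : 'rV[R]_d -> R).
Proof.
rewrite /dot; apply: (@continuous_big _ _ +%R).
  exact: add_continuous.
move=> i _ w.
apply: (@continuousM _ _ (cst (u ord0 i)) (fun v : 'rV[R]_d => v ord0 i)).
  exact: cst_continuous.
exact: coord_continuous.
Qed.

Lemma convex_set_comb K u v t : convex_set (K : set (convex_lmodType 'rV[R]_d)) ->
  K u -> K v -> 0 <= t <= 1 -> K (t *: u + (1 - t) *: v).
Proof.
move=> cK Ku Kv /andP[t0 t1].
have := @cK u v (Itv01 t0 t1) (mem_set Ku) (mem_set Kv).
by rewrite inE.
Qed.

Lemma convex_set_triangle K u v w a b : convex_set (K : set (convex_lmodType 'rV[R]_d)) ->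
  K w -> K (w + u) -> K (w + v) -> 0 <= a -> 0 <= b -> a + b <= 1 ->
  K (w + a *: u + b *: v).
Proof.
move=> cK Kw Ku Kv a0 b0 ab1.
have [ab0|ab0] := eqVneq (a + b) 0.
  have -> : a = 0 by lra.
  have -> : b = 0 by lra.
  by rewrite !scale0r !addr0.
have abp : 0 < a + b by rewrite lt_neqAle eq_sym ab0 addr_ge0.
have t01 : 0 <= a / (a + b) <= 1.
  by rewrite divr_ge0 ?(ltW abp)//= ler_pdivrMr// mul1r lerDl.
have h := convex_set_comb cK Ku Kv t01.
have ab01 : 0 <= a + b <= 1 by rewrite ltW.
have := convex_set_comb cK h Kw ab01; congr (K _).
apply/rowP => i; rewrite !mxE; field.
by rewrite gt_eqF.
Qed.

(** The endpoints are the points of [K] where the linear form [dot u] is least and greatest. Its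
    contrapositive provides three non-collinear points. *)
Lemma collinear_segment K : K !=set0 -> compact K ->
  convex_set (K : set (convex_lmodType 'rV[R]_d)) ->
  (forall u v w, K w -> K (w + u) -> K (w + v) -> u != 0 -> exists t, v = t *: u) ->
  exists u v, K = segment u v.
Proof.
move=> K0 cK convK col; have [w Kw] := K0.
have [[z [Kz zw]]|none] := pselect (exists z, K z /\ z != w); last first.
  exists w, w; apply/seteqP; split => z.
    move=> Kz; have zw : z = w by apply/eqP; apply/negPn/negP => zw; apply: none; exists z.
    exists 0; first by rewrite /= in_itv/= lexx ler01.
    by rewrite scale0r addr0 subr0 scale1r.
  by move=> [t _ <-]; rewrite -scalerDl subrK scale1r.
pose u := z - w.
have u0 : u != 0 by rewrite subr_eq0.
have uu0 : 0 < dot u u.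
  by rewrite lt_neqAle dot_ge0 andbT eq_sym; apply: contra_neq u0; exact: dot_eq0.
pose f := dot u.
have cf : {within K, continuous f} by apply: continuous_subspaceT; exact: dot_continuous.
have [a /set_mem Ka amin] := compact_EVT_min K0 cK cf.
have [b /set_mem Kb bmax] := compact_EVT_max K0 cK cf.
have KE y : K y -> y = w + ((f y - f w) / dot u u) *: u.
  move=> Ky; have [|||t yE] := col u (y - w) w Kw; rewrite ?subrKC//.
  have -> : f y - f w = t * dot u u by rewrite /f -dotBr yE dotZr.
  by rewrite mulfK ?gt_eqF// -yE subrKC.
have fzw : f w < f z by rewrite -subr_gt0 /f -dotBr.
have fab : f a < f b.
  by apply: le_lt_trans (lt_le_trans fzw _); [apply: amin|apply: bmax]; exact: mem_set.
exists a, b; apply/seteqP; split => y.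
  move=> Ky; exists ((f y - f a) / (f b - f a)).
    have fa := amin y (mem_set Ky); have fb := bmax y (mem_set Ky).
    have fab' : 0 < f b - f a by rewrite subr_gt0.
    rewrite /= in_itv/= divr_ge0 ?subr_ge0 ?(ltW fab)//= ler_pdivrMr// mul1r.
    by rewrite lerD2r.
  have eab : f b - f a != 0 by rewrite subr_eq0 gt_eqF.
  have eu : dot u u != 0 by rewrite gt_eqF.
  move: (KE _ Ka) (KE _ Kb) (KE _ Ky) eab eu.
  move: (f a) (f b) (f y) (f w) (dot u u) => A B Y W D -> -> -> eab eu.
  apply/rowP => i; rewrite !mxE; field.
  by rewrite eab eu.
move=> [t]; rewrite /= in_itv/= => t01 <-; rewrite addrC.
exact: convex_set_comb.
Qed.

(** The origin is the centroid of a triangle in [K], [e1] is along one side and [e2] along the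
    orthogonal part of another. The ordinate goes down to -1 because the point [(0, - s)] must be in
    [K] too. *)
Lemma convex_rectangle K (N : R) : 0 <= N -> K !=set0 -> compact K ->
  convex_set (K : set (convex_lmodType 'rV[R]_d)) ->
  (forall u v, K <> segment u v) ->
  exists c e1 e2 rho, [/\ [/\ 0 < rho, rho * (N + 3) <= 1, dot e1 e2 = 0,
    dot e1 e1 = rho ^+ 2 & dot e2 e2 = rho ^+ 2] &
    forall a b, 0 <= a <= N -> - 1 <= b <= 1 -> K (pl c e1 e2 a b)].
Proof.
move=> N0 K0 cK convK nseg.
have [u [v [w [Kw Ku Kv [u0 uv]]]]] : exists u v w,
    [/\ K w, K (w + u), K (w + v) & u != 0 /\ forall t, v <> t *: u].
  apply: contrapT => H; have [|u [v /nseg//]] := collinear_segment K0 cK convK.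
  move=> u v w Kw Ku Kv u0; apply: contrapT => /forallNP nt; apply: H.
  by exists u, v, w.
have uu0 : 0 < dot u u.
  by rewrite lt_neqAle dot_ge0 andbT eq_sym; apply: contra_neq u0; exact: dot_eq0.
pose l := dot u v / dot u u; pose q := v - l *: u.
have uq : dot u q = 0 by rewrite dotBr dotZr /l mulfVK ?subrr// gt_eqF.
have q0 : q != 0 by rewrite subr_eq0; apply/eqP; exact: uv.
have qq0 : 0 < enorm q.
  by rewrite lt_neqAle enorm_ge0 andbT eq_sym; apply: contra_neq q0; exact: enorm0_eq0.
have un0 : 0 < enorm u.
  by rewrite lt_neqAle enorm_ge0 andbT eq_sym; apply: contra_neq u0; exact: enorm0_eq0.
have iu0 : 0 < (enorm u)^-1 by rewrite invr_gt0.
have iq0 : 0 < (enorm q)^-1 by rewrite invr_gt0.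
pose M := (enorm u)^-1 + (1 + `|l|) / enorm q + 1.
have l0 : 0 <= `|l| / enorm q by rewrite divr_ge0// ltW.
have ME : M = (enorm u)^-1 + (enorm q)^-1 + `|l| / enorm q + 1.
  by rewrite /M mulrDl mul1r addrA.
have M1 : 1 <= M by rewrite ME; lra.
have N3 : 0 < N + 3 by lra.
have M0 : 0 < M by lra.
(* The two coefficients at the centroid are 1/3; this [rho] keeps their total change below 1/6, so
   the point stays in the triangle. *)
pose rho := (6 * (N + 3) * M)^-1.
have rho0 : 0 < rho by rewrite invr_gt0 !mulr_gt0.
have rM : rho * (N + 3) * M = 6^-1 by rewrite /rho; field; rewrite !gt_eqF.
have rN0 : 0 < rho * (N + 3) by rewrite mulr_gt0.
exists (w + 3^-1 *: u + 3^-1 *: v), ((rho / enorm u) *: u), ((rho / enorm q) *: q), rho.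
split; first split => //.
- have := ler_wpM2l (ltW rN0) M1; lra.
- by rewrite dotZl dotZr uq !mulr0.
- by rewrite dotZl dotZr -enorm_sqr; field; rewrite gt_eqF.
- by rewrite dotZl dotZr -enorm_sqr; field; rewrite gt_eqF.
move=> a b /andP[a0 aN] /andP[b0 b1].
pose A := a * rho / enorm u; pose B := b * rho / enorm q.
have -> : pl (w + 3^-1 *: u + 3^-1 *: v) ((rho / enorm u) *: u) ((rho / enorm q) *: q) a b =
    w + (3^-1 + A - B * l) *: u + (3^-1 + B) *: v.
  by rewrite /pl /q /A /B; apply/rowP => i; rewrite !mxE; ring.
have ru : 0 <= rho * (enorm u)^-1 by rewrite mulr_ge0// ltW.
have rq : 0 <= rho * (enorm q)^-1 by rewrite mulr_ge0// ltW.
have rl : 0 <= rho * (`|l| / enorm q) by rewrite mulr_ge0// ltW.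
have A0 : 0 <= A by rewrite /A -mulrA mulr_ge0.
have A1 : A <= (N + 3) * (rho * (enorm u)^-1).
  by rewrite /A -mulrA; apply: ler_wpM2r => //; lra.
have Bn : `|B| <= rho * (enorm q)^-1.
  rewrite /B -mulrA normrM (ger0_norm rq) -[leRHS]mul1r; apply: ler_wpM2r => //.
  by rewrite ler_norml b0.
have Bln : `|B * l| <= rho * (`|l| / enorm q).
  rewrite normrM; apply: le_trans (ler_wpM2r (normr_ge0 l) Bn) _.
  by rewrite -mulrA [_ * `|l|]mulrC.
move: Bn Bln; rewrite !ler_norml => /andP[B1 B2] /andP[B3 B4].
have tot : (N + 3) * (rho * (enorm u)^-1) + rho * (enorm q)^-1 + rho * (`|l| / enorm q) <= 6^-1.
  rewrite -rM ME.
  have h1 : rho * (enorm q)^-1 <= (N + 3) * (rho * (enorm q)^-1).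
    by rewrite -[leLHS]mul1r; apply: ler_wpM2r => //; lra.
  have h2 : rho * (`|l| / enorm q) <= (N + 3) * (rho * (`|l| / enorm q)).
    by rewrite -[leLHS]mul1r; apply: ler_wpM2r => //; lra.
  have -> : rho * (N + 3) * ((enorm u)^-1 + (enorm q)^-1 + `|l| / enorm q + 1) =
    (N + 3) * (rho * (enorm u)^-1) + (N + 3) * (rho * (enorm q)^-1) +
    (N + 3) * (rho * (`|l| / enorm q)) + rho * (N + 3) by ring.
  lra.
have NU : 0 <= (N + 3) * (rho * (enorm u)^-1) by rewrite mulr_ge0// ltW.
by apply: convex_set_triangle => //; lra.
Qed.

End planar_rectangle.

(** * Two hypotheses *)

(** By induction [(1 + t)^k (1 - k t) <= 1]; take [k = n] and [n t = 1/2]. *)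
Lemma expr_one_plus_half_le2 (R : realFieldType) (n : nat) (x : R) :
  (0 < n)%N -> 0 <= x -> x <= 1 + (2 * n%:R)^-1 -> x ^+ n <= 2.
Proof.
move=> n0 x0 xn; have n0' : 0 < n%:R :> R by rewrite ltr0n.
pose t : R := (2 * n%:R)^-1.
have t0 : 0 <= t by rewrite invr_ge0 mulr_ge0.
have H k : (1 + t) ^+ k * (1 - k%:R * t) <= 1.
  elim: k => [|k IH]; first by rewrite expr0 mul0r subr0 mulr1.
  apply: le_trans IH; rewrite exprSr -mulrA ler_wpM2l ?exprn_ge0 ?addr_ge0//.
  have : 0 <= k%:R * (t * t) by rewrite !mulr_ge0.
  by have := mulr_ge0 t0 t0; rewrite -natr1; nra.
have := H n; have -> : n%:R * t = 2^-1 by rewrite /t; field; rewrite gt_eqF.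
have : x ^+ n <= (1 + t) ^+ n by rewrite ler_pXn2r ?nnegrE ?addr_ge0.
by move: (x ^+ n) ((1 + t) ^+ n) => y z; lra.
Qed.

Section arm_minimax.
Context (R : realType) (d : nat) (c e1 e2 : 'rV[R]_d) (rho : R).
Hypotheses (rho0 : 0 < rho) (e12 : dot e1 e2 = 0)
  (e11 : dot e1 e1 = rho ^+ 2) (e22 : dot e2 e2 = rho ^+ 2).
Variables (N eps m p beta s b eta1 eta2 : R).
Hypotheses (m0 : 0 < m) (m1 : m <= 1) (p1 : 1 <= p) (beta1 : 1 <= beta) (b1 : 1 <= b)
  (eps0 : 0 <= eps).
Hypothesis NE : N = 192 * p * 5 `^ (p - 1) / m.
Hypothesis rhoN : rho * (N + 3) <= 1.
Hypothesis s_def : s = (2 * (N + 3)) `^ (- beta) / 8.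
Hypotheses (eta10 : 0 <= eta1) (eta20 : 0 <= eta2) (etaN : eta1 + eta2 <= N^-1).
Hypothesis eta2_eps : eta2 = 0 -> eps = 0.
Local Notation c' := ((64 * p * (N + 3) `^ p)^-1).
Hypothesis eps_small : eps <= c' * s ^+ 3.

Let N192 : 192 <= N := N_ge192 m0 m1 p1 NE.
Let N0 : 0 < N. Proof. have := N192; lra. Qed.

(** The first two quotients are expanded to second order. Their linear parts are [- eta1] and
    [eta1 + eta2], so [eta1] survives only squared. The third quotient is 0, also for [eta2 = 0]. *)
Lemma arm_weight_chi2 :
  \sum_k arm_weight N 0 0 k ^+ 2 / arm_weight N eta1 eta2 k <=
    1 + (eta2 + N * eta1 ^+ 2 + 2 * (eta1 + eta2) ^+ 2).
Proof.
rewrite !big_ord_recl big_ord0 /arm_weight/=.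
have NV : N^-1 <= 192^-1 by rewrite lef_pV2 ?posrE.
have NV0 : 0 < N^-1 by rewrite invr_gt0.
rewrite !subr0 !addr0 expr0n/= mul0r addr0.
set h := eta1 + eta2.
have -> : 1 - N^-1 - eta1 - eta2 = 1 - N^-1 - h by rewrite /h; lra.
have h0 : 0 <= h by rewrite addr_ge0.
have hN : h <= N^-1 by exact: etaN.
have a1 : N^-1 ^+ 2 / (N^-1 + eta1) <= N^-1 - eta1 + N * eta1 ^+ 2.
  have q0 : 0 < N^-1 + eta1 by rewrite ltr_wpDr.
  rewrite ler_pdivrMr//.
  have -> : (N^-1 - eta1 + N * eta1 ^+ 2) * (N^-1 + eta1) = N^-1 ^+ 2 + N * eta1 ^+ 3.
    by field; rewrite gt_eqF.
  by rewrite lerDl mulr_ge0 ?exprn_ge0 ?(ltW N0).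
have a2 : (1 - N^-1) ^+ 2 / (1 - N^-1 - h) <= 1 - N^-1 + h + 2 * h ^+ 2.
  have q0 : 0 < 1 - N^-1 - h by lra.
  rewrite ler_pdivrMr//.
  have -> : (1 - N^-1 + h + 2 * h ^+ 2) * (1 - N^-1 - h) =
    (1 - N^-1) ^+ 2 + h ^+ 2 * (1 - 2 * N^-1 - 2 * h) by ring.
  by rewrite lerDl mulr_ge0 ?sqr_ge0//; lra.
move: a1 a2; move: (_ / _) (_ / _) => x y; rewrite /h; lra.
Qed.

Lemma arm_minimax_lb (K : set 'rV[R]_d) (a sigma : R) (n : nat) :
  (forall a' b', 0 <= a' <= N -> 0 <= b' <= 1 -> K (pl c e1 e2 a' b')) ->
  0 < a -> a <= N^-1 / 4 -> a * (2 * eps) `^ b <= eta2 / 2 -> sigma <= rho / 2 ->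
  (0 < n)%N -> eta2 + N * eta1 ^+ 2 + 2 * (eta1 + eta2) ^+ 2 <= (2 * n%:R)^-1 ->
  ((s * rho * (c' * (eta1 + eps) / 4 * (rho / 2) `^ beta) / 4)%:E <=
    minimax_risk m p beta K a b sigma n (pl c e1 e2 0 (- s)) (pl c e1 e2 0 s))%E.
Proof.
move=> HK a0 aN aeps sr n0 chi; have rN := rhoN.
have N1 : 0 < N^-1 <= 192^-1 by rewrite invr_gt0 N0 lef_pV2 ?posrE.
have [NV0 NV1] := andP N1.
have NV : 0 + 0 <= N^-1 by rewrite addr0 ltW.
have [c00 c64] := andP (arm_gain_bounds m0 m1 p1 NE).
have [s0 s8] := andP (arm_scale_bounds m0 m1 p1 beta1 NE s_def).
have eps08 : 0 <= eps <= 8^-1.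
  rewrite eps0/=; apply: le_trans eps_small _.
  have s3 : s ^+ 3 <= 1 by rewrite exprn_ile1 ?(ltW s0)//; lra.
  rewrite -[leRHS]mulr1; apply: ler_pM => //; first exact: ltW.
    by rewrite exprn_ge0// ltW.
  by apply: le_trans c64 _; lra.
have w_ge0 x y : 0 <= x -> 0 <= y -> x + y <= N^-1 -> forall k, 0 <= arm_weight N x y k.
  move=> x0 y0 xyN k; rewrite /arm_weight; case: (val k) => [|[|_]]//.
    by rewrite addr_ge0// ltW.
  lra.
have [mu0 mix0] := mixture_exists (arms c e1 e2 N eps) (w_ge0 0 0 (lexx 0) (lexx 0) NV)
  (arm_weight_sum N 0 0).
have [mu1 mix1] := mixture_exists (arms c e1 e2 N eps) (w_ge0 _ _ eta10 eta20 etaN)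
  (arm_weight_sum N eta1 eta2).
have [fin gap] := fdtm_arm_gap rho0 e12 e11 e22 m0 m1 p1 beta1 eps08 NE eta10 eta20 etaN
  mix0 mix1 eta2_eps s_def eps_small.
have e08 : 0 <= (0 : R) <= 8^-1 by rewrite lexx invr_ge0 ler0n.
have b0 : b != 0 by rewrite gt_eqF// (lt_le_trans _ b1).
have aeps0 : a * (2 * 0) `^ b <= 0 / 2 by rewrite mulr0 powR0// mulr0 mul0r.
have mc0 : measure_class m p K a b sigma mu0.
  by apply: (arms_measure_class rho0 e12 e11 e22 N192 e08 (lexx 0) (lexx 0) NV
    (mixture_arms_eps0 mix0)).
have mc1 : measure_class m p K a b sigma mu1.
  by apply: (arms_measure_class rho0 e12 e11 e22 N192 eps08 eta10 eta20 etaN mix1).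
apply: (minimax_risk_two_points mc0 mc1 mix0 mix1 _ _ _ fin gap).
- move=> k; rewrite /arm_weight; case: (val k) => [|[|_]]//; have := eta10; have := etaN; lra.
- apply: expr_one_plus_half_le2 => //.
    by apply: sumr_ge0 => k _; rewrite divr_ge0 ?sqr_ge0//; exact: w_ge0.
  by apply: le_trans arm_weight_chi2 _; rewrite lerD2l.
have r0 : 0 <= eta1 + eps by rewrite addr_ge0.
apply: mulr_ge0; first exact/ltW/mulr_gt0.
apply: mulr_ge0; last exact: powR_ge0.
by apply: divr_ge0 => //; apply: mulr_ge0 => //; exact: ltW.
Qed.

End arm_minimax.

(** The denominator [T] satisfies [T^2 = n] if [b <= 2] and [T^b = n] otherwise; the choice with the
    larger effect under the chi-square constraint is taken. *)
Lemma perturbation_exists (R : realType) (N c2 b a : R) (n : nat) :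
  192 <= N -> 0 < c2 -> c2 <= 8^-1 -> 1 <= b -> 0 < a -> a <= N^-1 / 8 -> (0 < n)%N ->
  exists eta1 eta2 eps : R, [/\ 0 <= eta1, 0 <= eta2, 0 <= eps & eta1 + eta2 <= N^-1] /\
    [/\ eta2 = 0 -> eps = 0, eps <= c2, a * (2 * eps) `^ b <= eta2 / 2,
        eta2 + N * eta1 ^+ 2 + 2 * (eta1 + eta2) ^+ 2 <= (2 * n%:R)^-1 &
        Num.min (N^-1 / 2) c2 / n%:R `^ Num.min b^-1 2^-1 <= eta1 + eps].
Proof.
move=> N192 c20 c28 b_ge1 a0 aN n0.
have N0 : 0 < N by lra.
have iN0 : 0 < N^-1 by rewrite invr_gt0.
have b0 : 0 < b by lra.
have n0' : 1 <= n%:R :> R by rewrite ler1n.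
have np : 0 < n%:R :> R by rewrite ltr0n.
set q := Num.min _ c2; set T := n%:R `^ _.
have T1 : 1 <= T.
  rewrite /T -[leLHS](powRr0 n%:R); apply: ler_powR => //.
  by rewrite le_min !invr_ge0 (ltW b0) ler0n.
have T0 : 0 < T by apply: lt_le_trans T1.
have qT : q / T <= N^-1 / 2 / T /\ q / T <= c2 / T.
  by split; apply: ler_wpM2r; rewrite ?invr_ge0 ?(ltW T0)// ge_min lexx ?orbT.
have Nn0 : 0 < N^-1 / n%:R by rewrite divr_gt0.
have i2n : (2 * n%:R)^-1 = n%:R^-1 / 2 :> R by field; rewrite gt_eqF.
have in0 : 0 < n%:R^-1 :> R by rewrite invr_gt0.
have in1 : n%:R^-1 <= 1 :> R by rewrite invf_le1.
have iN192 : N^-1 <= 192^-1 by rewrite lef_pV2 ?posrE.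
have [b2|b2] := leP b 2.
  have T2 : T ^+ 2 = n%:R.
    rewrite /T min_r; last by rewrite lef_pV2 ?posrE.
    by rewrite powR12_sqrt// sqr_sqrtr.
  have e2E : (N^-1 / 2 / T) ^+ 2 = N^-1 ^+ 2 / 4 * n%:R^-1.
    by rewrite -T2; field; rewrite !gt_eqF.
  have NN : N^-1 ^+ 2 <= 192^-1 * N^-1 by rewrite expr2 ler_pM2r.
  (* No third arm. The main chi-square term [N * eta1 ^+ 2] equals [N^-1 / (4 n)]. *)
  exists (N^-1 / 2 / T), 0, 0; split; split => //.
  - by rewrite !divr_ge0// ltW.
  - rewrite addr0 ler_pdivrMr//; apply: (@le_trans _ _ (N^-1 * 1)); first by lra.
    by rewrite ler_pM2l.
  - exact: ltW.
  - by rewrite mulr0 powR0 ?gt_eqF// mulr0 mul0r.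
  - rewrite !addr0 add0r e2E i2n.
    have -> : N * (N^-1 ^+ 2 / 4 * n%:R^-1) = N^-1 / 4 * n%:R^-1.
      by field; rewrite !gt_eqF.
    rewrite mulrA -mulrDl mulrC ler_pM2l//; lra.
  - by rewrite addr0; case: qT.
have Tb : T `^ b = n%:R.
  rewrite /T min_l; last by rewrite lef_pV2 ?posrE ?(ltW b2).
  by rewrite -powRrM mulVf ?gt_eqF// powRr1// ltW.
(* Since [2 c2 <= 1], [a (2 eps)^b <= a / n], and [a <= N^-1 / 8] makes this at most [eta2 / 2]. *)
exists 0, (N^-1 / 4 / n%:R), (c2 / T); split; split => //.
- by rewrite !divr_ge0// ltW.
- by rewrite divr_ge0// ltW.
- rewrite add0r ler_pdivrMr//; apply: (@le_trans _ _ (N^-1 * 1)); first by lra.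
  by rewrite ler_pM2l.
- by move=> /eqP; rewrite gt_eqF// !divr_gt0.
- by rewrite ler_pdivrMr// ler_peMr// ltW.
- have -> : 2 * (c2 / T) = (2 * c2) / T by ring.
  rewrite powRM; last 2 first.
  - by rewrite mulr_ge0// ltW.
  - by rewrite invr_ge0 ltW.
  have -> : T^-1 `^ b = n%:R^-1.
    by rewrite -(powR_inv1 (ltW T0)) -powRrM mulrC powRrM Tb powR_inv1// ltW.
  have c2b : (2 * c2) `^ b <= 1.
    rewrite -[leRHS](powRr0 (2 * c2)) ger_powR//; last exact: ltW.
    by apply/andP; split; [rewrite mulr_gt0|lra].
  have -> : N^-1 / 4 / n%:R / 2 = N^-1 / 8 * (1 * n%:R^-1) by field; rewrite !gt_eqF.
  apply: ler_pM => //; first exact: ltW.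
    by rewrite mulr_ge0 ?powR_ge0// ltW.
  by rewrite ler_pM2r.
- rewrite !add0r expr0n/= mulr0 addr0 i2n.
  have h2 : (N^-1 / 4 / n%:R) ^+ 2 <= N^-1 / 4 / n%:R.
    rewrite expr2 ler_piMl//; first by rewrite !divr_ge0// ltW.
    rewrite ler_pdivrMr//; lra.
  have h3 : N^-1 / 4 / n%:R <= 8^-1 * n%:R^-1 by rewrite ler_pM2r//; lra.
  lra.
by rewrite add0r; case: qT.
Qed.

(** [a0], [C] and [n0] precede [d] and [K], while [sigma0] follows [K]: d_mu is at most the diameter
    of [K] on [K], so the admissible [sigma] scale with [K]. *)
Theorem theorem11 (R : realType) (m p beta b : R)
    (m_gt0 : 0 < m) (m_le1 : m <= 1) (p_ge1 : 1 <= p) (beta_ge1 : 1 <= beta)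
    (b_ge1 : 1 <= b) :
  exists (a0 C : R) (n0 : nat), [/\ 0 < a0, 0 < C, (0 < n0)%N &
    forall (d : nat) (K : set 'rV[R]_d),
      K !=set0 -> compact K ->
      convex_set (K : set (convex_lmodType 'rV[R]_d)) ->
      (forall u v : 'rV[R]_d, K <> segment u v) ->
      exists x y : 'rV[R]_d, [/\ K x, K y, x != y &
        exists2 sigma0 : R, 0 < sigma0 &
          forall (a sigma : R) (n : nat),
            0 < a -> a <= a0 -> 0 < sigma -> sigma <= sigma0 -> (n0 <= n)%N ->
            ((C * enorm (x - y) `^ (beta + 1)
                / n%:R `^ Num.min b^-1 2^-1)%:E
             <= minimax_risk m p beta K a b sigma n x y)%E]].
Proof.
pose N := 192 * p * 5 `^ (p - 1) / m.
pose s := (2 * (N + 3)) `^ (- beta) / 8.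
pose c' := (64 * p * (N + 3) `^ p)^-1.
have NE : N = 192 * p * 5 `^ (p - 1) / m by [].
have s_def : s = (2 * (N + 3)) `^ (- beta) / 8 by [].
have c'E : (64 * p * (N + 3) `^ p)^-1 = c' by [].
have N192 := N_ge192 m_gt0 m_le1 p_ge1 NE.
have [c00 c64] := andP (arm_gain_bounds m_gt0 m_le1 p_ge1 NE).
have [s0 s8] := andP (arm_scale_bounds m_gt0 m_le1 p_ge1 beta_ge1 NE s_def).
rewrite -/c' in c00 c64.
have N0 : 0 < N by lra.
have iN0 : 0 < N^-1 by rewrite invr_gt0.
have b0 : 0 < b by lra.
clearbody N s c'.
pose c2 := c' * s ^+ 3.
have c20 : 0 < c2 by rewrite mulr_gt0// exprn_gt0.
have c28 : c2 <= 8^-1.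
  have s3 : s ^+ 3 <= 1 by rewrite exprn_ile1 ?(ltW s0)//; lra.
  rewrite -[leRHS]mulr1; apply: ler_pM => //; first exact: ltW.
    by rewrite exprn_ge0// ltW.
  lra.
pose q := Num.min (N^-1 / 2) c2.
have q0 : 0 < q by rewrite lt_min divr_gt0.
(* The 16 is 4 from the two-point bound times 4 from the middle half of the tent, and [2 ^ (- beta)]
   comes from the least cost [(rho / 2) ^ beta]. The distance between the two points is
   [2 s rho <= rho]. *)
pose C := s * c' * q * 2 `^ (- beta) / 16.
have C0 : 0 < C by rewrite !mulr_gt0 ?powR_gt0 ?invr_gt0.
exists (N^-1 / 8), C, 1%N; split => //; first by rewrite divr_gt0.
move=> d K K0 cK convK nseg.
have [c [e1 [e2 [rho [[rho0 rhoN e12 e11 e22] HK]]]]] :=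
  convex_rectangle (ltW N0) K0 cK convK nseg.
have xyE : enorm (pl c e1 e2 0 (- s) - pl c e1 e2 0 s) = 2 * s * rho.
  rewrite pl_sub subrr scale0r add0r enormZ enormE e22 sqrtr_sqr.
  rewrite (gtr0_norm rho0) (_ : - s - s = - (2 * s)); last by ring.
  by rewrite normrN gtr0_norm// mulr_gt0.
exists (pl c e1 e2 0 (- s)), (pl c e1 e2 0 s); split.
- by apply: HK; rewrite ?lexx ?(ltW N0)//; apply/andP; split; lra.
- by apply: HK; rewrite ?lexx ?(ltW N0)//; apply/andP; split; lra.
- rewrite -subr_eq0; apply/eqP => xy0; move: xyE; rewrite xy0 enorm0 => /esym/eqP.
  by rewrite gt_eqF// !mulr_gt0.
exists (rho / 2); first by rewrite divr_gt0.
move=> a sigma n a0 aN sigma0 sr n0.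
have n0' : 1 <= n%:R :> R by rewrite ler1n.
have np : 0 < n%:R :> R by rewrite ltr0n.
have HK0 a' b' : 0 <= a' <= N -> 0 <= b' <= 1 -> K (pl c e1 e2 a' b').
  by move=> h /andP[h1 h2]; apply: HK => //; apply/andP; split; lra.
have aN4 : a <= N^-1 / 4 by lra.
set T := n%:R `^ _.
have T0 : 0 < T by rewrite powR_gt0.
rewrite xyE.
have [eta1 [eta2 [eps [[eta10 eta20 eps0 etaN] [eta2_eps eps_small aeps chi qr]]]]] :=
  perturbation_exists N192 c20 c28 b_ge1 a0 aN n0.
rewrite -/T -/q in qr.
rewrite /c2 -c'E in eps_small.
apply: le_trans _ (arm_minimax_lb rho0 e12 e11 e22 m_gt0 m_le1 p_ge1 beta_ge1 b_ge1
  eps0 NE rhoN s_def eta10 eta20 etaN eta2_eps eps_small HK0 a0 aN4 aeps sr n0 chi).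
rewrite lee_fin c'E /C.
have -> : s * rho * (c' * (eta1 + eps) / 4 * (rho / 2) `^ beta) / 4 =
    s * c' * (2 `^ (- beta) / 16) * (rho `^ (beta + 1) * (eta1 + eps)).
  have -> : rho `^ (beta + 1) = rho `^ beta * rho.
    rewrite powRD; last by rewrite (gt_eqF rho0) implybT.
    by rewrite powRr1// ltW.
  by rewrite powRM ?(ltW rho0) ?invr_ge0// -(powR_inv1 (ler0n _ 2)) -powRrM mulN1r; field.
have -> : s * c' * q * 2 `^ (- beta) / 16 * (2 * s * rho) `^ (beta + 1) / T =
    s * c' * (2 `^ (- beta) / 16) * ((2 * s * rho) `^ (beta + 1) * (q / T)).
  by field; rewrite gt_eqF.
apply: ler_wpM2l.
  apply: mulr_ge0; first by apply: mulr_ge0; exact: ltW.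
  by apply: divr_ge0 => //; exact: powR_ge0.
apply: ler_pM => //.
- exact: powR_ge0.
- by apply: divr_ge0; exact: ltW.
have be0 : 0 <= beta + 1 by lra.
have sr2 : 2 * s * rho <= rho by rewrite -[leRHS]mul1r ler_pM2r//; lra.
by apply: (ge0_ler_powR be0) => //; rewrite nnegrE ?mulr_ge0// ltW.
Qed.
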